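(* Let $\tau\in\mathbb{R}$ with $\tau\neq -1$. For every closed ball $B\subseteq\mathbb{R}^2$ there exist a Borel probability measure $\mu$ on $\mathbb{R}^2$ with support contained in $E_{\ast}(\tau)\cap B$ and a constant $C>0$ such that $$|\widehat{\mu}(\xi)|\le C\,|\xi|^{-2/(1+\tau)}\exp\!\big(\ln|\xi|/\ln\ln|\xi|\big)\quad\text{for all }\xi\in\mathbb{R}^2\text{ with }|\xi|>e.$$
   Context: Identify $\mathbb{R}^2$ with $\mathbb{C}$, so that for $q,x\in\mathbb{R}^2$ the product $qx$ is complex multiplication and $\mathbb{Z}^2$ is the ring of Gaussian integers $\mathbb{Z}+i\mathbb{Z}$. For $x\in\mathbb{R}^2$, $|x|=\max(|x_1|,|x_2|)$. The inner product is $\langle\xi,x\rangle=\xi_1x_1+\xi_2x_2$, and the Fourier transform of a finite Borel measure $\mu$ on $\mathbb{R}^2$ is $\widehat{\mu}(\xi)=\int e^{-2\pi i\langle\xi,x\rangle}\,d\mu(x)$. Define $$E_{\ast}(\tau)=\{x\in\mathbb{R}^2: |qx-r|\le|q|^{-\tau}\text{ for infinitely many }(q,r)\in\mathbb{Z}^2\times\mathbb{Z}^2 \text{ with } q\neq 0\}.$$ *)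

(* Defs.v *)
(* R^2 is modelled as (R * R) with the
   product sigma-algebra of the Borel sigma-algebras on R (= Borel sets of R^2). *)
From HB Require Import structures.
From mathcomp Require Import all_boot all_order all_algebra.
From mathcomp Require Import all_classical all_reals all_analysis.
Set Implicit Arguments. Unset Strict Implicit. Unset Printing Implicit Defensive.
Import Order.TTheory GRing.Theory Num.Theory.
Import numFieldNormedType.Exports.
Local Open Scope classical_set_scope.
Local Open Scope ring_scope.

Section Defs.
Variable R : realType.

Definition maxnorm (x : R * R) : R := Num.max `|x.1| `|x.2|.

Definition dotp (xi x : R * R) : R := xi.1 * x.1 + xi.2 * x.2.

(* complex multiplication q x, q a Gaussian integer *)
Definition gmul (q : int * int) (x : R * R) : R * R :=
  (q.1%:~R * x.1 - q.2%:~R * x.2, q.1%:~R * x.2 + q.2%:~R * x.1).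

Definition gnorm (q : int * int) : R := Num.max `|q.1%:~R| `|q.2%:~R|.

Definition Estar (tau : R) : set (R * R) :=
  [set x | ~ finite_set
      [set qr : (int * int) * (int * int) |
         qr.1 != (0, 0) /\
         maxnorm (gmul qr.1 x - (qr.2.1%:~R, qr.2.2%:~R)) <= gnorm qr.1 `^ (- tau)]].

Definition cball (c : R * R) (r : R) : set (R * R) :=
  [set y | maxnorm (y - c) <= r].

Definition msupport (mu : {measure set (R * R) -> \bar R}) : set (R * R) :=
  [set x | forall e : R, 0 < e -> (0%E < mu [set y | (maxnorm (y - x) < e)%R])%E].

Definition fourier_re (mu : {measure set (R * R) -> \bar R}) (xi : R * R) : R :=
  (\int[mu]_(x in setT) cos (2 * pi * dotp xi x))%R.
Definition fourier_im (mu : {measure set (R * R) -> \bar R}) (xi : R * R) : R :=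
  (- \int[mu]_(x in setT) sin (2 * pi * dotp xi x))%R.
Definition fourier_abs (mu : {measure set (R * R) -> \bar R}) (xi : R * R) : R :=
  Num.sqrt (fourier_re mu xi ^+ 2 + fourier_im mu xi ^+ 2).

End Defs.

(* Main.v *)
Require Import Defs.
From HB Require Import structures.
From mathcomp Require Import all_boot all_order all_algebra zify ring lra.
From mathcomp Require Import all_classical all_reals all_analysis.
From mathcomp Require Import measurable_realfun complex.
Import Order.TTheory GRing.Theory Num.Theory.
Import numFieldNormedType.Exports.
Import Normc.
Local Open Scope complex_scope.
Local Open Scope classical_set_scope.
Local Open Scope ring_scope.

(** For [tau <= 0] every point lies in [E_*(tau)], so let [tau > 0]. The measure is a weak
    limit of weights on grids [N^-1 Z^2], and every Fourier estimate is made on the grid,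
    uniformly in [N].

    Start from a smooth weight on a small square, with Fourier transform [O(|xi|^-s)], and
    multiply it successively by kernels [F_j], where [F_j x] is the average over the
    Gaussian primes [q] with [2^j <= |q| < 2^(j+1)] (Euclidean norm, one per class of
    associates) of a B-spline of width about [2^(-j tau)] around [Z^2], evaluated at [q x].
    A point where none of the kernels vanishes lies in [E_*(tau)].

    [F_j] has mean 1, and its other frequencies are the [conj q * m]. A nonzero [k] has a
    bounded number of prime divisors in the shell, by unique factorisation, so each
    frequency receives [O(1/#primes)] of the mass. As there are at least [4^j / j^2] primes
    for infinitely many [j], multiplication by [F_j] changes the Fourier transform by
    [O(j^2 4^-j)], and rapidly less once [|xi|] exceeds [2^(j (1 + tau))]. This is
    [|xi|^(-2/(1+tau))] up to a power of [ln |xi|], which the exponential factor absorbs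
    with any prescribed constant if [j] is large; choosing the successive [j] sparse makes
    the changes summable. *)

(** * Gaussian integers *)

(** On a grid every measure is a finite sum and every Fourier expansion is orthogonality of
    characters modulo [N]. The price is that a frequency is only seen modulo [N]: decay can be
    claimed only for [2 * |xi| <= N]. The [k]-th weight therefore carries the first [k] kernels on a
    grid whose [N] is chosen after these kernels and tends to infinity with [k].

    A pointwise bound on the Fourier transform would not support the induction: spreading the mass
    of a kernel thinly over many frequencies [k] gains only if the values at [xi - k] are summable.
    The bound carried along is therefore a weighted sum over integer translates. It may grow with
    every kernel, because the next scale is chosen once it is known; only its uniformity in [N]
    matters.

    Since the scales are free, many primes are needed at infinitely many [j] only, and an elementary
    count can replace the prime number theorem.

    The changes add up to at most 1/2, at frequency 0 as well. The mass thus stays at least 1/2, and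
    normalising costs a factor 2. *)

Definition gint := (int * int)%type.
HB.instance Definition _ := GRing.Zmodule.on gint.

Definition gint_mul (x y : gint) : gint :=
  (x.1 * y.1 - x.2 * y.2, x.1 * y.2 + x.2 * y.1).
Definition gint_one : gint := (1, 0).

Fact gint_mulA : associative gint_mul.
Proof. by move=> [a b] [c d] [e f]; rewrite /gint_mul /=; congr pair; ring. Qed.
Fact gint_mulC : commutative gint_mul.
Proof. by move=> [a b] [c d]; rewrite /gint_mul /=; congr pair; ring. Qed.
Fact gint_mul1 : left_id gint_one gint_mul.
Proof. by move=> [a b]; rewrite /gint_mul /=; congr pair; ring. Qed.
Fact gint_mulD : left_distributive gint_mul +%R.
Proof.
by move=> [a b] [c d] [e f]; rewrite /gint_mul /=; congr pair => /=; ring.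
Qed.
Fact gint_oner_neq0 : gint_one != 0 :> gint. Proof. by []. Qed.

HB.instance Definition _ := GRing.Zmodule_isComNzRing.Build gint
  gint_mulA gint_mulC gint_mul1 gint_mulD gint_oner_neq0.

Lemma gint_mulE (x y : gint) :
  x * y = (x.1 * y.1 - x.2 * y.2, x.1 * y.2 + x.2 * y.1).
Proof. by []. Qed.

Definition gconj (x : gint) : gint := (x.1, - x.2).
Definition gn (x : gint) : nat := absz (x.1 ^+ 2 + x.2 ^+ 2).

Lemma gnE x : (gn x : int) = x.1 ^+ 2 + x.2 ^+ 2.
Proof. by rewrite /gn gez0_abs // addr_ge0 // sqr_ge0. Qed.

Lemma gnM x y : gn (x * y) = (gn x * gn y)%N.
Proof. by rewrite /gn -abszM; congr absz; rewrite gint_mulE /=; ring. Qed.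

Lemma gn_conj x : gn (gconj x) = gn x.
Proof. by rewrite /gn /= sqrrN. Qed.

Lemma gn_eq0 x : (gn x == 0)%N = (x == 0).
Proof.
case: x => a b; rewrite /gn absz_eq0 paddr_eq0 ?sqr_ge0 // !sqrf_eq0.
by [].
Qed.

Lemma gn_gt0 x : (0 < gn x)%N = (x != 0).
Proof. by rewrite lt0n gn_eq0. Qed.

Lemma gconj_mul x : x * gconj x = ((gn x : int), 0).
Proof. by rewrite gint_mulE gnE /=; congr pair; ring. Qed.

Lemma gunit_conj u : gn u = 1%N -> u * gconj u = 1.
Proof. by move=> h; rewrite gconj_mul h. Qed.

Lemma gint_mulf_eq0 (x y : gint) : x * y = 0 -> x = 0 \/ y = 0.
Proof.
move=> /eqP; rewrite -gn_eq0 gnM muln_eq0 !gn_eq0 => /orP[] /eqP; by [left|right].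
Qed.

Lemma gint_mulIf (x y z : gint) : x != 0 -> x * y = x * z -> y = z.
Proof.
move=> x0 h; have : x * (y - z) = 0 by rewrite mulrBr h subrr.
by move=> /gint_mulf_eq0[/eqP|/eqP]; [rewrite (negPf x0)|rewrite subr_eq0 => /eqP].
Qed.

Definition gdvd (d x : gint) := exists y, x = d * y.

Definition girr (p : gint) :=
  (1 < gn p)%N /\ forall x y, p = x * y -> gn x = 1%N \/ gn y = 1%N.

(* A half-open quadrant: it contains exactly one associate of every nonzero element. *)
Definition quad (x : gint) := (0 < x.1) && (0 <= x.2).

Lemma gunitP u : gn u = 1%N -> [\/ u = (1, 0), u = (-1, 0), u = (0, 1) | u = (0, -1)].
Proof.
move=> h; have := gnE u; rewrite h; case: u {h} => a b /= h.
have ha : a = 0 \/ a = 1 \/ a = -1 by nia.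
have hb : b = 0 \/ b = 1 \/ b = -1 by nia.
case: ha => [|[|]] ha; case: hb => [|[|]] hb; subst a b; try lia.
all: by [apply: Or41|apply: Or42|apply: Or43|apply: Or44].
Qed.

Lemma quad_unit x u : quad x -> quad (x * u) -> gn u = 1%N -> x * u = x.
Proof.
case: x => a b; rewrite /quad gint_mulE /= => /andP[h1 h2] h /gunitP[]hu; subst u;
 move: h => /= /andP[h3 h4]; try lia; congr pair; lia.
Qed.

Lemma quadP x : x != 0 -> exists u, gn u = 1%N /\ quad (x * u).
Proof.
move=> x0; case: x x0 => a b.
have -> : ((a, b) != 0 :> gint) = ~~ ((a == 0) && (b == 0)) by [].
move=> h; rewrite /quad.
have [ha|ha] := boolP ((0 < a) && (0 <= b)).
  by exists 1; rewrite mulr1.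
have [hb|hb] := boolP ((0 < b) && (a <= 0)).
  by exists (0, -1); split => //; rewrite gint_mulE /=; lia.
have [hc|hc] := boolP ((a < 0) && (b <= 0)).
  by exists (-1, 0); split => //; rewrite gint_mulE /=; lia.
by exists (0, 1); split => //; rewrite gint_mulE /=; lia.
Qed.

Lemma quad_neq0 x : quad x -> x != 0.
Proof. by case: x => a b /andP[/= h _]; apply/eqP => -[h']; rewrite h' in h. Qed.

Lemma divz_round (u : int) (n : nat) : (0 < n)%N ->
  exists c : int, `|2 * (u - c * n)| <= n%:Z.
Proof.
move=> n0; exists (divz (2 * u + n) (2 * n)).
have := divz_eq (2 * u + n) (2 * n); set c := divz _ _; set r := modz _ _ => h.
have r0 : 0 <= r by apply: modz_ge0; lia.
have r1 : r < 2 * n by apply: ltz_pmod; lia.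
lia.
Qed.

(** Both coordinates of the quotient [a * gconj b / gn b] are rounded to a nearest integer. Each
    error is at most 1/2, so the remainder has at most half the norm of [b]. *)
Lemma gint_euclid a b : b != 0 -> exists c, (gn (a - c * b)%R < gn b)%N.
Proof.
move=> b0; have n0 : (0 < gn b)%N by rewrite gn_gt0.
set z := a * gconj b.
have [c1 h1] := divz_round z.1 (gn b) n0.
have [c2 h2] := divz_round z.2 (gn b) n0.
pose c : gint := (c1, c2); exists c.
have e : gn ((a - c * b) * gconj b) = (gn (a - c * b)%R * gn b)%N.
  by rewrite gnM gn_conj.
have e2 : (a - c * b) * gconj b = (z.1 - c1 * gn b, z.2 - c2 * gn b).
  rewrite mulrBl -mulrA gconj_mul -/z /c; case: (z) => z1 z2.
  by rewrite gint_mulE /=; congr pair => /=; ring.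
move: (gnE ((a - c * b) * gconj b)); rewrite {1}e e2 /=.
move: (gn (a - _)) => m; move: (gn b) n0 h1 h2 => n n0.
move: (z.1 - _) (z.2 - _) => x y h1 h2 h.
have h1' : 4 * x ^+ 2 <= (n : int) ^+ 2 by rewrite !expr2; nia.
have h2' : 4 * y ^+ 2 <= (n : int) ^+ 2 by rewrite !expr2; nia.
rewrite ltnNge; apply/negP => hm.
have : (n : int) * n <= (m * n)%N :> int by nia.
move: h1' h2'; rewrite h !expr2; nia.
Qed.

(** A nonzero element [d] of least norm in the ideal of [p] and [a] divides both, by Euclidean
    division. As [p] is irreducible, [d] is a unit or an associate of [p]; the latter would make [p]
    divide [a]. *)
Lemma gint_bezout p a : girr p -> ~ gdvd p a -> exists x y, x * p + y * a = 1.
Proof.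
move=> [p1 pI] pa.
pose I := fun z : gint => exists x y, z = x * p + y * a.
have Ip : I p by exists 1, 0; rewrite mul1r mul0r addr0.
have Ia : I a by exists 0, 1; rewrite mul1r mul0r add0r.
have p0 : p != 0 by rewrite -gn_gt0 (ltn_trans _ p1).
have ex : exists n, `[< exists z, [/\ I z, z != 0 & gn z = n] >].
  by exists (gn p); apply/asboolP; exists p.
case: (ex_minnP ex) => n /asboolP[d [[x [y dE]] d0 dn]] dmin.
have dI z : I z -> gdvd d z.
  move=> [x' [y' zE]]; have [c hc] := gint_euclid z d d0.
  exists c; apply/eqP; rewrite mulrC -subr_eq0; apply/negP => /negP zc.
  have : (n <= gn (z - c * d)%R)%N.
    apply: dmin; apply/asboolP; exists (z - c * d); split => //.
    by exists (x' - c * x), (y' - c * y); rewrite zE dE; ring.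
  by rewrite -dn leqNgt hc.
have [e pE] := dI _ Ip.
have [/gunit_conj h|/gunit_conj h] := pI _ _ pE.
  exists (x * gconj d), (y * gconj d); rewrite -h.
  by transitivity ((x * p + y * a) * gconj d); [ring | rewrite -dE].
case: pa; have [f aE] := dI _ Ia; exists (gconj e * f).
have -> : p * (gconj e * f) = d * (e * gconj e) * f by rewrite pE; ring.
by rewrite h mulr1 -aE.
Qed.

Lemma girr_prime p a b : girr p -> gdvd p (a * b) -> gdvd p a \/ gdvd p b.
Proof.
move=> pI [c hc]; have [|pa] := pselect (gdvd p a); first by left.
right; have [x [y h]] := gint_bezout p a pI pa.
exists (x * b + y * c).
have -> : p * (x * b + y * c) = x * p * b + y * (p * c) by ring.
rewrite -hc; have -> : x * p * b + y * (a * b) = (x * p + y * a) * b by ring.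
by rewrite h mul1r.
Qed.

Lemma girr_dvd_eq p q : girr p -> girr q -> quad p -> quad q -> gdvd p q -> p = q.
Proof.
move=> [p1 _] [_ qI] hp hq [e qE]; case: (qI _ _ qE) => h; first by rewrite h in p1.
by rewrite qE in hq *; rewrite quad_unit.
Qed.

(** The part of unique factorisation that bounds the number of divisors: after one prime is split
    off, each of the others divides the cofactor, since distinct primes of the quadrant are not
    associates. *)
Lemma girr_divisors (l : seq gint) k : k != 0 -> uniq l ->
  (forall q, q \in l -> [/\ girr q, quad q & gdvd q k]) ->
  (\prod_(q <- l) gn q <= gn k)%N.
Proof.
elim: l k => [|q l IH] k k0 /=; first by rewrite big_nil gn_gt0.
move=> /andP[ql ul] h; rewrite big_cons.
have [qI qq [k1 kE]] := h q (mem_head _ _).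
have k10 : k1 != 0 by apply: contraNneq k0 => h0; rewrite kE h0 mulr0.
rewrite kE gnM leq_mul // IH // => q' q'l.
have [q'I qq' q'k] := h q' (mem_behead (s := q :: l) q'l); split => //.
rewrite kE in q'k; case: (girr_prime _ _ _ q'I q'k) => // q'q.
by move: ql; rewrite -(girr_dvd_eq _ _ q'I qI qq' qq q'q) q'l.
Qed.

Lemma girr_factor z : (1 < gn z)%N -> exists p, [/\ girr p, quad p & gdvd p z].
Proof.
have [n] := ubnP (gn z); elim: n z => // n IH z /ltnSE zn z1.
have z0 : z != 0 by rewrite -gn_gt0 (ltn_trans _ z1).
have [zI|zI] := pselect (girr z).
  have [u [u1 zu]] := quadP _ z0; exists (z * u); split => //; last first.
    by exists (gconj u); rewrite -mulrA gunit_conj // mulr1.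
  split; first by rewrite gnM u1 muln1.
  move=> x y e; have : z = x * (y * gconj u).
    by rewrite mulrA -e -mulrA gunit_conj // mulr1.
  by move=> /zI.2; rewrite gnM gn_conj u1 muln1.
have [x [y [zE x1 y1]]] : exists x y, [/\ z = x * y, gn x <> 1%N & gn y <> 1%N].
  apply: contrapT => hn; apply: zI; split => // x y zE.
  apply: contrapT => /not_orP[hx hy]; apply: hn; by exists x, y.
have zn' : gn z = (gn x * gn y)%N by rewrite zE gnM.
have x0 : (0 < gn x)%N by nia.
have y0 : (0 < gn y)%N by nia.
have [||p [pI pq [w xE]]] := IH x; [nia|lia|].
by exists p; split => //; exists (w * y); rewrite zE xE mulrA.
Qed.

(** A product of two elements of the quadrant can leave it; passing to the associate in the quadrant
    makes lists of products comparable with [qbox]. Zero has no such associate and is sent to 0. *)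
Definition canon (x : gint) : gint :=
  if pselect (exists u, gn u = 1%N /\ quad (x * u)) is left h
  then x * projT1 (cid h) else 0.

Lemma canonP x : x != 0 -> exists u, [/\ gn u = 1%N, canon x = x * u & quad (canon x)].
Proof.
move=> x0; rewrite /canon; case: pselect => [h|]; last by have := quadP _ x0.
by case: cid => u [u1 hu] /=; exists u.
Qed.

Lemma canon_id x u : quad (x * u) -> gn u = 1%N -> canon x = x * u.
Proof.
move=> h u1; have x0 : x != 0.
  by have := quad_neq0 _ h; apply: contraNneq => ->; rewrite mul0r.
have [v [v1 -> hv]] := canonP _ x0.
have e : x * v = x * u * (gconj u * v).
  by rewrite -mulrA (mulrA u) gunit_conj // mul1r.
rewrite e; apply: quad_unit => //; rewrite -?e //; last by rewrite gnM gn_conj u1 v1.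
Qed.

(** * Many Gaussian primes *)

Lemma leq_expn2r m n e : (m <= n)%N -> (m ^ e <= n ^ e)%N.
Proof. by case: e => // e; rewrite leq_exp2r. Qed.

Definition qbox (J : nat) : seq gint :=
  [seq z <- [seq ((Posz a, Posz b) : gint) | a <- iota 0 (2 ^ J), b <- iota 0 (2 ^ J)]
     | quad z && (gn z < 4 ^ J)%N].

Lemma qbox_uniq J : uniq (qbox J).
Proof.
rewrite filter_uniq // allpairs_uniq ?iota_uniq //.
by move=> [a b] [c d] _ _ [-> ->].
Qed.

Lemma mem_qbox J z : (z \in qbox J) = quad z && (gn z < 4 ^ J)%N.
Proof.
rewrite mem_filter andbC; apply/andb_idl => /andP[hq hn].
have e4 : (4 ^ J = 2 ^ J * 2 ^ J)%N by rewrite -expnMn.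
rewrite e4 in hn; move: (2 ^ J)%N hn {e4} => m hn.
have := gnE z; case: z hq hn => a b /= /andP[/= ha hb] hn h.
have ea : a = Posz (absz a) by lia.
have eb : b = Posz (absz b) by lia.
rewrite ea eb; apply/allpairsP; exists (absz a, absz b) => /=; split => //;
 rewrite mem_iota; move: h hn; rewrite !expr2; nia.
Qed.

Lemma size_qbox_le J : (size (qbox J) <= 4 ^ J)%N.
Proof.
rewrite size_filter (leq_trans (count_size _ _)) //.
by rewrite size_allpairs !size_iota -expnMn.
Qed.

Lemma size_qbox_ge J : (4 ^ J <= size (qbox J.+1))%N.
Proof.
have -> : (4 ^ J = size [seq ((Posz a, Posz b) : gint)
     | a <- iota 1 (2 ^ J), b <- iota 0 (2 ^ J)])%N.
  by rewrite size_allpairs !size_iota -expnMn.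
apply: uniq_leq_size.
  rewrite allpairs_uniq ?iota_uniq //.
  by move=> [a b] [c d] _ _ [-> ->].
move=> z /allpairsP[[a b] /=]; rewrite !mem_iota => -[ha hb ->].
rewrite mem_qbox /quad /=; apply/andP; split; first lia.
have e4 : (4 ^ J.+1 = 4 * (2 ^ J * 2 ^ J))%N by rewrite expnS -expnMn.
have := gnE (Posz a, Posz b); rewrite e4; move: (2 ^ J)%N ha hb {e4} => m ha hb /=.
by rewrite !expr2; nia.
Qed.

Definition gprimes (j : nat) : seq gint :=
  [seq z <- qbox j.+1 | (4 ^ j <= gn z)%N && `[< girr z >]].

Lemma mem_gprimes j z : z \in gprimes j <->
  [/\ quad z, girr z, (4 ^ j <= gn z)%N & (gn z < 4 ^ j.+1)%N].
Proof.
rewrite mem_filter mem_qbox; split.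
  by move=> /andP[/andP[? /asboolP ?] /andP[? ?]].
by move=> [-> /asboolP -> -> ->].
Qed.

Fixpoint smooth (n : nat) (l : seq gint) : seq gint :=
  if l is p :: l' then [seq canon (p ^+ e * w) | e <- iota 0 n, w <- smooth n l']
  else [:: 1].

Lemma size_smooth n l : size (smooth n l) = (n ^ size l)%N.
Proof. by elim: l => //= p l IH; rewrite size_allpairs size_iota IH expnS. Qed.

Lemma canon_mul x y : x * y != 0 -> canon (x * canon y) = canon (x * y).
Proof.
move=> xy0; have y0 : y != 0 by apply: contraNneq xy0 => ->; rewrite mulr0.
have [u [u1 -> _]] := canonP _ y0; rewrite mulrA.
have [v [v1 cv qv]] := canonP _ xy0.
rewrite cv in qv *; rewrite (canon_id _ (gconj u * v)) //.
- by rewrite -[LHS]mulrA (mulrA u) gunit_conj // mul1r.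
- by rewrite -[X in quad X]mulrA (mulrA u) gunit_conj // mul1r.
- by rewrite gnM gn_conj u1 v1.
Qed.

Lemma mem_smooth n l z : quad z -> (gn z < 2 ^ n)%N ->
  (forall p, girr p -> quad p -> gdvd p z -> p \in l) -> z \in smooth n l.
Proof.
elim: l z => [|p l IH] z qz nz hz /=.
  rewrite inE; have z0 := quad_neq0 _ qz; rewrite -gn_gt0 in z0.
  have [/girr_factor[p [pI pq pd]]|] := ltnP 1 (gn z).
    by have := hz p pI pq pd.
  move=> z1; have h : gn z = 1%N by lia.
  by rewrite -[z]mul1r (quad_unit 1 z) // mul1r.
have z0 := quad_neq0 _ qz.
(* An entry of [l] that is not irreducible is used with exponent 0. *)
have [pI|pI] := pselect (girr p); last first.
  have n0 : (0 < n)%N by case: (n) nz => //; rewrite expn0 ltnNge gn_gt0 z0.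
  have zE : z = canon (p ^+ 0 * z) by rewrite expr0 mul1r (canon_id _ 1) ?mulr1.
  apply/allpairsP; exists (0%N, z); split => //=; first by rewrite mem_iota.
  apply: IH => // q qI qq qz'; have := hz q qI qq qz'; rewrite inE => /orP[/eqP qp|//].
  by rewrite -qp in pI.
(* The full power of [p] is split off, so that [p] does not divide the cofactor and the rest of [l]
   suffices for it. *)
have [e [[z' zE] he]] : exists e, gdvd (p ^+ e) z /\ ~ gdvd (p ^+ e.+1) z.
  have P0 : exists e, `[< gdvd (p ^+ e) z >].
    by exists 0%N; apply/asboolP; exists z; rewrite mul1r.
  have Pb e : `[< gdvd (p ^+ e) z >] -> (e <= n)%N.
    move=> /asboolP[y yE]; rewrite leqNgt; apply/negP => en.
    have y0 : y != 0 by apply: contraNneq z0 => y0; rewrite yE y0 mulr0.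
    have gX : gn (p ^+ e) = (gn p ^ e)%N.
      by elim: (e) => // k IHk; rewrite exprS gnM IHk expnS.
    move: nz; rewrite yE gnM gX ltnNge => /negP; apply.
    have h2 : (2 ^ e <= gn p ^ e)%N by apply: leq_expn2r; exact: pI.1.
    rewrite -gn_gt0 in y0.
    have : (2 ^ n <= 2 ^ e)%N by rewrite leq_exp2l // ltnW.
    move: h2; move: (2 ^ n)%N (2 ^ e)%N (gn p ^ e)%N => ? ? ?; nia.
  case: (ex_maxnP P0 Pb) => e /asboolP h hm; exists e; split => // h'.
  by have /asboolP/hm := h'; rewrite ltnn.
have z'0 : z' != 0 by apply: contraNneq z0 => y0; rewrite zE y0 mulr0.
have [u [u1 cz' qz']] := canonP _ z'0.
have gX : gn (p ^+ e) = (gn p ^ e)%N.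
  by elim: (e) => // k IHk; rewrite exprS gnM IHk expnS.
have h2 : (2 ^ e <= gn p ^ e)%N by apply: leq_expn2r; exact: pI.1.
have nE : gn z = (gn p ^ e * gn z')%N by rewrite {1}zE gnM gX.
apply/allpairsP; exists (e, canon z'); split => /=.
- rewrite mem_iota /= add0n -(ltn_exp2l (m := 2)) //.
  rewrite -gn_gt0 in z'0; move: h2 nz z'0; rewrite nE.
  move: (2 ^ n)%N (2 ^ e)%N (gn p ^ e)%N => ? ? ?; nia.
- apply: IH => //.
    rewrite cz' gnM u1 muln1; move: (expn_gt0 (gn p) e); rewrite (ltn_trans _ pI.1) //=.
    by move: nz; rewrite nE; move: (2 ^ n)%N (gn p ^ e)%N => ? ?; nia.
  move=> q qI qq; rewrite cz' => -[y yE].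
  have qz2 : gdvd q z'.
    by exists (y * gconj u); rewrite mulrA -yE -mulrA gunit_conj // mulr1.
  have qz3 : gdvd q z.
    by have [v vE] := qz2; exists (p ^+ e * v); rewrite zE vE; ring.
  have := hz q qI qq qz3; rewrite inE => /orP[/eqP qp|//].
  exfalso; apply: he; have [v vE] := qz2; exists v.
  by rewrite zE vE qp exprSr mulrA.
by rewrite canon_mul -?zE // (canon_id _ 1) ?mulr1.
Qed.

Lemma linear_lt_exp2 t : exists n, (t * n + 3 < 2 ^ n)%N.
Proof.
exists ((2 * t + 3) * 2)%N; rewrite expnM.
have h := ltn_expl (2 * t + 3) (ltnSn 1).
by move: (2 ^ (2 * t + 3))%N h => m h; rewrite -mulnn; nia.
Qed.

(** The telescoping bound of the sum of [1 / i ^ 2] over [a < i <= a + m] by [1 / a - 1 / (a + m)],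
    with denominators cleared. *)
Lemma sum_inv_square_bound (s : nat -> nat) (a X m : nat) :
  (forall i, (i < m)%N -> s i * (a.+1 + i) ^ 2 <= X)%N ->
  ((\sum_(i < m) s i) * (a * (a + m)) <= X * m)%N.
Proof.
elim: m => [|m IH] h; first by rewrite big_ord0.
have {}IH := IH (fun i im => h i (ltnW im)).
rewrite big_ord_recr /=; move: IH; move: (\sum_(i < m) s i)%N => S IH.
have hs := h m (ltnSn m).
have h1 : (s m * ((a.+1 + m) * (a + m)) <= X)%N.
  by apply: leq_trans hs; rewrite leq_mul2l -mulnn leq_mul2l addSn leqnSn !orbT.
have [k0|k0] := posnP (a + m)%N.
  by move: k0 => /eqP; rewrite addn_eq0 => /andP[/eqP -> _]; rewrite mul0n muln0.
rewrite -(leq_pmul2r k0).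
have -> : ((S + s m) * (a * (a + m.+1)) * (a + m) =
  S * (a * (a + m)) * (a + m).+1 + a * (s m * ((a.+1 + m) * (a + m))))%N by ring.
apply: (@leq_trans (X * m * (a + m).+1 + a * X)%N).
  by rewrite leq_add // leq_mul.
by nia.
Qed.

(** Either all primes dividing [z] have norm below [4 ^ j1], or one of them lies in a shell
    [j1 <= j < J] and its cofactor has norm below [4 ^ (J - j)]. The exponent bound [2 * J] comes
    from [4 ^ J = 2 ^ (2 * J)]. *)
Lemma qbox_cover j1 J : {subset qbox J <=
  smooth (2 * J) [seq z <- qbox j1 | `[< girr z >]] ++
  flatten [seq [seq canon (p * w) | p <- gprimes (j1 + i), w <- qbox (J - (j1 + i))]
          | i <- iota 0 (J - j1)]}.
Proof.
move=> z; rewrite mem_qbox => /andP[qz zJ]; rewrite mem_cat.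
set l := [seq z <- _ | _].
have [h|h] := pselect (forall p, girr p -> quad p -> gdvd p z -> p \in l).
  by rewrite mem_smooth // expnM.
have [p [pI pq [w zE] pl]] : exists p, [/\ girr p, quad p, gdvd p z & p \notin l].
  apply: contrapT => hn; apply: h => p pI pq pz; apply: contrapT => /negP pl.
  by apply: hn; exists p.
have z0 := quad_neq0 _ qz.
have w0 : w != 0 by apply: contraNneq z0 => w0; rewrite zE w0 mulr0.
have pj : (4 ^ j1 <= gn p)%N.
  move: pl; rewrite mem_filter mem_qbox pq /= => h2; rewrite leqNgt.
  by apply: contra h2 => ->; rewrite andbT; apply/asboolP.
have p0 : (0 < gn p)%N by case: pI => pI _; lia.
have /andP[l1 l2] := trunc_log_bounds (isT : (1 < 4)%N) p0.
move: (trunc_log 4 (gn p)) l1 l2 => j l1 l2.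
have j1j : (j1 <= j)%N by rewrite -ltnS -(ltn_exp2l (m := 4)) // (leq_ltn_trans pj).
have nz : gn z = (gn p * gn w)%N by rewrite zE gnM.
have wg : (0 < gn w)%N by rewrite gn_gt0.
have jJ : (j < J)%N.
  by rewrite -(ltn_exp2l (m := 4)) // (leq_ltn_trans l1) //; nia.
have [u [u1 cw qw]] := canonP _ w0.
apply/orP; right; apply/flattenP.
exists [seq canon (p * w) | p <- gprimes j, w <- qbox (J - j)].
  apply/mapP; exists (j - j1)%N; first by rewrite mem_iota; lia.
  by rewrite subnKC.
apply/allpairsP; exists (p, canon w); split => /=.
- exact/mem_gprimes.
- rewrite mem_qbox qw cw gnM u1 muln1 /=.
  have e : (4 ^ J = 4 ^ j * 4 ^ (J - j))%N by rewrite -expnD subnKC // ltnW.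
  by move: zJ l1; rewrite nz e; move: (4 ^ j)%N (4 ^ (J - j))%N => ? ?; nia.
- by rewrite canon_mul -?zE // (canon_id _ 1) ?mulr1.
Qed.

(* Otherwise the shells would contribute a convergent series, so that a positive
   proportion of the Gaussian integers would be products of finitely many primes. *)
Lemma gprimes_many j0 : exists j, (j0 <= j)%N /\ (4 ^ j <= size (gprimes j) * j ^ 2)%N.
Proof.
apply: contrapT => hn.
have few j : (j0 <= j)%N -> (size (gprimes j) * j ^ 2 <= 4 ^ j)%N.
  by move=> jj; rewrite leqNgt; apply/negP => h; apply: hn; exists j; split => //; exact: ltnW.
(* With [j1 - 1 >= 8] the shells account for at most [4 ^ J / 8] elements. The products of small
   primes are fewer than [4 ^ J / 8], while the box has at least [4 ^ J / 4] elements. *)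
pose j1 := (j0 + 9)%N; set l := [seq z <- qbox j1 | `[< girr z >]].
(* Since [J = 2 ^ n], the count [(2 * J) ^ size l] is a power of 2 with exponent linear in [n], far
   below the exponent [2 * J] of [4 ^ J]. *)
have [n hn'] := linear_lt_exp2 (size l + 3 + j1); pose J := (2 ^ n)%N.
have tJ : ((size l + 3 + j1) * n + 3 < J)%N := hn'.
have n0 : (0 < n)%N by case: (n) hn' => //; rewrite muln0.
have jJ : (j1 < J)%N by move: tJ n0; move: (J) (size l) (j1) => ? ? ?; nia.
have := uniq_leq_size (qbox_uniq J) (qbox_cover j1 J).
rewrite size_cat size_smooth -/l size_flatten /shape -map_comp.
set S := sumn _ => hS.
have {}hS : (4 ^ J.-1 <= (2 * J) ^ size l + S)%N.
  by apply: leq_trans hS; rewrite -{2}[J](ltn_predK jJ) size_qbox_ge.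
pose s i := (size (gprimes (j1 + i)) * 4 ^ (J - (j1 + i)))%N.
have SE : (S <= \sum_(i < J - j1) s i)%N.
  rewrite /S sumnE big_map -[X in iota 0 X]subn0 -/(index_iota 0 _) big_mkord leq_sum //.
  by move=> i _ /=; rewrite size_allpairs leq_mul2l size_qbox_le orbT.
have hs i : (i < J - j1)%N -> (s i * (j1.-1.+1 + i) ^ 2 <= 4 ^ J)%N.
  move=> iJ; have -> : j1.-1.+1 = j1 by rewrite /j1; lia.
  have le : (j1 + i <= J)%N by lia.
  have h : (size (gprimes (j1 + i)) * (j1 + i) ^ 2 <= 4 ^ (j1 + i))%N.
    by apply: few; rewrite /j1; lia.
  by rewrite /s -{2}(subnKC le) expnD mulnAC leq_mul2r h orbT.
have := sum_inv_square_bound s j1.-1 (4 ^ J) (J - j1) hs.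
have {SE}hS : (4 ^ J.-1 <= (2 * J) ^ size l + \sum_(i < J - j1) s i)%N.
  by apply: leq_trans hS _; rewrite leq_add2l.
move: (\sum_(i < _) _)%N hS => T hT hb.
have {}hb : (8 * T <= 4 ^ J)%N.
  move: hb; have e : (j1.-1 + (J - j1) = J.-1)%N by rewrite /j1 in jJ *; lia.
  rewrite e; have : (8 <= j1.-1)%N by rewrite /j1; lia.
  have : (J - j1 <= J.-1)%N by rewrite /j1; lia.
  have : (0 < J.-1)%N by rewrite /j1 in jJ; lia.
  move: (J - j1)%N (J.-1)%N (j1.-1) (4 ^ J)%N => b c d X c0 bc d8 hb.
  rewrite -(leq_pmul2r c0); apply: (@leq_trans (T * (d * c))%N); first by nia.
  by apply: leq_trans hb _; rewrite leq_mul2l bc orbT.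
have hm : ((2 * J) ^ size l * 8 < 4 ^ J)%N.
  rewrite /J -expnS -expnM -[8%N]/(2 ^ 3)%N -expnD -[4%N]/(2 ^ 2)%N -expnM.
  by rewrite ltn_exp2l // -/J; move: tJ; move: (J) (size l) (j1) => ? ? ?; nia.
have e4 : (4 ^ J = 4 * 4 ^ J.-1)%N by rewrite -expnS (ltn_predK jJ).
by move: hm hb hT; rewrite e4; lia.
Qed.

(** Each counted prime has norm at least [4 ^ j], and the product of these norms is at most
    [gn k]. *)
Lemma count_gprimes_dvd j k : k != 0 ->
  (4 ^ (j * count (fun q => `[< gdvd q k >]) (gprimes j)) <= gn k)%N.
Proof.
move=> k0; rewrite -size_filter.
apply: leq_trans (girr_divisors [seq q <- gprimes j | `[< gdvd q k >]] k k0 _ _); last 2 first.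
- by rewrite filter_uniq // filter_uniq // qbox_uniq.
- by move=> q; rewrite mem_filter => /andP[/asboolP qk /mem_gprimes[]].
have : {subset [seq q <- gprimes j | `[< gdvd q k >]] <= gprimes j} by apply: mem_subseq; exact: filter_subseq.
elim: [seq q <- _ | _] => [|q l IH] h /=; first by rewrite muln0 big_nil.
rewrite big_cons mulnS expnD leq_mul //.
  by have /mem_gprimes[] := h q (mem_head _ _).
by apply: IH => z zl; apply: h; rewrite inE zl orbT.
Qed.

Set Implicit Arguments.
Unset Strict Implicit.
Unset Printing Implicit Defensive.

(** * Weak limits of weights in a square *)

Lemma zdigits (n : nat) (a b : bool) :
  ((4 * n + 2 * a + b) %% 4 %/ 2)%N = a /\ odd (4 * n + 2 * a + b) = b.
Proof. by case: a; case: b; lia. Qed.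

Section ZOrder.
Variables (R : realType) (c : R * R) (L : R).

(* [zcode l y] is the Z-order (Morton) index of the cell of side [L / 2 ^ l] containing
   [y], and [zdec] recovers the corner of that cell; dividing an index by 4 gives the
   index of the parent cell. *)
Fixpoint zdec (l n : nat) : R * R :=
  if l is l'.+1 then
    let p := zdec l' (n %/ 4)%N in
    (p.1 + L / 2 ^+ l * ((n %% 4) %/ 2)%:R, p.2 + L / 2 ^+ l * (odd n)%:R)
  else c.

Fixpoint zcode (l : nat) (y : R * R) : nat :=
  if l is l'.+1 then
    let n := zcode l' y in let p := zdec l' n in
    (4 * n + 2 * ((p.1 + L / 2 ^+ l <= y.1)%R : bool)
           + ((p.2 + L / 2 ^+ l <= y.2)%R : bool))%N
  else 0%N.

Lemma zcodeS_div4 l y : (zcode l.+1 y %/ 4)%N = zcode l y.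
Proof. by move=> /=; case: (_ <= y.1); case: (_ <= y.2); lia. Qed.

Lemma zcode_lt l y : (zcode l y < 4 ^ l)%N.
Proof. by elim: l => // l IH; rewrite expnS mulnC -ltn_divLR // zcodeS_div4. Qed.

Lemma zdec_zcode l y : c.1 <= y.1 <= c.1 + L -> c.2 <= y.2 <= c.2 + L ->
  (zdec l (zcode l y)).1 <= y.1 <= (zdec l (zcode l y)).1 + L / 2 ^+ l /\
  (zdec l (zcode l y)).2 <= y.2 <= (zdec l (zcode l y)).2 + L / 2 ^+ l.
Proof.
move=> h1 h2; elim: l => [|l [IH1 IH2]]; first by rewrite /= expr0 divr1.
have e : L / 2 ^+ l = L / 2 ^+ l.+1 + L / 2 ^+ l.+1.
  have h : (2 : R) ^+ l != 0 by rewrite expf_neq0.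
  by rewrite exprS; field.
rewrite [zdec l.+1 _]/= zcodeS_div4.
have -> : (zcode l.+1 y %% 4 %/ 2)%N = ((zdec l (zcode l y)).1 + L / 2 ^+ l.+1 <= y.1 :> R)%R.
  by have [] := zdigits (zcode l y) ((zdec l (zcode l y)).1 + L / 2 ^+ l.+1 <= y.1)
    ((zdec l (zcode l y)).2 + L / 2 ^+ l.+1 <= y.2).
have -> : odd (zcode l.+1 y) = ((zdec l (zcode l y)).2 + L / 2 ^+ l.+1 <= y.2 :> R)%R.
  by have [] := zdigits (zcode l y) ((zdec l (zcode l y)).1 + L / 2 ^+ l.+1 <= y.1)
    ((zdec l (zcode l y)).2 + L / 2 ^+ l.+1 <= y.2).
move: (zdec l _) IH1 IH2 => p; rewrite e; move: (L / 2 ^+ l.+1) => d /= IH1 IH2.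
split; [case: (lerP (p.1 + d) y.1) | case: (lerP (p.2 + d) y.2)] => h /=; rewrite ?mulr1 ?mulr0; lra.
Qed.

Hypothesis L0 : 0 < L.

Lemma zdecS l n : exists a b : R, [/\ 0 <= a <= L / 2 ^+ l.+1, 0 <= b <= L / 2 ^+ l.+1 &
  zdec l.+1 n = ((zdec l (n %/ 4)).1 + a, (zdec l (n %/ 4)).2 + b)].
Proof.
have d0 : 0 <= L / 2 ^+ l.+1 by rewrite divr_ge0 ?exprn_ge0 // ltW.
exists (L / 2 ^+ l.+1 * (n %% 4 %/ 2)%:R), (L / 2 ^+ l.+1 * (odd n)%:R); split => //.
  have h : (n %% 4 %/ 2 <= 1)%N by lia.
  by rewrite mulr_ge0 //= ler_piMr // lern1.
by rewrite mulr_ge0 //= ler_piMr // lern1; case: odd.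
Qed.

End ZOrder.

Section UltraLimit.
Variable R : realType.

(** Along a free ultrafilter all bounded real sequences converge simultaneously, so no subsequence
    has to be extracted for the masses of all cells and the Fourier transform at all frequencies. *)
Definition ultra_nat : set_system nat :=
  projT1 (cid (@ultraFilterLemma nat \oo _)).

Lemma ultra_natP : UltraFilter ultra_nat /\ \oo `<=` ultra_nat.
Proof. exact: projT2 (cid (@ultraFilterLemma nat \oo _)). Qed.

Global Instance ultra_nat_proper : ProperFilter ultra_nat.
Proof. by have [h _] := ultra_natP; exact: ultra_proper. Qed.

Lemma ultra_nearW (P : nat -> Prop) K : (forall k, (K <= k)%N -> P k) ->
  \forall k \near ultra_nat, P k.
Proof. by move=> h; apply: ultra_natP.2; exists K. Qed.

Lemma ultra_cvg (u : nat -> R) (B : R) : (forall k, `|u k| <= B) ->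
  cvg (u @ ultra_nat).
Proof.
move=> uB; have : compact `[- B, B] by exact: segment_compact.
rewrite compact_ultra => /(_ (u @ ultra_nat)) [].
- have [h _] := ultra_natP; split; first exact: fmap_proper_filter.
  move=> G GG uG; rewrite predeqE => A; split; last exact: uG.
  move=> GA; have [//|hA] := in_ultra_setVsetC (u @^-1` A) h.
  have GC : G (~` A) by apply: uG.
  by have := @filterI _ G _ _ _ GA GC; rewrite setICr => G0; case: (@filter_not_empty _ G GG); apply: G0; exact: GG.
- apply: (@ultra_nearW _ 0%N) => k _ /=.
  by rewrite in_itv /= -ler_norml.
- by move=> p [_ h]; apply/cvg_ex; exists p.
Qed.

End UltraLimit.

Lemma uniform_prob_lt (R : realType) (a : R) : 0 <= a <= 1 ->
  uniform_prob (ltr01 : (0 : R) < 1) [set t | t < a] = a%:E.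
Proof.
move=> /andP[a0 a1]; rewrite /uniform_prob integral_uniform_pdf.
have -> : [set t | t < a] `&` `[0, 1] = `[0, a[%classic.
  apply/seteqP; split => t /=; rewrite !in_itv /=; last first.
    by move=> /andP[t0 ta]; split => //; rewrite t0 /= (le_trans (ltW ta)).
  by move=> [ta /andP[-> _]].
rewrite (eq_integral (fun=> 1%:E)); last first.
  move=> t; rewrite inE /= in_itv /= => /andP[t0 ta].
  by rewrite /uniform_pdf t0 (le_trans (ltW ta) a1) /= subr0 invr1.
rewrite integral_cst //= mul1e lebesgue_measure_itv /= lte_fin.
by case: ltP => [|a0']; rewrite ?sube0 //; congr EFin; apply/le_anti/andP.
Qed.

Lemma nested_cvg (R : realType) (a d : nat -> R) :
  (forall l, 0 <= d l) -> (forall l, a l <= a l.+1) ->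
  (forall l, a l.+1 + d l.+1 <= a l + d l) ->
  a @ \oo --> lim (a @ \oo) /\ forall l, a l <= lim (a @ \oo) <= a l + d l.
Proof.
move=> d0 ainc adec.
have ai : nondecreasing_seq a by apply/nondecreasing_seqP.
have ad : nonincreasing_seq (fun l => a l + d l) by apply/nonincreasing_seqP.
have ub l m : a m <= a l + d l.
  have h1 : a m <= a (maxn l m) by apply: ai; exact: leq_maxr.
  have h2 := ad _ _ (leq_maxl l m).
  by apply: le_trans h1 (le_trans _ h2); rewrite lerDl.
have ca : cvg (a @ \oo).
  apply: nondecreasing_is_cvgn => //; exists (a 0%N + d 0%N) => _ [m _ <-]; exact: ub.
split => // l; rewrite nondecreasing_cvgn_le //=.
by apply: limr_le => //; apply: nearW => m; exact: ub.
Qed.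

Lemma half_power_lt (R : realType) (C e : R) : 0 < e -> exists l, C / 2 ^+ l < e.
Proof.
move=> e0; pose n := (Num.truncn (C / e)).+1; exists n.
have h : C / e < n%:R by exact: truncnS_gt.
rewrite ltr_pdivrMr ?exprn_gt0 // -ltr_pdivrMl // mulrC (lt_trans h) //.
by rewrite -natrX ltr_nat ltn_expl.
Qed.

Lemma norm_cosB (R : realType) (x y : R) : `|cos x - cos y| <= `|x - y|.
Proof.
wlog xy : x y / x < y.
  move=> h; have [/h//|yx|->] := ltgtP x y; last by rewrite !subrr.
  by rewrite distrC (distrC x) h.
have [z _] := @MVT R cos (fun z => - sin z) x y xy (fun z _ => is_derive_cos z)
  (continuous_subspaceT (@continuous_cos R)).
rewrite distrC => ->; rewrite normrM normrN distrC.
by rewrite ler_piMl // sin_max.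
Qed.

Lemma norm_sinB (R : realType) (x y : R) : `|sin x - sin y| <= `|x - y|.
Proof.
rewrite -!cosBpihalf (le_trans (norm_cosB _ _)) //.
by rewrite (_ : _ - _ - _ = x - y) //; ring.
Qed.

Lemma maxnormD (R : realType) (x y : R * R) : maxnorm (x + y) <= maxnorm x + maxnorm y.
Proof.
rewrite /maxnorm ge_max; apply/andP; split; apply: le_trans (ler_normD _ _) _; apply: lerD;
  by rewrite le_max lexx ?orbT.
Qed.

(* The limit law is built as the image of the uniform law on [0, 1) under the inverse
   of the distribution function of the Z-order: at every level [l] the limits [G l n] of
   the masses of the first [n] cells cut [0, 1) into intervals, and these cuttings are
   nested. *)
Section LimitMeasure.
Variables (R : realType) (c : R * R) (L : R).
Hypothesis L0 : 0 < L.
Unset Implicit Arguments.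
Variables (I : nat -> finType) (w : forall k, I k -> R) (x : forall k, I k -> R * R).
Set Implicit Arguments.
Hypothesis w0 : forall k i, 0 <= w k i.
Hypothesis w1 : forall k, \sum_i w k i = 1.
Hypothesis xbox : forall k i,
  c.1 <= (x k i).1 <= c.1 + L /\ c.2 <= (x k i).2 <= c.2 + L.

Let Lk (g : R * R -> R) k : R := \sum_i w k i * g (x k i).
Let Lam g : R := lim (Lk g k @[k --> ultra_nat]).

Let Lk_le g h k : (forall i, g (x k i) <= h (x k i)) -> Lk g k <= Lk h k.
Proof. by move=> gh; apply: ler_sum => i _; rewrite ler_wpM2l. Qed.

Let Lk_cst (a : R) k : Lk (fun=> a) k = a.
Proof. by rewrite /Lk -mulr_suml w1 mul1r. Qed.

Let Lk_norm g (B : R) k : (forall i, `|g (x k i)| <= B) -> `|Lk g k| <= B.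
Proof.
move=> gB; rewrite ler_norml -{1}(Lk_cst (- B) k) -{2}(Lk_cst B k).
by apply/andP; split; apply: Lk_le => i; have := gB i; rewrite ler_norml => /andP[].
Qed.

Let Lam_cvg g (B : R) : (forall y, `|g y| <= B) ->
  Lk g k @[k --> ultra_nat] --> Lam g.
Proof. by move=> gB; apply: (ultra_cvg (B := B)) => k; exact: Lk_norm. Qed.

Let gcode l n (y : R * R) : R := (zcode c L l y < n)%:R.

Let gcode_norm l n y : `|gcode l n y| <= 1.
Proof. by rewrite /gcode; case: (_ < _)%N; rewrite ?normr1 ?normr0. Qed.

Let G l n : R := Lam (gcode l n).

Let G_cvg l n : Lk (gcode l n) k @[k --> ultra_nat] --> G l n.
Proof. exact: Lam_cvg (gcode_norm l n). Qed.

Let G_cst l n (a : R) : (forall k, Lk (gcode l n) k = a) -> G l n = a.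
Proof.
move=> h; rewrite /G /Lam (_ : Lk _ = fun=> a); last by apply/funext.
by apply/cvg_lim => //; exact: cvg_cst.
Qed.

Let G_0 l : G l 0 = 0. Proof. by apply: G_cst => k; exact: Lk_cst. Qed.

Let G_top l n : (4 ^ l <= n)%N -> G l n = 1.
Proof.
move=> h; apply: G_cst => k; rewrite -[RHS](Lk_cst 1 k); congr Lk.
by apply/funext => y; rewrite /gcode (leq_trans (zcode_lt _ _ _ _) h).
Qed.

Let G_mono l n m : (n <= m)%N -> G l n <= G l m.
Proof.
move=> nm; apply: (ler_cvg_to (@G_cvg l n) (@G_cvg l m)).
apply: (ultra_nearW (K := 0%N)) => k _; apply: Lk_le => i.
by rewrite /gcode ler_nat; case: ltnP => // h; rewrite (leq_trans h).
Qed.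

Let G_ge0 l n : 0 <= G l n. Proof. by rewrite -(G_0 l) G_mono. Qed.

Let G_le1 l n : G l n <= 1.
Proof. by rewrite -(G_top (leq_maxl (4 ^ l) n)) G_mono // leq_maxr. Qed.

Let G_S l n : G l.+1 (4 * n) = G l n.
Proof.
rewrite /G (_ : gcode l.+1 (4 * n) = gcode l n) //; apply/funext => y.
by rewrite /gcode mulnC -ltn_divLR // zcodeS_div4.
Qed.

(** The comparison [t < G l n], forced to be false at [n = 0] and true from [4 ^ l] on. These agree
    with [G = 0] and [G = 1] on [[0, 1)], and [idx] becomes defined for every real [t]. *)
Let lt l n t := (4 ^ l <= n)%N || ((0 < n)%N && (t < G l n)).

Let lt0 l t : lt l 0 t = false.
Proof. by rewrite /lt leqn0 expn_eq0. Qed.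

Let lt_mono l n m t : (n <= m)%N -> lt l n t -> lt l m t.
Proof.
move=> nm /orP[h|/andP[n0 h]]; apply/orP; first by left; exact: leq_trans nm.
by right; rewrite (leq_trans n0 nm) /= (lt_le_trans h) // G_mono.
Qed.

Let lt_S l n t : lt l.+1 (4 * n) t = lt l n t.
Proof. by rewrite /lt G_S expnS leq_mul2l /= muln_gt0. Qed.

Let ex_lt l t : exists n, lt l n.+1 t.
Proof. by exists (4 ^ l)%N; rewrite /lt leqnSn. Qed.

(** The quantile function of the limiting cell masses at level [l]. *)
Let idx l t := ex_minn (ex_lt l t).

Let idx_lt l n t : (idx l t < n)%N = lt l n t.
Proof.
rewrite /idx; case: ex_minnP => m hm min.
apply/idP/idP => [mn|]; first exact: lt_mono hm.
by case: n => [|n]; [rewrite lt0|rewrite ltnS; exact: min].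
Qed.

Let idxS l t : (idx l.+1 t %/ 4)%N = idx l t.
Proof.
have h n : (idx l.+1 t %/ 4 < n)%N = (idx l t < n)%N.
  by rewrite ltn_divLR // mulnC !idx_lt lt_S.
by apply/eqP; rewrite eqn_leq -ltnS h leqnn -ltnS -h leqnn.
Qed.

Let P := [the probability _ R of uniform_prob (ltr01 : (0 : R) < 1)].

Let below l n : set R := [set t | lt l n t].

Let below_measurable l n : measurable (below l n).
Proof.
rewrite /below /lt; case: (leqP (4 ^ l)%N n) => _ /=.
  by rewrite (_ : [set _ | _] = setT) //; apply/seteqP; split.
case: n => [|n] /=; first by rewrite (_ : [set _ | _] = set0) //; by apply/seteqP; split.
rewrite (_ : [set _ | _] = `]-oo, (G l n.+1)[%classic) //.
Qed.

Let P_below l n : P (below l n) = (G l n)%:E.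
Proof.
rewrite /below /lt; case: (leqP (4 ^ l)%N n) => [h|_] /=.
  rewrite G_top // -(@probability_setT _ _ _ P); congr (P _).
  by apply/seteqP; split.
case: n => [|n] /=.
  by rewrite (_ : [set _ | _] = set0) ?measure0 ?G_0 //; by apply/seteqP; split.
by apply: uniform_prob_lt; rewrite G_ge0 G_le1.
Qed.

Let cell l n : set R := below l n.+1 `\` below l n.

Let cellP l n t : cell l n t <-> idx l t = n.
Proof.
rewrite /cell /below /= -!idx_lt ltnS; split; last by move=> ->; rewrite ltnn.
by move=> [h /negP]; rewrite -leqNgt => h'; apply/eqP; rewrite eqn_leq h h'.
Qed.

Let cell_measurable l n : measurable (cell l n).
Proof. by apply: measurableD; exact: below_measurable. Qed.

Let P_cell l n : P (cell l n) = (G l n.+1 - G l n)%:E.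
Proof.
rewrite measureD //; try exact: below_measurable; last by rewrite [X in (X < _)%E]P_below ltry.
rewrite setIidr; last by move=> t; exact: lt_mono.
by rewrite [X in (X - _)%E]P_below [X in (_ - X)%E]P_below.
Qed.

Let idx_max l t : (idx l t < 4 ^ l)%N.
Proof. by rewrite idx_lt /lt leqnn. Qed.

Let idxE l t (h : nat -> R) : h (idx l t) = \sum_(n < 4 ^ l) h n * \1_(cell l n) t.
Proof.
rewrite (bigD1 (Ordinal (idx_max l t))) //= indicE mem_set; last exact/cellP.
rewrite mulr1 big1 ?addr0 // => n nt; rewrite indicE memNset ?mulr0 //.
by move=> /cellP h'; move: nt; rewrite -(inj_eq val_inj) /= h' eqxx.
Qed.

Let m_cell l n : measurable_fun setT (\1_(cell l n) : R -> R).
Proof. by apply: measurable_indic; exact: cell_measurable. Qed.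

Let m_term l n (a : R) : measurable_fun setT (fun t : R => a * \1_(cell l n) t).
Proof. by apply: measurable_funM; [exact: measurable_cst | exact: m_cell]. Qed.

Let m_idx l (h : nat -> R) : measurable_fun setT (fun t => h (idx l t)).
Proof.
rewrite (_ : (fun t => _) = fun t => \sum_(n < 4 ^ l) h n * \1_(cell l n) t).
  by apply: measurable_sum => n; exact: m_term.
by apply/funext => t; rewrite -idxE.
Qed.

Let P_int (f : R -> R) (B : R) : measurable_fun setT f -> (forall t, `|f t| <= B) ->
  P.-integrable setT (EFin \o f).
Proof.
move=> mf fB; apply: measurable_bounded_integrable => //.
  by rewrite [X in (X < _)%E]probability_setT ltry.
by exists B; split; rewrite ?num_real // => M BM t _ /=; rewrite (le_trans (fB t)) // ltW.
Qed.

Let int_idx l (h : nat -> R) :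
  \int[P]_t h (idx l t) = \sum_(n < 4 ^ l) h n * (G l n.+1 - G l n).
Proof.
under eq_Rintegral do rewrite idxE.
have i1 n : P.-integrable setT (EFin \o (fun t => h n * \1_(cell l n) t)).
  apply: (P_int (B := `|h n|)); first exact: m_term.
  by move=> t; rewrite normrM ler_piMr // indicE; case: (_ \in _); rewrite ?normr1 ?normr0.
elim: (4 ^ l)%N => [|m IH].
  under eq_Rintegral do rewrite big_ord0.
  by rewrite big_ord0 Rintegral_cst // mul0r.
under eq_Rintegral do rewrite big_ord_recr /=.
rewrite RintegralD //; last 1 first.
  apply: (P_int (B := \sum_(n < m) `|h n|)).
    by apply: measurable_sum => n; exact: m_term.
  move=> t; apply: le_trans (ler_norm_sum _ _ _) _; apply: ler_sum => n _.
  by rewrite normrM ler_piMr // indicE; case: (_ \in _); rewrite ?normr1 ?normr0.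
rewrite IH big_ord_recr /= RintegralZl //.
  congr (_ + _ * _); rewrite /Rintegral integral_indic //; last exact: cell_measurable.
  by rewrite setIT [X in fine X]P_cell.
apply: (P_int (B := 1)); first exact: m_cell.
by move=> t; rewrite indicE; case: (_ \in _); rewrite ?normr1 ?normr0.
Qed.

Let d l : R := L / 2 ^+ l.

Let d_ge0 l : 0 <= d l. Proof. by rewrite divr_ge0 ?exprn_ge0 // ltW. Qed.

Let dS l : d l = d l.+1 + d l.+1.
Proof.
have h : (2 : R) ^+ l != 0 by rewrite expf_neq0.
by rewrite /d exprS; field.
Qed.

Let a1 t l := (zdec c L l (idx l t)).1.
Let a2 t l := (zdec c L l (idx l t)).2.
Let X1 t : R := lim (a1 t @ \oo).
Let X2 t : R := lim (a2 t @ \oo).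

Let X1P t : a1 t @ \oo --> X1 t /\ forall l, a1 t l <= X1 t <= a1 t l + d l.
Proof.
by apply: nested_cvg => // l; rewrite /a1; have [a [b []]] := zdecS c L0 l (idx l.+1 t);
  rewrite idxS -/(d _) => ha hb -> /=; rewrite ?(dS l); lra.
Qed.

Let X2P t : a2 t @ \oo --> X2 t /\ forall l, a2 t l <= X2 t <= a2 t l + d l.
Proof.
by apply: nested_cvg => // l; rewrite /a2; have [a [b []]] := zdecS c L0 l (idx l.+1 t);
  rewrite idxS -/(d _) => ha hb -> /=; rewrite ?(dS l); lra.
Qed.

Let X t : R * R := (X1 t, X2 t).

Let mX : measurable_fun setT X.
Proof.
apply: measurable_fun_pair.
  apply: (measurable_fun_cvg (h := fun l t => a1 t l)) => [l|t _]; last by have [] := X1P t.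
  exact: (m_idx l (fun n => (zdec c L l n).1)).
apply: (measurable_fun_cvg (h := fun l t => a2 t l)) => [l|t _]; last by have [] := X2P t.
exact: (m_idx l (fun n => (zdec c L l n).2)).
Qed.

(* Only points of positive weight in the same cell as [X t] can charge that cell *)
Let X_atom t e K : 0 <= t < 1 -> 0 < e ->
  exists k, (K <= k)%N /\ exists i, 0 < w k i /\ maxnorm (x k i - X t) < e.
Proof.
move=> /andP[t0 t1] e0; have [l hl] := half_power_lt L e0.
apply: contrapT => hn; set n := idx l t.
have Gt : G l n < G l n.+1.
  have : lt l n.+1 t by rewrite -idx_lt.
  have : ~~ lt l n t by rewrite -idx_lt ltnn.
  rewrite /lt negb_or -ltnNge => /andP[n4]; rewrite negb_and -leqNgt -leNgt leqn0.
  move=> h1 h2; apply: (@le_lt_trans _ _ t).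
    by case/orP: h1 => [/eqP ->|//]; rewrite G_0.
  by case/orP: h2 => [/G_top ->|//].
have : G l n = G l n.+1; last by move=> h; rewrite h ltxx in Gt.
apply/eqP; rewrite eq_le (G_mono l (leqnSn n)) /=.
apply: (ler_cvg_to (@G_cvg l n.+1) (@G_cvg l n)); apply: (ultra_nearW (K := K)) => k Kk.
apply: ler_sum => i _; rewrite /gcode ltnS leq_eqVlt.
have [->|wi] := eqVneq (w k i) 0; first by rewrite !mul0r.
have wi0 : 0 < w k i by rewrite lt_def wi w0.
case: eqP => [h|//]; exfalso; apply: hn; exists k; split => //; exists i; split => //.
have [b1 b2] := @zdec_zcode _ c L l (x k i) (xbox i).1 (xbox i).2.
have [_ /(_ l) c1] := X1P t; have [_ /(_ l) c2] := X2P t.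
move: b1 b2; rewrite h => b1 b2.
rewrite /maxnorm gt_max; apply/andP; split; apply: le_lt_trans hl; rewrite -/(d l) /=.
  by move: c1 b1; rewrite /a1 -/n -/(d l) ler_norml; lra.
by move: c2 b2; rewrite /a2 -/n -/(d l) ler_norml; lra.
Qed.

Let mu := distribution P (@mfun_Sub _ _ (measurableTypeR R) (R * R)%type X (mem_set mX)).

Let int_mu (g : R * R -> R) (B : R) : measurable_fun setT g -> (forall y, `|g y| <= B) ->
  \int[mu]_y g y = \int[P]_t g (X t).
Proof.
move=> mg gB; rewrite /Rintegral integral_distribution //.
  by apply/measurable_EFinP.
apply: (P_int (f := g \o X) (B := B)); first exact: measurableT_comp.
by move=> t; exact: gB.
Qed.

(** Both sides are compared with the step function that samples [g] at the cell corners, whose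
    integral is a finite combination of the limits [G l n]. A limit of cell masses need not be the
    mass that the limit law gives to the cell, as mass may drift to an edge; the comparison only
    uses that the closed cell contains both the sample points and [X t]. *)
Let int_Lam (g : R * R -> R) (B K : R) : measurable_fun setT g -> (forall y, `|g y| <= B) ->
  0 <= K -> (forall y z, `|g y - g z| <= K * (`|y.1 - z.1| + `|y.2 - z.2|)) ->
  \int[P]_t g (X t) = Lam g.
Proof.
move=> mg gB K0 gK.
have key l : `|\int[P]_t g (X t) - Lam g| <= (4 * K * L) / 2 ^+ l.
  pose h n := g (zdec c L l n).
  have hB n : `|h n| <= B by exact: gB.
  have iX : P.-integrable setT (EFin \o (g \o X)).
    by apply: (P_int (f := g \o X) (B := B)) => [|t]; [exact: measurableT_comp|exact: gB].
  have ih : P.-integrable setT (EFin \o (fun t => h (idx l t))).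
    by apply: (P_int (f := fun t => h (idx l t)) (B := B)) => [|t]; [exact: m_idx|exact: hB].
  have h1 : `|\int[P]_t g (X t) - \int[P]_t h (idx l t)| <= K * (d l + d l).
    rewrite -RintegralB //; apply: le_trans (le_normr_Rintegral _ _) _ => //.
      apply: (P_int (f := fun t => g (X t) - h (idx l t)) (B := B + B)).
        by apply: measurable_funB; [exact: measurableT_comp|exact: m_idx].
      by move=> t; rewrite (le_trans (ler_normB _ _)) // lerD.
    have -> : K * (d l + d l) = \int[P]_(t in setT) (K * (d l + d l)).
      by rewrite Rintegral_cst // [X in fine X]probability_setT mulr1.
    apply: le_Rintegral => //.
    - apply: (P_int (f := fun t => `|g (X t) - h (idx l t)|) (B := B + B)).
        apply: measurableT_comp => //.
        by apply: measurable_funB; [exact: measurableT_comp|exact: m_idx].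
      by move=> t; rewrite normr_id (le_trans (ler_normB _ _)) // lerD.
    - by apply: (P_int (f := fun t => K * (d l + d l)) (B := `|K * (d l + d l)|)).
    - move=> t _; apply: le_trans (gK _ _) _; rewrite ler_wpM2l // /X /=.
      have [_ /(_ l) c1] := X1P t; have [_ /(_ l) c2] := X2P t.
      by rewrite lerD // ler_norml; move: c1 c2 (d_ge0 l); rewrite /a1 /a2; lra.
  have h2 : `|\int[P]_t h (idx l t) - Lam g| <= K * (d l + d l).
    rewrite int_idx; set S := \sum_(n < _) _.
    pose Sk k := \sum_(n < 4 ^ l) h n * (Lk (gcode l n.+1) k - Lk (gcode l n) k).
    have cS : Sk k - Lk g k @[k --> ultra_nat] --> S - Lam g.
      apply: cvgB; last exact: Lam_cvg gB.
      rewrite /Sk /S; elim: (4 ^ l)%N => [|m IH].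
        by rewrite big_ord0; under eq_fun do rewrite big_ord0; exact: cvg_cst.
      rewrite big_ord_recr; under eq_fun do rewrite big_ord_recr.
      by apply: cvgD => //; apply: cvgMl_tmp; apply: cvgB; exact: G_cvg.
    have SkE k : Sk k = Lk (fun y => h (zcode c L l y)) k.
      rewrite /Sk /Lk; under eq_bigr do rewrite -sumrB mulr_sumr.
      rewrite exchange_big; apply: eq_bigr => i _ /=.
      rewrite (bigD1 (Ordinal (zcode_lt c L l (x k i)))) //= big1 ?addr0.
        by rewrite /gcode ltnSn ltnn mulr0 subr0 mulr1 mulrC.
      move=> n /eqP nz; rewrite /gcode ltnS leq_eqVlt.
      case: eqP => [zn|_]; last by rewrite subrr mulr0.
      by case: nz; apply: val_inj.
    have h3 k : `|Sk k - Lk g k| <= K * (d l + d l).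
      rewrite SkE -sumrB -(Lk_cst (K * (d l + d l)) k).
      apply: le_trans (ler_norm_sum _ _ _) _; apply: ler_sum => i _.
      rewrite -mulrBr normrM ger0_norm // ler_wpM2l //.
      apply: le_trans (gK _ _) _; rewrite ler_wpM2l //.
      have [] := @zdec_zcode _ c L l (x k i) (xbox i).1 (xbox i).2; rewrite -/(d l).
      by move=> b1 b2; rewrite lerD // ler_norml; lra.
    apply: (cvgr_to_le (F := ultra_nat) (f := fun k => `|Sk k - Lk g k|)).
      exact: cvg_norm.
    by apply: (ultra_nearW (K := 0%N)).
  have -> : 4 * K * L / 2 ^+ l = K * (d l + d l) + K * (d l + d l).
    by rewrite /d; ring.
  by rewrite (le_trans (ler_distD (\int[P]_t h (idx l t)) _ _)) // lerD.
apply/eqP; rewrite -subr_eq0 -normr_le0; apply/ler_addgt0Pr => e e0; rewrite add0r.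
by have [l hl] := half_power_lt (4 * K * L) e0; apply: le_trans (key l) (ltW hl).
Qed.

Let m_dotp xi : measurable_fun setT (fun y : R * R => 2 * pi * dotp xi y).
Proof.
apply: measurable_funM; first exact: measurable_cst.
by apply: measurable_funD; apply: measurable_funM; try exact: measurable_cst;
  [exact: measurable_fst | exact: measurable_snd].
Qed.

Let dotp_lip xi (y z : R * R) : `|2 * pi * dotp xi y - 2 * pi * dotp xi z| <=
  2 * pi * maxnorm xi * (`|y.1 - z.1| + `|y.2 - z.2|).
Proof.
have p0 : 0 <= 2 * pi :> R by rewrite mulr_ge0 // pi_ge0.
rewrite -mulrBr normrM ger0_norm // -mulrA ler_wpM2l //.
have -> : dotp xi y - dotp xi z = xi.1 * (y.1 - z.1) + xi.2 * (y.2 - z.2).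
  by rewrite /dotp; ring.
rewrite [leRHS]mulrDr (le_trans (ler_normD _ _)) // !normrM lerD // ler_wpM2r //.
  by rewrite /maxnorm le_max lexx.
by rewrite /maxnorm le_max lexx orbT.
Qed.

Let int_trig (f : R -> R) xi : continuous f -> (forall a, `|f a| <= 1) ->
  (forall a b, `|f a - f b| <= `|a - b|) ->
  Lk (fun y => f (2 * pi * dotp xi y)) k @[k --> ultra_nat] -->
    \int[mu]_y f (2 * pi * dotp xi y).
Proof.
move=> cf f1 flip.
have mg : measurable_fun setT (fun y : R * R => f (2 * pi * dotp xi y)).
  apply: (@measurableT_comp _ _ _ _ _ _ f); first exact: continuous_measurable_fun.
  exact: m_dotp.
have gB y : `|f (2 * pi * dotp xi y)| <= 1 by exact: f1.
rewrite (int_mu mg gB) (int_Lam (K := 2 * pi * maxnorm xi) mg gB).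
- exact: Lam_cvg gB.
- by rewrite !mulr_ge0 ?pi_ge0 // /maxnorm le_max normr_ge0.
- by move=> y z; exact: le_trans (flip _ _) (dotp_lip _ _ _).
Qed.

(** The second clause transfers pointwise information: a support point is approached by atoms of
    positive weight with arbitrarily large [k], so whatever holds at all these atoms can be passed
    to the limit. The first clause is stated with squares because cosine and sine sums converge
    separately. *)
Lemma limit_measure : exists mu : probability (R * R)%type R,
  (forall (xi : R * R) (B : R) K, 0 <= B ->
    (forall k, (K <= k)%N -> (\sum_i w k i * cos (2 * pi * dotp xi (x k i))) ^+ 2 +
      (\sum_i w k i * sin (2 * pi * dotp xi (x k i))) ^+ 2 <= B ^+ 2) ->
    fourier_abs mu xi <= B) /\
  (forall y, msupport mu y -> forall e K, 0 < e ->
    exists k, (K <= k)%N /\ exists i, 0 < w k i /\ maxnorm (x k i - y) < e).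
Proof.
exists mu; split.
  move=> xi B K B0 hB; rewrite /fourier_abs /fourier_re /fourier_im sqrrN.
  rewrite -[leRHS]ger0_norm // -sqrtr_sqr ler_wsqrtr //.
  have hc := @int_trig _ xi (@continuous_cos R) (@cos_max R) (@norm_cosB R).
  have hs := @int_trig _ xi (@continuous_sin R) (@sin_max R) (@norm_sinB R).
  apply: (cvgr_to_le (F := ultra_nat) (cvgD (cvgM hc hc) (cvgM hs hs))).
  by apply: (ultra_nearW (K := K)) => k Kk; exact: hB.
move=> y ysupp e K e0; have e20 : 0 < e / 2 by rewrite divr_gt0.
have hpos := ysupp _ e20.
have [t [t01 ty]] : exists t, 0 <= t < 1 /\ maxnorm (X t - y) < e / 2.
  apply: contrapT => hn; move: hpos; rewrite lt_neqAle => /andP[/eqP hpos _]; apply: hpos.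
  set D := [set _ | _].
  have mD : measurable (X @^-1` D).
    have [/= m1 m2] := (measurable_fun_pairP X).1 mX.
    have mI (z r : R) : measurable (`]z - r, z + r[%classic : set R) by exact: measurable_itv.
    have := measurableI _ _ (m1 measurableT _ (mI y.1 (e / 2))) (m2 measurableT _ (mI y.2 (e / 2))).
    rewrite !setTI (_ : _ `&` _ = X @^-1` D) //; apply/seteqP; split => t /=.
      rewrite !in_itv /D /= /maxnorm gt_max !ltr_norml /=.
      by move=> [/andP[? ?] /andP[? ?]]; apply/andP; split; lra.
    rewrite !in_itv /D /= /maxnorm gt_max !ltr_norml /= => /andP[? ?].
    by split; lra.
  have m0 (a : R) : measurable [set t : R | t < a].
    rewrite (_ : [set _ | _] = `]-oo, a[%classic); first exact: measurable_itv.
    by apply/seteqP; split => t; rewrite /= in_itv.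
  (* [X_atom] says nothing about [t] outside [[0, 1)]; these parameters form a null set of the
     uniform law. *)
  have P0 : P ([set t | t < 0] `|` ~` [set t | t < 1]) = 0%E.
    apply/eqP; rewrite -measure_le0; apply: le_trans (measureU2 _ _ _) _.
    - exact: m0.
    - apply: measurableC; exact: m0.
    - rewrite [X in (X + _)%E]uniform_prob_lt ?lexx ?ler01 //.
      have := probability_setC P (m0 1).
      by rewrite [X in (_ - X)%E]uniform_prob_lt ?lexx ?ler01 // subee // => h; rewrite [X in (_ + X)%E]h add0e.
  apply/esym; change (P (X @^-1` D) = 0%E); apply: (subset_measure0 _ _ _ P0) => //.
    by apply: measurableU; [exact: m0|apply: measurableC; exact: m0].
  move=> t Dt /=; have [t0|t0] := ltP t 0; first by left.
  by right => t1; apply: hn; exists t; rewrite t0 t1.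
have [k [Kk [i [wi xi]]]] := X_atom K t01 e20.
exists k; split => //; exists i; split => //.
have -> : x k i - y = (x k i - X t) + (X t - y) by rewrite addrA subrK.
by apply: le_lt_trans (maxnormD _ _) _; rewrite [ltRHS]splitr ltrD.
Qed.

End LimitMeasure.

(** * Kernels on the grid *)

Section Exponential.
Variable R : realType.
Implicit Types (a b t : R) (z : R[i]).

Definition ex a : R[i] := cos (2 * pi * a) +i* sin (2 * pi * a).

Lemma exD a b : ex (a + b) = ex a * ex b.
Proof.
rewrite /ex mulrDr cosD sinD; apply/eqP; rewrite eq_complex /=.
by apply/andP; split; apply/eqP; ring.
Qed.

Lemma ex0 : ex 0 = 1.
Proof. by rewrite /ex mulr0 cos0 sin0. Qed.

Lemma normc_ex a : normc (ex a) = 1.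
Proof. by rewrite /ex /normc cos2Dsin2 sqrtr1. Qed.

Lemma ex_natr n : ex n%:R = 1.
Proof.
elim: n => [|n IH]; first exact: ex0.
rewrite -natr1 exD IH mul1r /ex mulr1 mulr_natl cos2pi sin2pi //.
Qed.

Lemma exN a : ex (- a) * ex a = 1.
Proof. by rewrite -exD addNr ex0. Qed.

Lemma ex_int (z : int) : ex z%:~R = 1.
Proof.
case: z => n; first exact: ex_natr.
by have := exN n.+1%:R; rewrite ex_natr mulr1 NegzE intrN.
Qed.

Lemma ex_sum (I : Type) (s : seq I) (f : I -> R) :
  ex (\sum_(i <- s) f i) = \prod_(i <- s) ex (f i).
Proof. by apply: (big_morph ex exD ex0). Qed.

Lemma exX a n : ex a ^+ n = ex (n%:R * a).
Proof.
elim: n => [|n IH]; first by rewrite mul0r ex0.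
by rewrite exprS IH -exD -natr1; congr ex; ring.
Qed.

Lemma normc_ge0 z : 0 <= normc z.
Proof. by case: z => x y; exact: sqrtr_ge0. Qed.

Lemma normc_sum (I : Type) (s : seq I) (P : pred I) (f : I -> R[i]) :
  normc (\sum_(i <- s | P i) f i) <= \sum_(i <- s | P i) normc (f i).
Proof.
apply: (big_ind2 (fun z r => normc z <= r)) => [|x1 x2 y1 y2 h1 h2|//].
  by rewrite normc0.
by rewrite (le_trans (le_normcD _ _)) // lerD.
Qed.

Lemma normcX z n : normc (z ^+ n) = normc z ^+ n.
Proof. by elim: n => [|n IH]; rewrite ?expr0 ?normc1 // !exprS normcM IH. Qed.

Lemma normc_real a : 0 <= a -> normc (a%:C) = a.
Proof. by move=> a0; rewrite /normc /= expr0n addr0 sqrtr_sqr ger0_norm. Qed.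

Lemma normc_sub1ex a : normc (1 - ex a) = 2 * `|sin (pi * a)|.
Proof.
have -> : 1 - ex a = (1 - cos (2 * pi * a)) +i* (- sin (2 * pi * a)).
  by apply/eqP; rewrite eq_complex /= sub0r !eqxx.
rewrite /normc; have -> : 2 * pi * a = (pi * a) *+ 2 by rewrite mulr2n; ring.
rewrite cos_mulr2n sin_mulr2n.
have -> : (1 - (cos (pi * a) ^+ 2 *+ 2 - 1)) ^+ 2 +
   (- ((cos (pi * a) * sin (pi * a)) *+ 2)) ^+ 2 = (2 * sin (pi * a)) ^+ 2.
  have := cos2Dsin2 (pi * a); move: (cos _) (sin _) => x y h.
  have -> : 1 - (x ^+ 2 *+ 2 - 1) = 2 * y ^+ 2 by rewrite mulr2n; lra.
  by transitivity (4 * y ^+ 2 * (x ^+ 2 + y ^+ 2)); [ring|rewrite h; ring].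
by rewrite sqrtr_sqr normrM ger0_norm.
Qed.

Lemma sin_le_id t : `|sin t| <= `|t|.
Proof. by have := norm_sinB t 0; rewrite sin0 !subr0. Qed.

(** A crude form of Jordan's inequality. The mean value theorem with [cos >= 1 / 2] on [[0, 1]]
    gives [x / 2 <= sin x] there; beyond 1, monotonicity and [pi / 2 < 2] suffice. *)
Lemma sin_lower t : 0 <= t <= pi / 2 -> t / 4 <= sin t.
Proof.
move=> /andP[t0 t2].
have pi1 : 1 <= pi / 2 :> R by exact: pihalf_ge1.
have c1 : 1 / 2 <= cos (1 : R).
  have e1 : (1 / 2) *+ 2 = 1 :> R by rewrite mulr2n -splitr.
  have := cos_mulr2n (1 / 2 : R); rewrite e1 cos2sin2 => ->.
  have h : `|sin (1 / 2 : R)| <= 1 / 2.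
    by rewrite (le_trans (sin_le_id _)) // ger0_norm // divr_ge0.
  have h2 : sin (1 / 2 : R) ^+ 2 <= 1 / 4.
    rewrite -real_normK ?num_real // [X in _ <= X](_ : _ = (1 / 2) ^+ 2); last by field.
    by rewrite lerXn2r // nnegrE divr_ge0.
  lra.
have small (x : R) : 0 <= x <= 1 -> x / 2 <= sin x.
  move=> /andP[x0 x1]; have [->|xn0] := eqVneq x 0; first by rewrite mul0r sin0.
  have xp : 0 < x by rewrite lt_def xn0.
  have [y] := @MVT R sin cos 0 x xp (fun y _ => is_derive_sin y)
    (continuous_subspaceT (@continuous_sin R)).
  rewrite in_itv /= sin0 !subr0 => /andP[y0 yx] ->.
  rewrite mulrC ler_pM2r //; apply: le_trans (_ : 1 / 2 <= _); first lra.
  apply: le_trans c1 _; rewrite leNgt; apply/negP.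
  have pi2 := pi_ge2 R; rewrite ltr_cos ?in_itv /=; lra.
have [t1|t1] := leP t 1.
  by apply: le_trans (small t _); lra.
have p4 : pi / 2 < 2 :> R by exact: pihalf_lt2.
have s1 := small 1 ltac:(lra).
apply: le_trans (_ : sin 1 <= _); first lra.
by rewrite leNgt; apply/negP; rewrite ltr_sin ?in_itv /=; lra.
Qed.

End Exponential.

(** * Dirichlet kernels modulo [N] *)

Section Dirichlet.
Variables (R : realType) (N : nat).
Hypothesis N0 : (0 < N)%N.
Implicit Types (t : R) (h : nat).

Let NR0 : (N%:R : R) != 0. Proof. by rewrite pnatr_eq0 -lt0n. Qed.
Let NR_gt0 : 0 < (N%:R : R). Proof. by rewrite ltr0n. Qed.

Lemma geom_sum (z : R[i]) n : (1 - z) * (\sum_(i < n) z ^+ i) = 1 - z ^+ n.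
Proof. by rewrite -opprB mulNr -subrX1 opprB. Qed.

Lemma ex_orthogonal (k : int) :
  \sum_(m < N) ex (m%:R * (k%:~R / N%:R) : R) =
    (if (N %| `|k|)%N then N%:R else 0)%:C.
Proof.
case: ifPn => [/dvdnP[m hm]|kN].
  have [c kE] : exists c : int, k = c * N.
    case: (intP k) hm => [|n|n] /= hm; first by exists 0; rewrite mul0r.
      by exists (m : int); lia.
    by exists (- (m : int)); lia.
  have -> : \sum_(m < N) ex (m%:R * (k%:~R / N%:R) : R) = \sum_(m < N) 1.
    apply: eq_bigr => i _; rewrite kE intrM -[(N : int)%:~R]/(N%:R) mulfK //.
    by rewrite -[i%:R]/((i : int)%:~R) -intrM ex_int.
  by rewrite sumr_const card_ord rmorph_nat.
have z1 : 1 - ex (k%:~R / N%:R : R) != 0.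
  apply/eqP => h; have := normc_sub1ex (k%:~R / N%:R : R).
  rewrite h normc0 => /esym/eqP; rewrite mulf_eq0 pnatr_eq0 /= normr_eq0 => /eqP.
  pose r := (k %% N)%Z; have r0 : 0 <= r by apply: modz_ge0; lia.
  have rN : r < N by apply: ltz_pmod.
  have rn0 : r != 0.
    by apply: contra kN => /eqP /dvdz_mod0P; rewrite /dvdz /=.
  have kE : k = (k %/ N)%Z * N + r by exact: divz_eq.
  have -> : pi * (k%:~R / N%:R) = pi * (r%:~R / N%:R) + pi * (k %/ N)%Z%:~R :> R.
    rewrite {1}kE intrD intrM -[(N : int)%:~R]/(N%:R); field.
    exact: NR0.
  have sinpi_int (c : int) : sin (pi * c%:~R : R) = 0.
    have := normc_sub1ex (c%:~R : R); rewrite ex_int subrr normc0 => /esym/eqP.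
    by rewrite mulf_eq0 pnatr_eq0 /= normr_eq0 => /eqP.
  rewrite sinD sinpi_int mulr0 addr0 => /eqP; rewrite mulf_eq0 => /orP[] /eqP hs.
    have : 0 < sin (pi * (r%:~R / N%:R) : R); last by rewrite hs ltxx.
    apply: sin_gt0_pi; apply/andP; split.
      by rewrite mulr_gt0 ?pi_gt0 // divr_gt0 // ltr0z lt_def rn0.
    rewrite -[X in _ < X]mulr1 ltr_pM2l ?pi_gt0 // ltr_pdivrMr // mul1r.
    by rewrite -[(N%:R : R)]/((N : int)%:~R) ltr_int.
  by have := cos2Dsin2 (pi * (k %/ N)%Z%:~R : R); rewrite hs sinpi_int !expr0n addr0 => /eqP; rewrite eq_sym oner_eq0.
apply: (mulfI z1); rewrite mulr0 -[RHS](subrr 1).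
under eq_bigr do rewrite -exX.
by rewrite geom_sum exX mulrC divfK // ex_int subrr.
Qed.

(** The Fourier transform of the uniform law on the points [j / N] with [j < h]; its powers are
    those of the B-splines. *)
Definition dirk h t : R[i] := (h%:R^-1)%:C * \sum_(j < h) ex (- (t * j%:R / N%:R)).

(* A substitute for [`|t|] that is [N]-periodic and still subadditive. *)
Definition dper t : R := N%:R * `|sin (pi * (t / N%:R))|.

Lemma dper_ge0 t : 0 <= dper t.
Proof. by rewrite mulr_ge0. Qed.

Lemma dper0 : dper 0 = 0.
Proof. by rewrite /dper mul0r mulr0 sin0 normr0 mulr0. Qed.

Lemma dperD t u : dper (t + u) <= dper t + dper u.
Proof.
rewrite /dper -mulrDr ler_wpM2l //.
have -> : pi * ((t + u) / N%:R) = pi * (t / N%:R) + pi * (u / N%:R) by ring.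
rewrite sinD.
rewrite (le_trans (ler_normD _ _)) // !normrM lerD //.
  by rewrite ler_piMr // cos_max.
by rewrite ler_piMl // cos_max.
Qed.

Lemma dperN t : dper (- t) = dper t.
Proof. by rewrite /dper mulNr mulrN sinN normrN. Qed.

Lemma dper_natM n t : dper (n%:R * t) <= n%:R * dper t.
Proof.
elim: n => [|n IH]; first by rewrite !mul0r dper0.
by rewrite -natr1 !mulrDl !mul1r (le_trans (dperD _ _)) // lerD2r.
Qed.

Lemma dper_intM (z : int) t : dper (z%:~R * t) <= `|z|%:~R * dper t.
Proof.
case: z => n; first exact: dper_natM.
by rewrite NegzE intrN mulNr dperN; apply: dper_natM.
Qed.

Lemma dper_lower t : 2 * `|t| <= N%:R -> `|t| / 2 <= dper t.
Proof.
move=> tN; have -> : dper t = dper `|t|.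
  by have [t0|t0] := ger0P t; rewrite ?dperN.
move: `|t| (normr_ge0 t) tN => {}t t0 tN; rewrite /dper.
have pi2 := pi_ge2 R.
have tN0 : 0 <= t / N%:R by rewrite divr_ge0.
have h : (pi * (t / N%:R)) / 4 <= sin (pi * (t / N%:R)).
  apply: sin_lower; rewrite mulr_ge0 //=; last by lra.
  by rewrite ler_pM2l ?pi_gt0 // ler_pdivrMr //; lra.
apply: le_trans (ler_wpM2l (ler0n _ _) (le_trans h (ler_norm _))).
have -> : N%:R * (pi * (t / N%:R) / 4) = pi * t / 4 by field; exact: NR0.
by nra.
Qed.

Lemma dirk0 h : (0 < h)%N -> dirk h 0 = 1.
Proof.
move=> h0; rewrite /dirk (eq_bigr (fun=> 1)); last first.
  by move=> j _; rewrite !mul0r oppr0 ex0.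
rewrite sumr_const card_ord -(rmorph_nat (real_complex R)) -rmorphM mulVf ?rmorph1 //.
by rewrite pnatr_eq0 -lt0n.
Qed.

Lemma normc_dirk_le1 h t : normc (dirk h t) <= 1.
Proof.
have [->|h0] := posnP h; first by rewrite /dirk big_ord0 mulr0 normc0.
have hR : (0 : R) < h%:R by rewrite ltr0n.
rewrite /dirk normcM normc_real ?invr_ge0 // ler_pdivrMl // mulr1.
apply: le_trans (normc_sum _ _ _) _.
by under eq_bigr do rewrite normc_ex; rewrite sumr_const card_ord.
Qed.

Lemma normc_dirk_dper h t : normc (dirk h t) * dper t <= N%:R / h%:R.
Proof.
have [->|h0] := posnP h; first by rewrite /dirk big_ord0 mulr0 normc0 mul0r invr0 mulr0.
have hR : (0 : R) < h%:R by rewrite ltr0n.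
rewrite /dirk normcM normc_real ?invr_ge0 // /dper.
have -> : \sum_(j < h) ex (- (t * j%:R / N%:R)) = \sum_(j < h) ex (- (t / N%:R)) ^+ j.
  by apply: eq_bigr => j _; rewrite exX; congr ex; ring.
have := normc_sub1ex (- (t / N%:R)); rewrite mulrN sinN normrN => e.
have : normc ((1 - ex (- (t / N%:R))) * \sum_(j < h) ex (- (t / N%:R)) ^+ j) <= 2.
  rewrite geom_sum exX (le_trans (le_normcD _ _)) // normcN normc_ex normc1 //.
rewrite normcM e; move: (normc _) (`|sin _|) => x y.
have hi : 0 <= (h%:R : R)^-1 by rewrite invr_ge0.
move=> xy; rewrite [leLHS](_ : _ = N%:R * h%:R^-1 * (x * y)); last by ring.
by rewrite ler_piMr ?mulr_ge0 //; lra.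
Qed.

(** The trivial bound 1 is added to the geometric sum estimate. If [h] is a fixed proportion of [N],
    then [K] does not depend on the grid. *)
Lemma dirk_bound h t (K : R) : 1 + N%:R / h%:R <= K -> normc (dirk h t) <= K / (1 + dper t).
Proof.
move=> hK; have d0 := dper_ge0 t.
rewrite ler_pdivlMr; last by lra.
by rewrite mulrDr mulr1 (le_trans _ hK) // lerD ?normc_dirk_le1 // normc_dirk_dper.
Qed.

Lemma dirk_periodic h t (k : int) : dirk h (t + k%:~R * N%:R) = dirk h t.
Proof.
rewrite /dirk; congr (_ * _); apply: eq_bigr => j _.
have -> : - ((t + k%:~R * N%:R) * j%:R / N%:R) = - (t * j%:R / N%:R) + (- (k * (j : int)))%:~R.
  rewrite intrN intrM -[(j : int)%:~R]/(j%:R); field; exact: NR0.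
by rewrite exD ex_int mulr1.
Qed.

Lemma normc_sqr (z : R[i]) : (normc z ^+ 2)%:C = z * z^*%C.
Proof.
case: z => a b; rewrite /normc sqr_sqrtr ?addr_ge0 ?sqr_ge0 //.
by apply/eqP; rewrite eq_complex /=; apply/andP; split; apply/eqP; ring.
Qed.

Lemma conjc_dirk h t :
  (dirk h t)^*%C = (h%:R^-1)%:C * \sum_(j < h) ex (t * j%:R / N%:R).
Proof.
rewrite /dirk (rmorphM (@conjc R)) (rmorph_sum (@conjc R)); congr (_ * _).
  exact: conjc_real.
by apply: eq_bigr => j _; rewrite /= mulrN cosN sinN opprK.
Qed.

(** In the expanded square, orthogonality keeps only the diagonal, since two indices below [h <= N]
    differ by less than [N]. The result is summability over frequencies, uniformly in the grid. *)
Lemma dirk_parseval h t : (0 < h)%N -> (h <= N)%N ->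
  \sum_(m < N) normc (dirk h (t - m%:R)) ^+ 2 = N%:R / h%:R.
Proof.
move=> h0 hN; apply: (@complexI R); rewrite rmorph_sum /=.
have hR : (h%:R : R) != 0 by rewrite pnatr_eq0 -lt0n.
pose c (j k : nat) := ex (- (t * (j%:R - k%:R) / N%:R)).
have -> : \sum_(m < N) (normc (dirk h (t - m%:R)) ^+ 2)%:C =
    \sum_(m < N) ((h%:R ^- 2)%:C * \sum_(j < h) \sum_(k < h) c j k *
      ex (m%:R * (((j : int) - (k : int))%:~R / N%:R))).
  apply: eq_bigr => m _; rewrite normc_sqr conjc_dirk /dirk.
  rewrite mulrACA -(rmorphM (real_complex R)) -invfM -expr2; congr (_ * _).
  rewrite big_distrl /=; apply: eq_bigr => j _; rewrite big_distrr /=.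
  apply: eq_bigr => k _; rewrite -!exD; congr ex.
  by rewrite intrB -[(j : int)%:~R]/(j%:R) -[(k : int)%:~R]/(k%:R); ring.
rewrite -mulr_sumr exchange_big /=.
have -> : \sum_(j < h) \sum_(m < N) \sum_(k < h) c j k *
      ex (m%:R * (((j : int) - (k : int))%:~R / N%:R)) = \sum_(j < h) N%:R%:C.
  apply: eq_bigr => j _; rewrite exchange_big /= (bigD1 j) //= [X in _ + X]big1 => [|k kj].
    rewrite -mulr_sumr ex_orthogonal subrr absz0 dvdn0 /c subrr mulr0 mul0r oppr0 ex0.
    by rewrite mul1r addr0.
  rewrite -mulr_sumr ex_orthogonal; case: ifPn => [dv|]; last by rewrite mulr0.
  exfalso; move: kj; rewrite -(inj_eq val_inj) /= => /eqP kj.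
  have := ltn_ord k; have := ltn_ord j => jh kh.
  have : (0 < `|(j : int) - (k : int)|)%N by lia.
  by move=> /dvdn_leq /(_ dv); lia.
rewrite sumr_const card_ord.
have -> : (N%:R : R)%:C *+ h = (N%:R * h%:R)%:C by rewrite mulr_natr; exact/esym/(raddfMn (real_complex R)).
by rewrite -(rmorphM (real_complex R)); congr (_%:C); field.
Qed.

End Dirichlet.

Section Centered.
Variables (R : realType) (N : nat).

(** The representative of the class of [i] in [(-N/2, N/2]]. For such representatives a small [dper]
    forces a small integer, by [dper_lower]. *)
Definition centered (i : 'I_N) : int := if (2 * i <= N)%N then (i : int) else (i : int) - (N : int).

Lemma centeredP i : exists k : int, centered i = (i : int) + k * N.
Proof. by rewrite /centered; case: ifP => _; [exists 0|exists (-1)]; lia. Qed.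

Lemma centered_le i : 2 * `|(centered i)%:~R : R| <= N%:R.
Proof.
rewrite -intr_norm -[2]/((2 : int)%:~R) -intrM -[(N%:R : R)]/((N : int)%:~R) ler_int.
by have := ltn_ord i; rewrite /centered; case: ifP; lia.
Qed.

Lemma centered_inj : injective centered.
Proof.
move=> i j; move: (ltn_ord i) (ltn_ord j) => hi hj hij; apply: val_inj => /=.
by move: hij; rewrite /centered; do 2 case: ifP; lia.
Qed.

Hypothesis N0 : (0 < N)%N.

Lemma centered_eq0 i : centered i = 0 -> i = Ordinal N0.
Proof. by move=> hi; apply: val_inj => /=; move: hi (ltn_ord i); rewrite /centered; case: ifP; lia. Qed.

Lemma centered0 : centered (Ordinal N0) = 0.
Proof. by rewrite /centered muln0. Qed.

End Centered.

(** * B-spline kernels and their Fourier expansion *)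

Section Kernel.
Variables (R : realType) (N h : nat).
Hypotheses (N0 : (0 < N)%N) (h0 : (0 < h)%N) (hN : (h <= N)%N).

Let NR0 : (N%:R : R) != 0. Proof. by rewrite pnatr_eq0 -lt0n. Qed.

Lemma dirk_centered (i : 'I_N) : dirk N h (centered i)%:~R = dirk N h (i%:R : R).
Proof. by have [k ->] := centeredP i; rewrite intrD intrM dirk_periodic. Qed.

Lemma ex_centered (i : 'I_N) (y : int) :
  ex ((centered i)%:~R * (y%:~R / N%:R) : R) = ex (i%:R * (y%:~R / N%:R)).
Proof.
have [k ->] := centeredP i.
have -> : ((i : int) + k * N)%:~R * (y%:~R / N%:R) = i%:R * (y%:~R / N%:R) + (k * y)%:~R :> R.
  by rewrite intrD !intrM -[(i : int)%:~R]/(i%:R) -[(N : int)%:~R]/(N%:R); field.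
by rewrite exD ex_int mulr1.
Qed.

(* [N] times the [n]-fold convolution of the uniform law on [{0, ..., h - 1}] modulo [N]. *)
Fixpoint bspline (n : nat) (y : int) : R :=
  if n is n'.+1 then h%:R^-1 * \sum_(j < h) bspline n' (y - (j : nat)%:Z)
  else if (N %| `|y|)%N then N%:R else 0.

Lemma bspline_ge0 n y : 0 <= bspline n y.
Proof.
elim: n y => [|n IH] y /=; first by case: ifP.
by rewrite mulr_ge0 ?invr_ge0 ?ler0n // sumr_ge0.
Qed.

Lemma bspline_support n y : bspline n y != 0 ->
  exists z : nat, (z <= n * h)%N /\ (N %| `|(y - (z : int))%R|)%N.
Proof.
clear NR0 N0 h0 hN; elim: n y => [|n IH] y /=.
  by case: ifP => [d _|]; [exists 0%N; rewrite subr0|rewrite eqxx].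
rewrite mulf_eq0 negb_or => /andP[_ hs].
have [j hj] : exists j : 'I_h, bspline n (y - (j : nat)%:Z) != 0.
  apply/existsP; apply: contraNT hs => /existsPn hn; apply/eqP/big1 => j _.
  by apply/eqP; have := hn j; rewrite negbK.
have [z [zn zd]] := IH _ hj; exists (z + j)%N; split.
  by rewrite mulSn addnC leq_add // ltnW.
by rewrite [X in (_ %| `|X|)%N](_ : _ = y - (j : nat)%:Z - z%:Z) //; lia.
Qed.

Lemma bsplineE n y : (bspline n y)%:C =
  \sum_(i < N) dirk N h (centered i)%:~R ^+ n * ex ((centered i)%:~R * (y%:~R / N%:R)).
Proof.
under eq_bigr do rewrite dirk_centered ex_centered.
elim: n y => [|n IH] y.
  under eq_bigr do rewrite expr0 mul1r.
  by rewrite ex_orthogonal.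
rewrite /= rmorphM rmorph_sum /=; under [in LHS]eq_bigr do rewrite IH.
rewrite exchange_big big_distrr /=; apply: eq_bigr => i _.
rewrite -big_distrr /= mulrCA exprSr -!mulrA; congr (_ * _).
congr (_ * _); rewrite big_distrl /=.
apply: eq_bigr => j _; rewrite -exD; congr ex.
by rewrite intrB -[(j : int)%:~R]/(j%:R); ring.
Qed.

Definition gdot (k x : gint) : R := (k.1 * x.1 + k.2 * x.2)%:~R.
Definition gvec (k : gint) : R * R := (k.1%:~R, k.2%:~R).
Definition mvec (m : 'I_N * 'I_N) : gint := (centered m.1, centered m.2).

Definition kap n (m : 'I_N * 'I_N) : R[i] :=
  (dirk N h (centered m.1)%:~R * dirk N h (centered m.2)%:~R) ^+ n.

Definition Fker n (Q : seq gint) (x : gint) : R :=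
  (size Q)%:R^-1 * \sum_(q <- Q) bspline n (q * x).1 * bspline n (q * x).2.

Lemma Fker_ge0 n Q x : 0 <= Fker n Q x.
Proof.
by rewrite mulr_ge0 ?invr_ge0 ?ler0n // sumr_ge0 // => q _; rewrite mulr_ge0 ?bspline_ge0.
Qed.

(** The adjoint of complex multiplication by [q] for the inner product is multiplication by
    [gconj q], which is how the conjugate enters the frequencies. *)
Lemma FkerE n Q x : (Fker n Q x)%:C = ((size Q)%:R^-1)%:C *
  \sum_(q <- Q) \sum_m kap n m * ex (gdot (gconj q * mvec m) x / N%:R).
Proof.
rewrite /Fker rmorphM rmorph_sum /=; congr (_ * _); apply: eq_bigr => q _.
rewrite rmorphM /= !bsplineE big_distrlr /= pair_big /=; apply: eq_bigr => m _.
rewrite mulrACA /kap [X in _ = X * _]exprMn; congr (_ * _); rewrite -exD; congr ex.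
by rewrite /gdot !gint_mulE /= !(intrD, intrB, intrM, intrN, mulrNz); ring.
Qed.

Section System.
Variables (J : finType) (p : J -> gint).
Implicit Types (u : J -> R) (xi : R * R).

Definition uhat u xi : R[i] :=
  \sum_j (u j)%:C * ex (- ((xi.1 * (p j).1%:~R + xi.2 * (p j).2%:~R) / N%:R)).

Lemma uhat_Fker n Q u xi : uhat (fun j => u j * Fker n Q (p j)) xi =
  ((size Q)%:R^-1)%:C * \sum_(q <- Q) \sum_m kap n m * uhat u (xi - gvec (gconj q * mvec m)).
Proof.
rewrite /uhat.
under eq_bigr => j _.
  rewrite rmorphM /= FkerE mulrAC mulrCA big_distrr /=.
  under eq_bigr => q _ do rewrite big_distrr /=.
  over.
rewrite -big_distrr /= exchange_big /=; congr (_ * _); apply: eq_bigr => q _.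
rewrite exchange_big /=; apply: eq_bigr => m _; rewrite big_distrr /=; apply: eq_bigr => j _.
rewrite mulrCA; congr (_ * _); rewrite -mulrA; congr (_ * _); rewrite -exD; congr ex.
by rewrite /gdot /gvec /= !(intrD, intrM); ring.
Qed.

End System.
End Kernel.

Lemma shift_bound (x : int) (H N : nat) : (`|x| <= H)%N -> (2 * H < N)%N ->
  (`|(x + H%:Z)%R| < N)%N /\ (`|(x + H%:Z)%R|%N : int) = x + H%:Z.
Proof. by lia. Qed.

(** * The effect of one kernel on weighted Fourier bounds *)

Section Bounds.
Variables (R : realType) (N h : nat).
Hypotheses (N0 : (0 < N)%N) (h0 : (0 < h)%N) (hN : (h <= N)%N).
Variable K : R.
Hypothesis hK : 1 + N%:R / h%:R <= K.
Variable s : nat.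

Let NR0 : (N%:R : R) != 0. Proof. by rewrite pnatr_eq0 -lt0n. Qed.
Let NR_gt0 : 0 < (N%:R : R). Proof. by rewrite ltr0n. Qed.

Let K_ge1 : 1 <= K.
Proof. by apply: le_trans hK; rewrite lerDl divr_ge0. Qed.

(** A weight of order [s] that is submultiplicative because [dper] is subadditive; it therefore
    passes through convolutions. *)
Definition wt (xi : R * R) : R := (1 + dper N xi.1 + dper N xi.2) ^+ s.

Lemma wt_ge1 xi : 1 <= wt xi.
Proof. by rewrite /wt exprn_ege1 // -addrA lerDl addr_ge0 // dper_ge0. Qed.

Lemma wt_ge0 xi : 0 <= wt xi. Proof. exact: le_trans (wt_ge1 xi). Qed.
Lemma wt_gt0 xi : 0 < wt xi. Proof. exact: lt_le_trans (wt_ge1 xi). Qed.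

Lemma wtD xi eta : wt (xi + eta) <= wt xi * wt eta.
Proof.
rewrite /wt -exprMn lerXn2r ?nnegrE //.
- by rewrite !addr_ge0 ?dper_ge0.
- by rewrite mulr_ge0 // !addr_ge0 ?dper_ge0.
have := dperD N xi.1 eta.1; have := dperD N xi.2 eta.2 => /=.
move: (dper_ge0 N xi.1) (dper_ge0 N xi.2) (dper_ge0 N eta.1) (dper_ge0 N eta.2).
move: (dper N xi.1) (dper N xi.2) (dper N eta.1) (dper N eta.2) (dper N _) (dper N _).
by move=> a b c d x y a0 b0 c0 d0 h1 h2; nra.
Qed.

Let md (m : 'I_N * 'I_N) : R :=
  Num.max (dper N (centered m.1)%:~R) (dper N (centered m.2)%:~R).

Let md_ge0 m : 0 <= md m.
Proof. by rewrite /md le_max dper_ge0. Qed.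

Let dd (m : 'I_N * 'I_N) : R := normc (dirk N h (centered m.1)%:~R) * normc (dirk N h (centered m.2)%:~R : R[i]).

Let dd_ge0 m : 0 <= dd m. Proof. by rewrite mulr_ge0 ?normc_ge0. Qed.

Let dd_le1 m : dd m <= 1.
Proof. by rewrite mulr_ile1 ?normc_ge0 ?normc_dirk_le1. Qed.

Let dd_md m : dd m <= K / (1 + md m).
Proof.
rewrite /dd /md; case: (leP (dper N (centered m.1)%:~R) (dper N (centered m.2)%:~R)) => _.
  rewrite -[leRHS]mul1r ler_pM ?normc_ge0 ?normc_dirk_le1 //; exact: dirk_bound.
rewrite -[leRHS]mulr1 ler_pM ?normc_ge0 ?normc_dirk_le1 //; exact: dirk_bound.
Qed.

Let kapE n m : normc (kap R h n m) = dd m ^+ n.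
Proof. by rewrite /kap normcX normcM. Qed.

Let sum_dd2 : \sum_(m : 'I_N * 'I_N) dd m ^+ 2 <= K ^+ 2.
Proof.
have P : \sum_(i < N) normc (dirk N h (centered i)%:~R : R[i]) ^+ 2 = N%:R / h%:R.
  rewrite -(@dirk_parseval R N N0 h 0 h0 hN); apply: eq_bigr => i _.
  rewrite dirk_centered // sub0r; congr (_ ^+ 2).
  have normc_conj (z : R[i]) : normc z^*%C = normc z by case: z => a b; rewrite /normc /= sqrrN.
  rewrite -[LHS]normc_conj conjc_dirk; congr normc; rewrite /dirk; congr (_ * _).
  by apply: eq_bigr => j _; rewrite mulNr mulNr opprK.
under eq_bigr do rewrite /dd exprMn.
rewrite -(pair_bigA _ (fun i j : 'I_N => normc (dirk N h (centered i)%:~R : R[i]) ^+ 2 * normc (dirk N h (centered j)%:~R : R[i]) ^+ 2)) /=.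
rewrite -big_distrlr /= P -expr2.
have h1 : N%:R / h%:R <= K by apply: le_trans hK; rewrite lerDr.
have h2 : 0 <= N%:R / h%:R :> R by rewrite divr_ge0.
by rewrite lerXn2r // nnegrE // (le_trans h2).
Qed.

Variables (B : R) (Q : seq gint).
Hypothesis B1 : 1 <= B.
Hypothesis QB : forall q, q \in Q -> `|q.1%:~R| <= B /\ `|q.2%:~R| <= B.

Let A := (4 * B * K) ^+ s.
Let A_ge0 : 0 <= A.
Proof. by rewrite exprn_ge0 // !mulr_ge0 //; [exact: le_trans B1|exact: le_trans K_ge1]. Qed.

(** Each coordinate of [gconj q * mvec m] has [dper] at most [2 * B * md m], whence
    [1 + 4 * B * md m] inside the power. *)
Let wt_qm q m : q \in Q -> wt (gvec R (gconj q * mvec m)) <= (4 * B * (1 + md m)) ^+ s.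
Proof.
move=> /QB[b1 b2]; have d0 := md_ge0 m; rewrite /wt lerXn2r ?nnegrE //.
- by rewrite !addr_ge0 ?dper_ge0.
- by rewrite !mulr_ge0 //; [exact: le_trans B1|lra].
rewrite /gvec /mvec gint_mulE /= /md.
set c1 := centered m.1; set c2 := centered m.2.
have h1 : dper N (c1%:~R : R) <= md m by rewrite /md le_max lexx.
have h2 : dper N (c2%:~R : R) <= md m by rewrite /md le_max lexx orbT.
have hz (z c : int) : `|z%:~R : R| <= B -> dper N (c%:~R : R) <= md m ->
    dper N ((z * c)%:~R : R) <= B * md m.
  move=> zB cm; rewrite intrM; apply: le_trans (dper_intM N z _) _.
  by rewrite intr_norm ler_pM ?dper_ge0.
have e1 : dper N ((q.1 * c1 - - q.2 * c2)%:~R : R) <= B * md m + B * md m.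
  rewrite mulNr opprK intrD; apply: le_trans (dperD _ _ _) _.
  by rewrite lerD ?hz.
have e2 : dper N ((q.1 * c2 + - q.2 * c1)%:~R : R) <= B * md m + B * md m.
  rewrite mulNr intrD intrN; apply: le_trans (dperD _ _ _) _.
  by rewrite dperN lerD ?hz.
rewrite -/(md m); move: d0 e1 e2 B1; move: (md m) (dper N _) (dper N _) => d x y d0 e1 e2 B1'; nra.
Qed.

Let dd_wt q m : q \in Q -> dd m ^+ s * wt (gvec R (gconj q * mvec m)) <= A.
Proof.
move=> qQ; have d0 := md_ge0 m.
have := dd_md m; have := dd_ge0 m; have := wt_qm m qQ; have := wt_ge0 (gvec R (gconj q * mvec m)).
have K0 : 0 <= K by exact: le_trans K_ge1.
move: (wt _) (dd m) (md m) d0 => w x d d0 w0 hw x0 xd; have d1 : 0 < 1 + d by lra.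
apply: le_trans (_ : (K / (1 + d)) ^+ s * (4 * B * (1 + d)) ^+ s <= _).
  by apply: ler_pM => //; rewrite ?exprn_ge0 // lerXn2r ?nnegrE ?divr_ge0 // ltW.
rewrite -exprMn (_ : K / (1 + d) * (4 * B * (1 + d)) = 4 * B * K) //.
by field; rewrite gt_eqF.
Qed.

(** The [s + 3] factors of [kap] are spent as follows: [s] of them pay for the weight of the
    translation, two remain for square summability, and the last one yields the decay
    [1 / (1 + md m)] needed for the far frequencies. *)
Let kap_wt q m : q \in Q -> normc (kap R h (s + 3) m) * wt (gvec R (gconj q * mvec m)) <=
  dd m ^+ 2 * (A * K / (1 + md m)).
Proof.
move=> qQ; rewrite kapE; have := dd_wt m qQ; have := wt_ge0 (gvec R (gconj q * mvec m)).
have := dd_md m; have := dd_ge0 m.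
move: (wt _) (dd m) (md m) => w x d x0 xd w0 hA.
rewrite [leLHS](_ : _ = x ^+ 2 * (x ^+ s * w * x)); last by rewrite exprD; ring.
rewrite ler_wpM2l ?exprn_ge0 // -[leRHS]mulrA.
by apply: ler_pM => //; rewrite mulr_ge0 ?exprn_ge0.
Qed.

(* Summing over all translates makes the bound stable under multiplication by [Fker],
   which convolves the Fourier transform with an absolutely summable sequence. *)
Definition wsum (J : finType) (p : J -> gint) (u : J -> R) (xi : R * R) : R :=
  \sum_(a : 'I_N * 'I_N) normc (uhat N p u (xi - (a.1%:R, a.2%:R))) * wt (xi - (a.1%:R, a.2%:R)).

Section System.
Variables (J : finType) (p : J -> gint) (u : J -> R) (C : R).
Hypothesis TC : forall xi, wsum p u xi <= C.

Lemma uhat_wt xi : normc (uhat N p u xi) * wt xi <= C.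
Proof.
apply: le_trans (TC xi); rewrite /wsum (bigD1 (Ordinal N0, Ordinal N0)) //=.
rewrite [X in _ <= normc (uhat N p u X) * _ + _](_ : _ = xi); last first.
  by case: xi => x y; rewrite /= -[_ - _]/(x - 0, y - 0) !subr0.
rewrite [X in _ <= _ * wt X + _](_ : _ = xi); last first.
  by case: xi => x y; rewrite /= -[_ - _]/(x - 0, y - 0) !subr0.
by rewrite lerDl sumr_ge0 // => a _; rewrite mulr_ge0 ?normc_ge0 ?wt_ge0.
Qed.

Let C0 : 0 <= C.
Proof. by apply: le_trans (uhat_wt 0); rewrite mulr_ge0 ?normc_ge0 ?wt_ge0. Qed.

Let uF := fun j => u j * Fker R N h (s + 3) Q (p j).

Let sum_kap_wt q : q \in Q ->
  \sum_(m : 'I_N * 'I_N) normc (kap R h (s + 3) m) * wt (gvec R (gconj q * mvec m)) <= A * K ^+ 3.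
Proof.
move=> qQ; apply: le_trans (_ : \sum_(m : 'I_N * 'I_N) dd m ^+ 2 * (A * K) <= _).
  apply: ler_sum => m _; apply: le_trans (kap_wt m qQ) _.
  rewrite ler_wpM2l ?exprn_ge0 // ler_pdivrMr; last by have := md_ge0 m; lra.
  by rewrite ler_peMr ?mulr_ge0 //; [exact: le_trans K_ge1|have := md_ge0 m; lra].
rewrite -big_distrl /= [leRHS](_ : _ = K ^+ 2 * (A * K)); last by ring.
by rewrite ler_wpM2r // mulr_ge0 //; exact: le_trans K_ge1.
Qed.

Let size_sum (f : gint -> R) (X : R) : 0 <= X -> (forall q, q \in Q -> f q <= X) ->
  (size Q)%:R^-1 * \sum_(q <- Q) f q <= X.
Proof.
move=> X0 fX; have [Q0|Q0] := posnP (size Q); first by rewrite Q0 invr0 mul0r.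
rewrite ler_pdivrMl ?ltr0n // mulr_natl.
rewrite -[X in _ <= X]addr0 -iter_addr -count_predT -(big_const_seq 0 +%R Q predT X).
by rewrite big_seq [leRHS]big_seq; apply: ler_sum.
Qed.

(** Young's inequality for a weighted sum. The hypothesis is needed at all [xi] because convolution
    translates the point. The factor [A * K ^+ 3] is large but does not depend on the grid. *)
Lemma wsum_Fker xi : wsum p uF xi <= A * K ^+ 3 * C.
Proof.
rewrite /wsum.
have hn (a : 'I_N * 'I_N) : normc (uhat N p uF (xi - (a.1%:R, a.2%:R))) * wt (xi - (a.1%:R, a.2%:R)) <=
  (size Q)%:R^-1 * \sum_(q <- Q) \sum_(m : 'I_N * 'I_N) normc (kap R h (s + 3) m) * wt (gvec R (gconj q * mvec m)) *
   (normc (uhat N p u (xi - gvec R (gconj q * mvec m) - (a.1%:R, a.2%:R))) *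
    wt (xi - gvec R (gconj q * mvec m) - (a.1%:R, a.2%:R))).
  rewrite /uF uhat_Fker // normcM normc_real ?invr_ge0 ?ler0n // -mulrA ler_wpM2l ?invr_ge0 ?ler0n //.
  apply: le_trans (ler_wpM2r (wt_ge0 _) (normc_sum _ _ _)) _.
  rewrite big_distrl /=; apply: ler_sum => q _.
  apply: le_trans (ler_wpM2r (wt_ge0 _) (normc_sum _ _ _)) _.
  rewrite big_distrl /=; apply: ler_sum => m _.
  have hw := wtD (xi - (a.1%:R, a.2%:R) - gvec R (gconj q * mvec m)) (gvec R (gconj q * mvec m)).
  rewrite subrK in hw.
  rewrite normcM -!mulrA ler_wpM2l ?normc_ge0 //.
  rewrite (addrAC xi (- gvec _ _)) mulrCA ler_wpM2l ?normc_ge0 // mulrC.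
  exact: hw.
apply: le_trans (ler_sum _ (fun a _ => hn a)) _.
rewrite -big_distrr /= exchange_big /=; apply: size_sum => [|q qQ].
  by rewrite mulr_ge0 // mulr_ge0 // exprn_ge0 // (le_trans ler01).
rewrite exchange_big /=; apply: le_trans (_ : \sum_(m : 'I_N * 'I_N) normc (kap R h (s + 3) m) * wt (gvec R (gconj q * mvec m)) * C <= _).
  apply: ler_sum => m _; rewrite -big_distrr /= ler_wpM2l ?mulr_ge0 ?normc_ge0 ?wt_ge0 //.
  exact: TC.
by rewrite -big_distrl /= ler_wpM2r // sum_kap_wt.
Qed.

Variables (Lc : R) (H Rm : nat).
Hypothesis Lc0 : 0 <= Lc.
Hypothesis HN : (2 * H < N)%N.
Hypothesis HL : 4 * B * Lc <= H%:R.
Hypothesis Q0 : forall q, q \in Q -> q != 0.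
Hypothesis Qsize : (0 < size Q)%N.
Hypothesis Qdiv : forall k : gint, k != 0 -> (`|k.1| <= H)%N -> (`|k.2| <= H)%N ->
  (count (fun q => `[< gdvd (gconj q) k >]) Q <= Rm)%N.

Let m0 : 'I_N * 'I_N := (Ordinal N0, Ordinal N0).
(** For these [m] the coordinates of [gconj q * mvec m] are at most [H]: two products, each at most
    [B] times [2 * Lc]. The divisor count is available there; all other nonzero frequencies are left
    to the decay of [kap]. *)
Let near0 m := (m != m0) && (md m <= Lc).
Let g xi := normc (uhat N p u xi) * wt xi.

Let g_ge0 xi : 0 <= g xi. Proof. by rewrite mulr_ge0 ?normc_ge0 ?wt_ge0. Qed.

(* Each frequency [k] is hit by at most [Rm] pairs [(q, m)], because [conj q] divides [k]. *)
Let near_sum xi : \sum_(q <- Q) \sum_(m : 'I_N * 'I_N | near0 m) g (xi - gvec R (gconj q * mvec m)) <= Rm%:R * C.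
Proof.
(* Shifting by [(H, H)] turns coordinates of absolute value at most [H] into indices below [N], so
   the sum over near frequencies becomes part of [wsum] at [xi + (H, H)]. *)
pose g' (a : 'I_N * 'I_N) := g (xi + (H%:R, H%:R) - (a.1%:R, a.2%:R)).
pose rel (q : gint) (m a : 'I_N * 'I_N) := let k := gconj q * mvec m in
  (k.1 + H%:Z == a.1%:Z) && (k.2 + H%:Z == a.2%:Z).
have small q m : q \in Q -> near0 m -> let k := gconj q * mvec m in
    [/\ k != 0, (`|k.1| <= H)%N & (`|k.2| <= H)%N].
  move=> qQ /andP[mn0 mL]; have [b1 b2] := QB qQ.
  have cL (i : 'I_N) : dper N ((centered i)%:~R : R) <= Lc -> `|(centered i)%:~R : R| <= 2 * Lc.
    by move=> iL; have := dper_lower N0 (centered_le R i); lra.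
  have [c1 c2] : `|(centered m.1)%:~R : R| <= 2 * Lc /\ `|(centered m.2)%:~R : R| <= 2 * Lc.
    by move: mL; rewrite /md ge_max => /andP[/cL ? /cL ?].
  have bnd (x y z t : int) : `|x%:~R : R| <= B -> `|y%:~R : R| <= B ->
      `|z%:~R : R| <= 2 * Lc -> `|t%:~R : R| <= 2 * Lc -> (`|(x * z + y * t)%R| <= H)%N.
    move=> hx hy hz ht; rewrite -lez_nat abszE -(ler_int R) intr_norm.
    rewrite -[leRHS]/(H%:R) (le_trans _ HL) // intrD !intrM.
    apply: le_trans (ler_normD _ _) _; rewrite !normrM.
    have := ler_pM (normr_ge0 _) (normr_ge0 _) hx hz.
    have := ler_pM (normr_ge0 _) (normr_ge0 _) hy ht.
    lra.
  split.
  - apply/eqP => /gint_mulf_eq0[] h1.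
      by have := Q0 qQ; rewrite -gn_eq0 -gn_conj h1.
    by move: mn0; rewrite /m0; case: m h1 {mL c1 c2} => i j [/centered_eq0 -> /centered_eq0 ->]; rewrite eqxx.
  - rewrite gint_mulE /= mulNr opprK; exact: bnd.
  - rewrite gint_mulE /=; apply: bnd => //.
    by rewrite intrN normrN.
have cnt a : (\sum_(q <- Q) \sum_(m : 'I_N * 'I_N | near0 m) rel q m a <= Rm)%N.
  pose k0 : gint := (a.1%:Z - H%:Z, a.2%:Z - H%:Z).
  have relE q m : rel q m a -> gconj q * mvec m = k0.
    rewrite /rel /k0; case: (gconj q * mvec m) => x y /andP[/eqP /= h1 /eqP /= h2].
    by rewrite -h1 -h2 !addrK.
  have [/hasP[q qQ /existsP[m /andP[mn hr]]]|/hasPn hn] :=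
    boolP (has (fun q => [exists m : 'I_N * 'I_N, near0 m && rel q m a]) Q); last first.
    rewrite big_seq big1 // => q qQ; rewrite big1 // => m mn; apply/eqP; rewrite eqb0.
    by have := hn q qQ; rewrite negb_exists => /forallP /(_ m); rewrite mn.
  have [kn0 k1 k2] := small q m qQ mn; rewrite (relE _ _ hr) in kn0 k1 k2.
  apply: leq_trans (Qdiv kn0 k1 k2); rewrite -sum1_count [leqRHS]big_mkcond /=.
  rewrite big_seq [leqRHS]big_seq; apply: leq_sum => {qQ hr mn}q qQ.
  have [/existsP[m1 /andP[mn1 hr1]]|] := boolP [exists m : 'I_N * 'I_N, near0 m && rel q m a]; last first.
    rewrite negb_exists => /forallP hm; rewrite big1 // => m' mn'; apply/eqP; rewrite eqb0.
    by have := hm m'; rewrite mn'.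
  have -> : `[< gdvd (gconj q) k0 >] by apply/asboolP; exists (mvec m1); rewrite (relE _ _ hr1).
  rewrite (bigD1 m1) //= hr1 big1 // => m2 /andP[_ m21]; apply/eqP; rewrite eqb0.
  apply: contra m21 => hr2.
  have : mvec m2 = mvec m1.
    apply: (@gint_mulIf (gconj q)); last by rewrite (relE _ _ hr1) (relE _ _ hr2).
    by rewrite -gn_eq0 gn_conj gn_eq0; exact: Q0.
  by case: m1 m2 {mn1 hr1 hr2} => [i j] [i' j'] [/centered_inj -> /centered_inj ->].
apply: le_trans (_ : \sum_(q <- Q) \sum_(m : 'I_N * 'I_N | near0 m) \sum_a (rel q m a)%:R * g' a <= _).
  rewrite big_seq [leRHS]big_seq; apply: ler_sum => q qQ; apply: ler_sum => m mn.
  have [kn0 k1 k2] := small q m qQ mn;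
  have [i1 e1] := shift_bound k1 HN; have [i2 e2] := shift_bound k2 HN.
  rewrite (bigD1 (Ordinal i1, Ordinal i2)) //=.
  have -> : rel q m (Ordinal i1, Ordinal i2) by rewrite /rel /= e1 e2 !eqxx.
  have -> : g' (Ordinal i1, Ordinal i2) = g (xi - gvec R (gconj q * mvec m)).
    have cast (n : nat) (x : int) : (n : int) = x + H%:Z -> n%:R = x%:~R + H%:R :> R.
      by move=> nx; rewrite -[n%:R]/((n : int)%:~R) nx intrD.
    rewrite /g' /= (cast _ _ e1) (cast _ _ e2); congr g; rewrite /gvec.
    by case: (xi) => z t; congr pair => /=; ring.
  rewrite mul1r lerDl sumr_ge0 // => a _.
  by apply: mulr_ge0; [exact: ler0n|exact: g_ge0].
apply: le_trans (_ : \sum_a (Rm%:R * g' a) <= _); last first.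
  rewrite -big_distrr /= ler_wpM2l //; exact: TC.
under eq_bigr do rewrite exchange_big /=.
rewrite exchange_big /=; apply: ler_sum => a _.
under eq_bigr do rewrite -big_distrl /=.
rewrite -big_distrl /=; apply: ler_wpM2r; first exact: g_ge0.
have := cnt a; rewrite -(ler_nat R) => hc; apply: le_trans hc.
by rewrite natr_sum; apply: ler_sum => q _; rewrite natr_sum.
Qed.

Let Sup xi : R := Num.min 1 (A / wt xi).

(** Besides the trivial bound 1 for [kap], its [s] factors control the weight of the translation,
    and [wt xi] is at most that weight times the weight at the translated point; this gives
    [A / wt xi]. *)
Let near_term q (m : 'I_N * 'I_N) xi : q \in Q ->
  normc (kap R h (s + 3) m * uhat N p u (xi - gvec R (gconj q * mvec m))) <=
  Sup xi * g (xi - gvec R (gconj q * mvec m)).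
Proof.
move=> qQ; rewrite normcM kapE /g mulrCA mulrC ler_wpM2l ?normc_ge0 //.
have hw := wtD (xi - gvec R (gconj q * mvec m)) (gvec R (gconj q * mvec m)).
rewrite subrK in hw; have := dd_wt m qQ.
have := wt_ge1 (xi - gvec R (gconj q * mvec m)).
have := wt_ge0 (gvec R (gconj q * mvec m)); have := wt_gt0 xi; move: hw; rewrite /Sup.
have := dd_ge0 m; have := dd_le1 m.
move: (wt xi) (wt (xi - _)) (wt (gvec _ _)) (dd m) => w w1 w2 x x1 x0 hw w0 w20 w11 hx.
have xn k : x ^+ k <= 1 by rewrite exprn_ile1.
rewrite minEle; case: ifP => _; first by rewrite mul1r (le_trans (xn _)).
rewrite mulrAC ler_pdivlMr // exprD.
have h1 : x ^+ s * w <= w1 * A.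
  apply: le_trans (ler_wpM2l (exprn_ge0 _ x0) hw) _.
  by rewrite mulrCA ler_wpM2l // (le_trans ler01 w11).
rewrite mulrAC (mulrC A); apply: le_trans h1.
by rewrite ler_piMr // mulr_ge0 ?exprn_ge0 // ltW.
Qed.

Lemma Fker_diff xi : normc (uhat N p uF xi - uhat N p u xi) <=
  C * (Rm%:R / (size Q)%:R * Num.min 1 (A / wt xi) + A * K ^+ 3 / (1 + Lc) / wt xi).
Proof.
have K0 : 0 <= K by exact: le_trans K_ge1.
have sQ0 : (0 : R) < (size Q)%:R by rewrite ltr0n.
pose t q (m : 'I_N * 'I_N) := kap R h (s + 3) m * uhat N p u (xi - gvec R (gconj q * mvec m)).
(* The zero frequency has coefficient 1 for each [q], so averaging reproduces [uhat] and exactly the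
   nonzero [m] remain. *)
have dE : uhat N p uF xi - uhat N p u xi =
    ((size Q)%:R^-1)%:C * \sum_(q <- Q) \sum_(m : 'I_N * 'I_N | m != m0) t q m.
  rewrite /uF uhat_Fker //.
  have -> : uhat N p u xi = ((size Q)%:R^-1)%:C * \sum_(q <- Q) uhat N p u xi.
    rewrite big_const_seq count_predT iter_addr addr0 mulrnAr -mulrnAl.
    have -> : ((size Q)%:R^-1 : R)%:C *+ size Q = 1.
      have e : (size Q)%:R^-1 *+ size Q = 1 :> R by rewrite -[LHS]mulr_natr mulVf // gt_eqF.
      by rewrite -(raddfMn (real_complex R)) /= e.
    by rewrite mul1r.
  rewrite -mulrBr -sumrB; congr (_ * _); apply: eq_bigr => q _.
  rewrite (bigD1 m0) //= /t.
  have -> : mvec m0 = 0 by rewrite /mvec /= centered0.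
  have -> : kap R h (s + 3) m0 = 1 by rewrite /kap /= centered0 // dirk0 // mulr1 expr1n.
  by rewrite mulr0 mul1r [gvec R 0](_ : _ = 0) // subr0 addrAC subrr add0r.
rewrite dE normcM normc_real ?invr_ge0 ?ler0n //.
have L1 : 0 <= 1 + Lc by rewrite addr_ge0.
have AKL : 0 <= A * K / (1 + Lc) by apply: divr_ge0 => //; exact: mulr_ge0.
have Cw : 0 <= C / wt xi by apply: divr_ge0 => //; exact: wt_ge0.
have far q : q \in Q -> \sum_(m : 'I_N * 'I_N | (m != m0) && ~~ (md m <= Lc)) normc (t q m) <=
    C * (A * K ^+ 3 / (1 + Lc) / wt xi).
  move=> qQ; apply: le_trans (_ : \sum_(m : 'I_N * 'I_N) dd m ^+ 2 * (A * K / (1 + Lc) * (C / wt xi)) <= _).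
    rewrite big_mkcond; apply: ler_sum => m _; case: ifP => [/andP[_ mL]|_]; last first.
      by apply: mulr_ge0; [exact: sqr_ge0|exact: mulr_ge0].
    rewrite /t normcM.
    have := kap_wt m qQ.
    have hw := wtD (xi - gvec R (gconj q * mvec m)) (gvec R (gconj q * mvec m)).
    rewrite subrK in hw; move: hw.
    have := uhat_wt (xi - gvec R (gconj q * mvec m)).
    have := wt_gt0 (gvec R (gconj q * mvec m)); have := wt_gt0 xi.
    have := wt_gt0 (xi - gvec R (gconj q * mvec m)).
    have := normc_ge0 (uhat N p u (xi - gvec R (gconj q * mvec m))).
    have := normc_ge0 (kap R h (s + 3) m : R[i]); have := dd_ge0 m; move: mL; rewrite -ltNge.
    move: (wt (xi - _)) (wt xi) (wt (gvec _ _)) (normc (kap _ _ _ _)) (normc (uhat _ _ _ _)) (dd m) (md m).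
    move=> w1 w w2 k z x d dL x0 k0 z0 w10 w0 w20 hz hw hk.
    rewrite mulrA mulrA ler_pdivlMr //.
    apply: le_trans (_ : (k * w2) * (z * w1) <= _).
      rewrite [leRHS](_ : _ = k * z * (w1 * w2)); last by ring.
      by rewrite ler_wpM2l // mulr_ge0.
    apply: ler_pM => //; [exact: mulr_ge0 (ltW _)|exact: mulr_ge0 (ltW _)|].
    apply: le_trans hk _; rewrite ler_wpM2l ?exprn_ge0 // ler_wpM2l ?mulr_ge0 //.
    have dL1 : 1 + Lc <= 1 + d by rewrite lerD2l ltW.
    have L10 : 0 < 1 + Lc by rewrite ltr_wpDr.
    by rewrite lef_pV2 ?posrE ?(lt_le_trans L10 dL1).
  rewrite -big_distrl /= [leRHS](_ : _ = K ^+ 2 * (A * K / (1 + Lc) * (C / wt xi))); last by ring.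
  by apply: ler_wpM2r => //; exact: mulr_ge0.
apply: le_trans (_ : (size Q)%:R^-1 * (\sum_(q <- Q) \sum_(m : 'I_N * 'I_N | near0 m) normc (t q m) +
  \sum_(q <- Q) \sum_(m : 'I_N * 'I_N | (m != m0) && ~~ (md m <= Lc)) normc (t q m)) <= _).
  rewrite ler_wpM2l ?invr_ge0 // -big_split /=.
  apply: le_trans (normc_sum _ _ _) _; apply: ler_sum => q _.
  by apply: le_trans (normc_sum _ _ _) _; rewrite (bigID (fun m => md m <= Lc)).
rewrite mulrDr mulrDr lerD //; last first.
  apply: size_sum => //; apply: mulr_ge0 => //; apply: divr_ge0; last exact: wt_ge0.
  by apply: divr_ge0 => //; apply: mulr_ge0 => //; exact: exprn_ge0.
rewrite [leRHS](_ : _ = (size Q)%:R^-1 * (Sup xi * (Rm%:R * C))); last by rewrite /Sup; ring.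
rewrite ler_wpM2l ?invr_ge0 //.
apply: le_trans (_ : Sup xi * \sum_(q <- Q) \sum_(m : 'I_N * 'I_N | near0 m) g (xi - gvec R (gconj q * mvec m)) <= _).
  rewrite big_distrr /= big_seq [leRHS]big_seq; apply: ler_sum => q qQ.
  by rewrite big_distrr /=; apply: ler_sum => m _; exact: near_term.
apply: ler_wpM2l; last exact: near_sum.
by rewrite /Sup le_min ler01; apply: divr_ge0 => //; exact: wt_ge0.
Qed.

End System.
End Bounds.

(** * The initial smooth weight *)

Section BaseSystem.
Variables (R : realType) (N h n : nat) (x0 : gint).
Hypotheses (N0 : (0 < N)%N) (h0 : (0 < h)%N) (hN : (h <= N)%N).

(** Indexing by tuples of summands instead of by grid points lets a point occur many times: constant
    weights then produce an [n]-fold convolution of uniform laws in each coordinate. *)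
Definition base_index : finType := ({ffun 'I_n -> 'I_h} * {ffun 'I_n -> 'I_h})%type.

Definition base_point (j : base_index) : gint :=
  (x0.1 + (\sum_i (j.1 i : nat))%N%:Z, x0.2 + (\sum_i (j.2 i : nat))%N%:Z).

Definition base_weight : base_index -> R := fun=> #|base_index|%:R^-1.

Let NR0 : (N%:R : R) != 0. Proof. by rewrite pnatr_eq0 -lt0n. Qed.

Lemma dirk_exp (t : R) : dirk N h t ^+ n =
  (h%:R^-1 ^+ n)%:C * \sum_(f : {ffun 'I_n -> 'I_h}) ex (- (t * (\sum_i (f i : nat))%N%:R / N%:R)).
Proof.
rewrite /dirk [LHS]exprMn -(rmorphXn (real_complex R)); congr (_ * _).
rewrite -[in LHS](card_ord n) -prodr_const bigA_distr_bigA /=; apply: eq_bigr => f _.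
rewrite -ex_sum; congr ex; rewrite natr_sum big_distrr /= big_distrl /= -sumrN.
by [].
Qed.

Lemma card_base_index : #|base_index| = (h ^ n * h ^ n)%N.
Proof. by rewrite card_prod !card_ffun !card_ord. Qed.

Lemma uhat_base (xi : R * R) : uhat N base_point base_weight xi =
  ex (- ((xi.1 * x0.1%:~R + xi.2 * x0.2%:~R) / N%:R)) *
  (dirk N h xi.1 ^+ n * dirk N h xi.2 ^+ n).
Proof.
rewrite !dirk_exp mulrACA -(rmorphM (real_complex R)) /uhat /base_weight card_base_index.
rewrite -big_distrr /= natrM !natrX invfM -!exprVn [RHS]mulrCA; congr (_ * _).
rewrite big_distrlr /= pair_big /= big_distrr /=; apply: eq_bigr => -[f g] _ /=.
rewrite -!exD; congr ex; rewrite !intrD /=.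
by rewrite -[((\sum_i _)%N : int)%:~R]/((\sum_i _)%N%:R) -[((\sum_i (g i : nat))%N : int)%:~R]/((\sum_i (g i : nat))%N%:R); ring.
Qed.

Lemma uhat_base0 : uhat N base_point base_weight 0 = 1.
Proof. by rewrite uhat_base /= !dirk0 // !mul0r addr0 mul0r oppr0 ex0 !expr1n !mulr1. Qed.

Lemma base_point_bounds j : x0.1 <= (base_point j).1 <= x0.1 + (n * h)%N%:Z /\
  x0.2 <= (base_point j).2 <= x0.2 + (n * h)%N%:Z.
Proof.
clear NR0 N0 h0 hN; have hs (f : {ffun 'I_n -> 'I_h}) : (\sum_i (f i : nat) <= n * h)%N.
  rewrite -[X in (_ <= X * _)%N](card_ord n) -sum_nat_const; apply: leq_sum => i _; exact: ltnW.
by have := hs j.1; have := hs j.2; rewrite /base_point /=; lia.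
Qed.

End BaseSystem.

(** In each coordinate [s] of the [s + 2] Dirichlet factors compensate the weight, which is at most
    a product of one-dimensional weights, and the other two are summed by Parseval. *)
Lemma wsum_base (R : realType) (N h s : nat) (x0 : gint) (K : R) (xi : R * R) :
  (0 < N)%N -> (0 < h)%N -> (h <= N)%N -> 1 + N%:R / h%:R <= K ->
  wsum N s (base_point x0) (base_weight R (h := h) (n := s + 2)) xi <= K ^+ (s + s + 2).
Proof.
move=> N0 h0 hN hK; rewrite /wsum.
have K1 : 1 <= K by apply: le_trans hK; rewrite lerDl divr_ge0.
have K0 : 0 <= K by exact: le_trans K1.
pose f (t : R) := normc (dirk N h t) ^+ 2.
have one (t : R) : normc (dirk N h t) ^+ (s + 2) * (1 + dper N t) ^+ s <= K ^+ s * f t.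
  rewrite exprD mulrAC -exprMn ler_wpM2r ?exprn_ge0 ?normc_ge0 //.
  have d0 := dper_ge0 N t.
  rewrite lerXn2r ?nnegrE ?mulr_ge0 ?normc_ge0 ?addr_ge0 //.
  have := dirk_bound t hK; rewrite ler_pdivlMr //; lra.
apply: le_trans (_ : \sum_(a : 'I_N * 'I_N) K ^+ s * f (xi.1 - a.1%:R) * (K ^+ s * f (xi.2 - a.2%:R)) <= _).
  apply: ler_sum => a _.
  rewrite uhat_base // normcM normc_ex mul1r normcM !normcX /=.
  apply: le_trans (ler_pM _ _ (one (xi.1 - a.1%:R)) (one (xi.2 - a.2%:R))); last 2 first.
  - by rewrite mulr_ge0 ?exprn_ge0 ?normc_ge0 ?addr_ge0 ?dper_ge0.
  - by rewrite mulr_ge0 ?exprn_ge0 ?normc_ge0 ?addr_ge0 ?dper_ge0.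
  rewrite mulrACA ler_wpM2l ?mulr_ge0 ?exprn_ge0 ?normc_ge0 // /wt -exprMn /=.
  have := dper_ge0 N (xi.1 - a.1%:R); have := dper_ge0 N (xi.2 - a.2%:R).
  move: (dper _ _) (dper _ _) => x y x0' y0.
  by rewrite lerXn2r ?nnegrE; nra.
have P (t : R) : \sum_(i < N) f (t - i%:R) = N%:R / h%:R by exact: dirk_parseval.
rewrite -(pair_bigA _ (fun i j : 'I_N => K ^+ s * f (xi.1 - i%:R) * (K ^+ s * f (xi.2 - j%:R)))) /=.
rewrite -big_distrlr /= -!big_distrr /= !P.
rewrite [leLHS](_ : _ = K ^+ s * K ^+ s * (N%:R / h%:R) ^+ 2); last by ring.
rewrite exprD exprD ler_wpM2l ?mulr_ge0 ?exprn_ge0 //.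
have h2 : 0 <= N%:R / h%:R :> R by rewrite divr_ge0.
have h1 : N%:R / h%:R <= K by apply: le_trans hK; rewrite lerDr.
by rewrite lerXn2r ?nnegrE.
Qed.

(** * Choice of the scales *)

Lemma cube_le_exp2 j : (j ^ 3 <= 64 * 2 ^ j)%N.
Proof.
have h : (j < 4 * 2 ^ (j %/ 4))%N.
  have := ltn_expl (j %/ 4) (ltnSn 1); have := ltn_mod j 4; have := divn_eq j 4.
  by move: (j %% 4)%N (2 ^ (j %/ 4))%N => c a; lia.
apply: leq_trans (_ : (4 * 2 ^ (j %/ 4)) ^ 3 <= _)%N; first by rewrite leq_exp2r // ltnW.
rewrite expnMn -expnM leq_mul2l /= leq_exp2l //; lia.
Qed.

Section Growth.
Variable R : realType.
Implicit Types (C D e : R).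

Lemma square_over_exp2 D e : 0 < e -> exists J, forall j, (J <= j)%N -> D * j%:R ^+ 2 <= e * 2 ^+ j.
Proof.
move=> e0; exists (Num.truncn (64 * `|D| / e)).+1 => j Jj.
have j1 : 64 * `|D| / e <= j%:R.
  by apply: ltW; apply: lt_le_trans (truncnS_gt _) _; rewrite ler_nat.
have j0 : (0 < j)%N by exact: leq_trans Jj.
have jR : (0 : R) < j%:R by rewrite ltr0n.
rewrite ler_pdivrMr // in j1.
have h3 : (j%:R : R) ^+ 3 <= 64 * 2 ^+ j.
  by rewrite -!natrX -natrM ler_nat cube_le_exp2.
apply: le_trans (_ : `|D| * j%:R ^+ 2 <= _); first by rewrite ler_wpM2r ?sqr_ge0 // ler_norm.
rewrite -(ler_pM2l (_ : (0 : R) < 64)) //.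
apply: le_trans (_ : j%:R * e * j%:R ^+ 2 <= _); first by rewrite mulrA ler_wpM2r ?sqr_ge0.
rewrite [leLHS](_ : _ = e * j%:R ^+ 3); last by ring.
by rewrite [leRHS]mulrCA ler_wpM2l // ltW.
Qed.

Lemma const_le_exp2 D : exists J, forall j, (J <= j)%N -> D <= 2 ^+ j.
Proof.
have [J hJ] := @square_over_exp2 `|D| 1 ltr01; exists J.+1 => j Jj.
have := hJ j (ltnW Jj); rewrite mul1r; apply: le_trans; apply: le_trans (ler_norm D) _.
rewrite ler_peMr // exprn_ege1 // ler1n; exact: leq_trans Jj.
Qed.

(* With [Z = ln y], this lets the exponential factor of the theorem absorb powers of [ln y]. *)
Lemma square_le_exp_ratio D : exists2 Z0, 1 <= Z0 & forall Z, Z0 <= Z -> D * Z ^+ 2 <= expR (Z / ln Z).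
Proof.
(* With [Z = expR v] and [D <= expR |D|] it suffices that [|D| * v + 2 * v ^ 2 <= expR v]; from [v0]
   on this follows from the cubic term [v ^ 3 / 6]. *)
pose v0 : R := 12 + 6 * `|D|.
have v01 : 1 <= v0 by rewrite /v0; have := normr_ge0 D; lra.
exists (expR v0); first by apply: le_trans (expR_ge1Dx _); lra.
move=> Z hZ; have Z0 : 0 < Z := lt_le_trans (expR_gt0 _) hZ.
have [v vZ] := expR_total Z0; have vv0 : v0 <= v by rewrite -ler_expR vZ.
rewrite -vZ expRK -[expR v ^+ 2]expRM_natl.
have v1 : 0 < v by lra.
apply: le_trans (_ : expR (`|D| + 2 * v) <= _).
  rewrite expRD ler_wpM2r ?expR_ge0 //; apply: le_trans (ler_norm D) _.
  by apply: le_trans (expR_ge1Dx _); lra.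
rewrite ler_expR ler_pdivlMr //.
have := @expR_ge1Dxn R v 2 (ltW v1); rewrite (_ : 3`!%:R = 6 :> R) // => h.
apply: le_trans h; rewrite exprS expr2; have := normr_ge0 D; move: vv0; rewrite /v0.
move: `|D| => d h d0.
have : v * (12 + 6 * d) <= v * v by rewrite ler_pM2l.
have : v * (v * (12 + 6 * d)) <= v * (v * v) by rewrite !ler_pM2l.
have : 0 <= v * v * d by rewrite !mulr_ge0 // ltW.
have : d * v <= d * (v * v) by rewrite ler_wpM2l // ler_peMr ?ltW //; lra.
nra.
Qed.

End Growth.

Definition decay (R : realType) (tau y : R) : R :=
  y `^ (- 2 / (1 + tau)) * expR (ln y / ln (ln y)).

Section Scale.
Variables (R : realType) (tau : R) (s : nat).

(* [eta j] is the mesh of the kernel at scale [2 ^ j], chosen so that [s + 3] steps stay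
   within half of the tolerance [(2 ^ j.+1) `^ (- tau)]; the slack absorbs the passage to
   the limit. [Bc], [Kc] and [Lc] are the values of [B], [K] and [Lc] in [Fker_diff]. *)
Definition eta j : R := (2 ^+ j.+1) `^ (- tau) / (2 * (s + 3)%:R).
Definition Kc j : R := 1 + 2 / eta j.
Definition Bc j : R := 2 ^+ j.+1.
Definition Ac j : R := (4 * Bc j * Kc j) ^+ s.
Definition Lc j : R := Ac j * Kc j ^+ 3 * 2 ^+ j.
Definition Hc j : nat := (Num.truncn (4 * Bc j * Lc j)).+1.

Hypothesis tau0 : 0 < tau.

Lemma eta_gt0 j : 0 < eta j.
Proof. by rewrite divr_gt0 ?powR_gt0 ?exprn_gt0 // mulr_gt0 // ltr0n addn3. Qed.

Lemma eta_le1 j : eta j <= 1.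
Proof.
rewrite ler_pdivrMr ?mulr_gt0 ?ltr0n ?addn3 // mul1r.
apply: le_trans (_ : 1 <= _).
  rewrite -[leRHS](powRr0 (2 ^+ j.+1)) ler_powR ?exprn_ege1 ?ler1n //.
  by rewrite oppr_le0 ltW.
by rewrite -natrM ler1n.
Qed.

Lemma Kc_ge1 j : 1 <= Kc j.
Proof. by rewrite lerDl divr_ge0 // ltW // eta_gt0. Qed.

Lemma Bc_ge1 j : 1 <= Bc j.
Proof. by rewrite exprn_ege1 // ler1n. Qed.

Lemma Ac_ge0 j : 0 <= Ac j.
Proof.
by rewrite exprn_ge0 // !mulr_ge0 // (le_trans ler01) ?Bc_ge1 ?Kc_ge1.
Qed.

Lemma Lc_ge0 j : 0 <= Lc j.
Proof. by rewrite !mulr_ge0 ?Ac_ge0 ?exprn_ge0 // (le_trans ler01) ?Kc_ge1. Qed.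

Lemma Hc_ge j : 4 * Bc j * Lc j <= (Hc j)%:R.
Proof. by rewrite ltW // truncnS_gt. Qed.

Let C1 : R := 1 + 4 * (s + 3)%:R * 2 `^ tau.

Let C1_ge1 : 1 <= C1.
Proof. by rewrite lerDl !mulr_ge0 ?powR_ge0. Qed.

Let pow_ge1 j : 1 <= (2 ^+ j : R) `^ tau.
Proof.
by rewrite -[leLHS](powRr0 (2 ^+ j)) ler_powR ?exprn_ege1 ?ler1n // ltW.
Qed.

Lemma Kc_le j : Kc j <= C1 * (2 ^+ j) `^ tau.
Proof.
rewrite /Kc /eta powRN /C1 [leRHS]mulrDl mul1r; apply: lerD; first exact: pow_ge1.
rewrite exprS powRM ?exprn_ge0 //.
rewrite le_eqVlt; apply/orP; left; apply/eqP.
have h1 : 2 `^ tau != 0 :> R by rewrite gt_eqF // powR_gt0.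
have h2 : (2 ^+ j) `^ tau != 0 :> R by rewrite gt_eqF // powR_gt0 // exprn_gt0.
have h3 : ((s + 3)%:R : R) != 0 by rewrite pnatr_eq0 addn3.
by field; rewrite -natrD h1 h2 h3.
Qed.

(** The box size is polynomial in [2 ^ j], while each prime of the shell has norm at least [4 ^ j].
    Hence at most [E] of them divide a nonzero frequency of the box, with [E] independent of [j]. *)
Lemma Hc_bound : exists E J, forall j, (J <= j)%N -> (2 * Hc j ^ 2 < 4 ^ (j * E.+1))%N.
Proof.
pose T := (Num.truncn tau).+1.
have tT : tau <= T%:R by rewrite ltW // truncnS_gt.
have [J1 hJ1] := const_le_exp2 C1.
(* Exponents of [2 ^ j]: 2 for [4 * Bc j] and [T + 1] for [Kc j], hence [(T + 3) * s] for [Ac j];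
   then [Lc j] adds [(T + 1) * 3] and 1, and the outer factor [4 * Bc j] adds 2. *)
pose E := ((T + 3) * s + (T + 1) * 3 + 3)%N.
exists E, (J1 + 3)%N => j Jj.
have KE : Kc j <= 2 ^+ (j * (T + 1)).
  apply: le_trans (Kc_le j) _; rewrite mulnDr muln1 exprD mulrC.
  apply: ler_pM; rewrite ?powR_ge0 //; first exact: le_trans C1_ge1.
    rewrite exprM -[leRHS]powR_mulrn ?exprn_ge0 //.
    by rewrite ler_powR // exprn_ege1 // ler1n.
  by apply: hJ1; lia.
have K0 : 0 <= Kc j by apply: le_trans (Kc_ge1 j).
have B4 : 4 * Bc j <= 2 ^+ (j * 2).
  rewrite /Bc (_ : 4 = 2 ^+ 2 :> R); last by rewrite expr2 -natrM.
  by rewrite -exprD ler_eXn2l ?ltr1n //; lia.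
have B0 : 0 <= 4 * Bc j by rewrite mulr_ge0 // (le_trans ler01) ?Bc_ge1.
have AE : Ac j <= 2 ^+ (j * ((T + 3) * s)).
  rewrite mulnA exprM /Ac lerXn2r ?nnegrE ?mulr_ge0 ?exprn_ge0 //.
  rewrite (_ : j * (T + 3) = j * 2 + j * (T + 1))%N; last by lia.
  by rewrite exprD; apply: ler_pM.
have LE : 4 * Bc j * Lc j <= 2 ^+ (j * E).
  rewrite (_ : j * E = j * 2 + (j * ((T + 3) * s) + j * (T + 1) * 3 + j))%N; last by rewrite /E; lia.
  rewrite exprD; apply: ler_pM => //; first exact: Lc_ge0.
  rewrite /Lc exprD; apply: ler_pM => //; rewrite ?mulr_ge0 ?Ac_ge0 ?exprn_ge0 //.
  rewrite exprD; apply: ler_pM; rewrite ?Ac_ge0 ?exprn_ge0 //.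
  by rewrite exprM lerXn2r ?nnegrE ?exprn_ge0.
have HE : (Hc j <= 2 ^ (j * E + 1))%N.
  have h : (Num.truncn (4 * Bc j * Lc j) <= 2 ^ (j * E))%N.
    rewrite -(ler_nat R) natrX (le_trans _ LE) //.
    by rewrite truncn_le // mulr_ge0 ?Lc_ge0.
  by rewrite /Hc addn1 expnS mul2n -addnn -addn1 leq_add // expn_gt0.
apply: leq_ltn_trans (_ : 2 * (2 ^ (j * E + 1)) ^ 2 < _)%N.
  by rewrite leq_mul2l /= leq_exp2r.
rewrite -expnM -expnS (_ : 4 = 2 ^ 2)%N // -expnM ltn_exp2l //.
by rewrite mulnS; lia.
Qed.

Lemma min_le_powR (Y a : R) : 0 <= Y -> 0 < a -> a <= s%:R -> Num.min 1 (Y ^+ s) <= Y `^ a.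
Proof.
move=> Y0 a0 as_; have [Y1|Y1] := leP Y 1.
  rewrite ge_min; apply/orP; right; have [->|Yn0] := eqVneq Y 0.
    rewrite powR0 ?gt_eqF // expr0n; case: (s) as_ => //= h.
    by move: (lt_le_trans a0 h); rewrite ltxx.
  by rewrite -powR_mulrn // ger_powR // Y1 lt_def Yn0 Y0.
rewrite ge_min; apply/orP; left.
by rewrite -[leLHS](powRr0 Y) ler_powR // ltW.
Qed.

Let a : R := 2 / (1 + tau).
Hypothesis as_ : a <= s%:R.

Let a0 : 0 < a. Proof. by rewrite divr_gt0 // addr_gt0. Qed.

Lemma decay_ge y : expR 1 < y -> y `^ (- a) <= decay tau y.
Proof.
move=> ye; rewrite /decay (_ : - 2 / (1 + tau) = - a); last by rewrite /a mulNr.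
rewrite ler_peMr ?powR_ge0 //.
have y0 : 0 < y by apply: lt_trans ye; exact: expR_gt0.
have l1 : 1 < ln y by rewrite -[X in X < _](expRK 1) ltr_ln ?posrE ?expR_gt0.
apply: le_trans (expR_ge1Dx _); rewrite lerDl divr_ge0 // ltW //.
  exact: lt_trans l1.
exact: ln_gt0.
Qed.

(** With [M = 2 ^ j], the main part is of order [j ^ 2 / M ^ 2]. As long as [y ^ a <= M] a whole
    factor [M] is to spare. For larger [y] the minimum is at most a constant times
    [M ^ 2 * (1 + y) ^ (- a)], which cancels [M ^ 2], and [j] is at most a constant times [ln y], so
    [j ^ 2] is absorbed by the exponential. *)
Lemma scale_bound (C delta : R) (Rm : nat) : 0 <= C -> 0 < delta ->
  exists J, forall j, (J <= j)%N -> forall (Sz : nat) (y w : R),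
    (4 ^ j <= Sz * j ^ 2)%N -> 0 <= y -> ((1 + y) / 2) ^+ s <= w -> 1 <= w ->
    let X := C * (Rm%:R / Sz%:R * Num.min 1 (Ac j / w) + Ac j * Kc j ^+ 3 / (1 + Lc j) / w) in
    X <= delta /\ (expR 1 < y -> X <= delta * decay tau y).
Proof.
move=> C0 d0.
have t1 : 0 < 1 + tau by rewrite addr_gt0.
pose C3 : R := 16 * C1; have C30 : 0 < C3 by rewrite mulr_gt0 // (lt_le_trans ltr01).
pose D1 := C * Rm%:R * C3 `^ a.
pose kappa : R := (1 + tau) / 2 * ln 2.
have k0 : 0 < kappa by rewrite mulr_gt0 ?divr_gt0 // ln_gt0 // ltr1n.
have [J1 e1] := square_over_exp2 (C * Rm%:R) (divr_gt0 d0 (ltr0Sn R 1)).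
have [J2 e2] := const_le_exp2 (2 * C * 2 ^+ s / delta).
have [Z0 Z01 e3] := square_le_exp_ratio (2 * D1 / (delta * kappa ^+ 2)).
exists (J1 + J2 + (Num.truncn (Z0 / kappa)).+1)%N => j Jj Sz y w hSz y0 hw w1 X.
have {}e1 := e1 j (leq_trans (leq_trans (leq_addr _ _) (leq_addr _ _)) Jj).
have {}e2 := e2 j (leq_trans (leq_trans (leq_addl _ _) (leq_addr _ _)) Jj).
have jZ : Z0 / kappa <= j%:R.
  apply: ltW; apply: lt_le_trans (truncnS_gt _) _; rewrite ler_nat.
  exact: leq_trans (leq_addl _ _) Jj.
set M : R := 2 ^+ j in e1 e2.
have M1 : 1 <= M by rewrite exprn_ege1 // ler1n.
have M0 : 0 < M by exact: lt_le_trans M1.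
have Sz0 : (0 < Sz)%N by case: (Sz) hSz => //; rewrite mul0n leqn0 expn_eq0.
have SzR : (0 : R) < Sz%:R by rewrite ltr0n.
have w0 : 0 < w by exact: lt_le_trans w1.
have y1 : 0 < 1 + y by rewrite ltr_wpDr.
have RS : Rm%:R / Sz%:R <= Rm%:R * j%:R ^+ 2 / M ^+ 2.
  rewrite -mulrA ler_wpM2l // ler_pdivlMr ?exprn_gt0 // mulrC ler_pdivrMr //.
  rewrite mulrC -natrX -natrM /M -exprM mulnC exprM -natrX -natrX ler_nat //.
have min1 : 0 <= Num.min 1 (Ac j / w) <= 1.
  by rewrite le_min ler01 divr_ge0 ?Ac_ge0 ?(ltW w0) //= ge_min lexx.
have RS0 : 0 <= Rm%:R / Sz%:R :> R by rewrite divr_ge0.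
have main1 : C * (Rm%:R / Sz%:R * Num.min 1 (Ac j / w)) <= delta / 2 / M.
  apply: le_trans (_ : C * (Rm%:R * j%:R ^+ 2 / M ^+ 2) <= _).
    rewrite ler_wpM2l // (le_trans _ RS) // ler_piMr //; by case/andP: min1.
  rewrite [leLHS](_ : _ = C * Rm%:R * j%:R ^+ 2 / M / M); last by field; rewrite gt_eqF.
  by rewrite ler_pM2r ?invr_gt0 // ler_pdivrMr.
(* [Lc j] was chosen for this: it exceeds the numerator by the factor [M]. *)
have tailM : Ac j * Kc j ^+ 3 / (1 + Lc j) <= M^-1.
  have L0 := Lc_ge0 j; rewrite ler_pdivrMr; last by rewrite ltr_wpDr.
  by rewrite ler_pdivlMl // mulrC -[leLHS]/(Lc j) lerDr.
have tail0 : 0 <= Ac j * Kc j ^+ 3 / (1 + Lc j).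
  rewrite divr_ge0 ?addr_ge0 ?Lc_ge0 // mulr_ge0 ?Ac_ge0 // exprn_ge0 //.
  exact: le_trans (Kc_ge1 j).
have CM : C * 2 ^+ s / M <= delta / 2.
  rewrite ler_pdivrMr // in e2; rewrite ler_pdivrMr //; move: e2; lra.
have s1 : 1 <= 2 ^+ s :> R by rewrite exprn_ege1 // ler1n.
split.
  rewrite /X mulrDr [leRHS]splitr lerD //.
    by apply: le_trans main1 _; rewrite ler_pdivrMr // ler_peMr // divr_ge0 // ltW.
  apply: le_trans CM; rewrite -[leRHS]mulrA ler_wpM2l //.
  apply: le_trans (_ : M^-1 / 1 <= _).
    apply: ler_pM => //; first by rewrite invr_ge0 ltW.
    by rewrite lef_pV2 ?posrE.
  by rewrite invr1 mulr1 ler_peMl // invr_ge0 ltW.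
move=> ye; have yp : 0 < y by apply: lt_trans ye; exact: expR_gt0.
have yy : (1 + y) `^ (- a) <= y `^ (- a).
  rewrite !powRN lef_pV2 ?posrE ?powR_gt0 // ge0_ler_powR ?nnegrE ?(ltW a0) ?(ltW yp) ?(ltW y1) //.
  by rewrite lerDr.
have dec := decay_ge ye.
have w2 : w^-1 <= 2 ^+ s * (1 + y) `^ (- a).
  apply: le_trans (_ : (((1 + y) / 2) ^+ s)^-1 <= _).
    by rewrite lef_pV2 ?posrE // exprn_gt0 // divr_gt0.
  rewrite expr_div_n invf_div ler_wpM2l ?exprn_ge0 // powRN lef_pV2 ?posrE ?powR_gt0 ?exprn_gt0 //.
  by rewrite -powR_mulrn ?(ltW y1) // ler_powR // lerDl.
rewrite /X mulrDr [X in _ <= X](_ : _ = delta / 2 * decay tau y + delta / 2 * decay tau y); last first.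
  by rewrite -mulrDl -splitr.
apply: lerD; last first.
  apply: le_trans (_ : C * (M^-1 * (2 ^+ s * (1 + y) `^ (- a))) <= _).
    by rewrite ler_wpM2l //; apply: ler_pM => //; rewrite invr_ge0 ltW.
  rewrite [leLHS](_ : _ = C * 2 ^+ s / M * (1 + y) `^ (- a)); last by ring.
  apply: ler_pM => //; rewrite ?powR_ge0 ?mulr_ge0 ?invr_ge0 ?exprn_ge0 ?(ltW M0) //.
  exact: le_trans yy dec.
(* At this threshold [y ^ a = M], and above it [ln y] is at least [kappa * j]. *)
have [yM|yM] := leP y (M `^ ((1 + tau) / 2)).
  apply: le_trans main1 _; rewrite ler_wpM2l ?divr_ge0 ?(ltW d0) //.
  apply: le_trans dec; rewrite powRN lef_pV2 ?posrE ?powR_gt0 //.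
  apply: le_trans (_ : (M `^ ((1 + tau) / 2)) `^ a <= _).
    by rewrite ge0_ler_powR ?nnegrE ?powR_ge0 ?(ltW a0) ?(ltW yp).
  rewrite -powRrM (_ : (1 + tau) / 2 * a = 1) ?powRr1 ?(ltW M0) //.
  by rewrite /a; field; rewrite gt_eqF.
have lnyj : kappa * j%:R <= ln y.
  apply: le_trans (_ : ln (M `^ ((1 + tau) / 2)) <= _); last first.
    by rewrite ler_ln ?posrE ?powR_gt0 // ltW.
  by rewrite ln_powR /M lnXn // /kappa -[ln 2 *+ j]mulr_natr mulrA.
have Zy : Z0 <= ln y.
  by apply: le_trans lnyj; rewrite mulrC -ler_pdivrMr.
have e3y := e3 _ Zy.
pose Y := 8 * Bc j * Kc j / (1 + y).
have B0 : 0 <= Bc j by exact: le_trans (Bc_ge1 j).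
have K0 : 0 <= Kc j by exact: le_trans (Kc_ge1 j).
have Y0 : 0 <= Y by rewrite divr_ge0 ?mulr_ge0 ?(ltW y1).
have minY : Num.min 1 (Ac j / w) <= Y `^ a.
  apply: le_trans (min_le_powR Y0 a0 as_); rewrite le_min ge_min lexx /= ge_min.
  apply/orP; right.
  apply: le_trans (_ : Ac j / ((1 + y) / 2) ^+ s <= _).
    by rewrite ler_wpM2l ?Ac_ge0 // lef_pV2 ?posrE // exprn_gt0 // divr_gt0.
  rewrite /Ac -expr_div_n (_ : _ / _ = Y) //.
  by rewrite /Y; field; rewrite gt_eqF.
have YC : Y `^ a <= C3 `^ a * M ^+ 2 * (1 + y) `^ (- a).
  apply: le_trans (_ : (C3 * M `^ (1 + tau) / (1 + y)) `^ a <= _).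
    rewrite ge0_ler_powR ?nnegrE ?(ltW a0) //.
      by apply: divr_ge0; [apply: mulr_ge0; [exact: ltW|exact: powR_ge0]|exact: ltW].
    rewrite ler_pM2r ?invr_gt0 // /Bc exprS -/M powRD; last by rewrite (gt_eqF M0) implybT.
    rewrite powRr1 ?(ltW M0) //.
    have := Kc_le j; rewrite -/M => hK.
    rewrite [leRHS](_ : _ = 8 * (2 * M) * (C1 * M `^ tau)); last by rewrite /C3; ring.
    by rewrite ler_wpM2l // !mulr_ge0 // ltW.
  have CM0 : 0 <= C3 * M `^ (1 + tau) by apply: mulr_ge0; [exact: ltW|exact: powR_ge0].
  rewrite (powRM _ CM0); last by rewrite invr_ge0 ltW.
  rewrite powRM ?powR_ge0 ?(ltW C30) // -powRrM.
  rewrite (_ : (1 + tau) * a = 2%:R); last by rewrite /a; field; rewrite gt_eqF.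
  rewrite powR_mulrn ?(ltW M0) // -powR_inv1 ?(ltW y1) // -powRrM mulN1r //.
apply: le_trans (_ : D1 * j%:R ^+ 2 * y `^ (- a) <= _).
  apply: le_trans (_ : C * (Rm%:R * j%:R ^+ 2 / M ^+ 2 * (C3 `^ a * M ^+ 2 * y `^ (- a))) <= _).
    rewrite ler_wpM2l //; apply: ler_pM => //; first by case/andP: min1.
    apply: le_trans minY (le_trans YC _).
    by rewrite ler_wpM2l // mulr_ge0 ?powR_ge0 ?sqr_ge0.
  rewrite le_eqVlt; apply/orP; left; apply/eqP; rewrite /D1; field.
  by rewrite gt_eqF.
rewrite /decay (_ : - 2 / (1 + tau) = - a); last by rewrite /a mulNr.
rewrite [leRHS]mulrCA [leLHS]mulrC ler_wpM2l ?powR_ge0 //.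
have e4 : D1 * j%:R ^+ 2 <= delta / 2 * (2 * D1 / (delta * kappa ^+ 2) * ln y ^+ 2).
  rewrite [leRHS](_ : _ = D1 * (ln y / kappa) ^+ 2); last first.
    by field; rewrite !gt_eqF.
  have D10 : 0 <= D1 by rewrite !mulr_ge0 ?powR_ge0.
  rewrite ler_wpM2l // lerXn2r ?nnegrE ?divr_ge0 ?(ltW k0) //.
    by apply: le_trans Zy; exact: le_trans Z01.
  by rewrite ler_pdivlMr // mulrC.
by apply: le_trans e4 _; rewrite ler_wpM2l // divr_ge0 // ltW.
Qed.

End Scale.

Lemma gn_absz (k : gint) : gn k = (`|k.1| ^ 2 + `|k.2| ^ 2)%N.
Proof.
apply/eqP; rewrite -eqz_nat gnE PoszD -!mulnn !PoszM !abszE -!expr2.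
by rewrite !real_normK ?num_real.
Qed.

Lemma count_gconj_dvd j (k : gint) (H E : nat) : (0 < j)%N -> k != 0 ->
  (`|k.1| <= H)%N -> (`|k.2| <= H)%N -> (2 * H ^ 2 < 4 ^ (j * E.+1))%N ->
  (count (fun q => `[< gdvd (gconj q) k >]) (gprimes j) <= E)%N.
Proof.
move=> j0 k0 k1 k2 HE.
have ck0 : gconj k != 0 by rewrite -gn_eq0 gn_conj gn_eq0.
have := count_gprimes_dvd j (gconj k) ck0.
rewrite (@eq_count _ _ (fun q => `[< gdvd (gconj q) k >])); last first.
  have conjM (x y : gint) : gconj (x * y) = gconj x * gconj y.
    by rewrite !gint_mulE /gconj /=; congr pair; ring.
  have conjK (x : gint) : gconj (gconj x) = x by case: x => x y; rewrite /gconj /= opprK.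
  move=> q /=; apply/asboolP/asboolP => -[y hy]; exists (gconj y).
    by rewrite -conjM -hy conjK.
  by rewrite hy conjM conjK.
rewrite gn_conj => h; rewrite -ltnS -(ltn_pmul2l j0) -(ltn_exp2l (m := 4)) //.
apply: leq_ltn_trans h (leq_ltn_trans _ HE).
by rewrite gn_absz mul2n -addnn leq_add // leq_sqr.
Qed.

Lemma gprimes_le (R : realType) j q : q \in gprimes j ->
  `|q.1%:~R : R| <= 2 ^+ j.+1 /\ `|q.2%:~R : R| <= 2 ^+ j.+1.
Proof.
move=> /mem_gprimes[_ _ _ qj]; rewrite gn_absz (_ : 4 = 2 ^ 2)%N // -expnM mulnC expnM in qj.
have h (x : int) : (`|x| ^ 2 < (2 ^ j.+1) ^ 2)%N -> `|x%:~R : R| <= 2 ^+ j.+1.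
  rewrite ltn_sqr => xj; rewrite -intr_norm -abszE -natrX.
  by rewrite -[X in X <= _]/(`|x|%:R) ler_nat ltnW.
by split; apply: h; apply: leq_ltn_trans qj; rewrite ?leq_addr ?leq_addl.
Qed.

Lemma wt_lower (R : realType) (N s : nat) (xi : R * R) : (0 < N)%N ->
  2 * `|xi.1| <= N%:R -> 2 * `|xi.2| <= N%:R ->
  ((1 + maxnorm xi) / 2) ^+ s <= wt N s xi.
Proof.
move=> N0 h1 h2; have d1 := dper_lower N0 h1; have d2 := dper_lower N0 h2.
have p1 := dper_ge0 N xi.1; have p2 := dper_ge0 N xi.2.
have a1 : 0 <= (1 + maxnorm xi) / 2 by rewrite divr_ge0 // addr_ge0 // /maxnorm le_max normr_ge0.
have a2 : (1 + maxnorm xi) / 2 <= 1 + dper N xi.1 + dper N xi.2.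
  by rewrite /maxnorm; case: (leP `|xi.1| `|xi.2|) => _; lra.
by rewrite /wt lerXn2r ?nnegrE // (le_trans a1).
Qed.

(** * Successive multiplication by kernels *)

Section State.
Variables (R : realType) (tau : R) (s : nat) (x0 : nat -> gint) (hb : nat -> nat).

Definition hh N j : nat := Num.truncn (N%:R * eta tau s j).

Fixpoint ustate N (l : seq nat) : base_index (hb N) (s + 2) -> R :=
  if l is j :: l' then fun i => ustate l' i *
     Fker R N (hh N j) (s + 3) (gprimes j) (base_point (x0 N) i)
  else base_weight R (h := hb N) (n := s + 2).

Definition ufour N l (xi : R * R) : R[i] :=
  uhat N (base_point (x0 N)) (@ustate N l) xi.

Variables (N1 : nat) (K0 : R).
Hypothesis hbP : forall N, (N1 <= N)%N ->
  [/\ (0 < N)%N, (0 < hb N)%N, (hb N <= N)%N & 1 + N%:R / (hb N)%:R <= K0].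

Lemma ustate_ge0 N l i : 0 <= @ustate N l i.
Proof.
elim: l => [|j l IH] /=; first by rewrite invr_ge0.
by rewrite mulr_ge0 // Fker_ge0.
Qed.

Lemma ufour_base N xi : (N1 <= N)%N -> 2 * `|xi.1| <= N%:R -> 2 * `|xi.2| <= N%:R ->
  normc (ufour N [::] xi) * ((1 + maxnorm xi) / 2) ^+ s <= K0 ^+ (s + s + 2).
Proof.
move=> NN h1 h2; have [n0 b0 bN bK] := hbP NN.
apply: le_trans (@uhat_wt R N n0 s _ (base_point (x0 N)) _ _ (fun xi => wsum_base s (x0 N) xi n0 b0 bN bK) xi).
by rewrite ler_wpM2l ?normc_ge0 // wt_lower.
Qed.

Lemma ufour_base0 N : (N1 <= N)%N -> ufour N [::] 0 = 1.
Proof. by move=> NN; have [n0 b0 bN bK] := hbP NN; exact: uhat_base0. Qed.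

Hypothesis tau0 : 0 < tau.

(** Once [N * eta >= 2], rounding down loses at most a factor 2; this is the 2 in [Kc]. *)
Lemma hh_mesh j : exists N2, forall N, (N2 <= N)%N ->
  [/\ (0 < N)%N, (0 < hh N j)%N, (hh N j <= N)%N & 1 + N%:R / (hh N j)%:R <= Kc tau s j].
Proof.
have e0 := eta_gt0 tau s j; have e1 := eta_le1 s tau0 j.
exists (Num.truncn (2 / eta tau s j)).+1 => N hN.
have hN2 : 2 <= N%:R * eta tau s j.
  rewrite -ler_pdivrMr //; apply: ltW; apply: lt_le_trans (truncnS_gt _) _.
  by rewrite ler_nat.
have lo : N%:R * eta tau s j < (hh N j).+1%:R by exact: truncnS_gt.
have up : (hh N j)%:R <= N%:R * eta tau s j by rewrite truncn_le //; lra.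
rewrite -natr1 in lo.
have n0 : (0 < N)%N by exact: leq_trans hN.
have NR : (0 : R) < N%:R by rewrite ltr0n.
have h0 : (0 : R) < (hh N j)%:R by lra.
split => //; first by rewrite -(ltr0n R).
  rewrite -(ler_nat R); apply: le_trans up _.
  by rewrite ler_piMr // ltW.
rewrite /Kc lerD2l ler_pdivrMr // mulrAC ler_pdivlMr //; lra.
Qed.

Lemma ufour_bounded l : exists C N2, 0 <= C /\ forall N, (N2 <= N)%N -> forall xi,
  wsum N s (base_point (x0 N)) (@ustate N l) xi <= C.
Proof.
elim: l => [|j l [C [N2 [C0 hC]]]].
  exists (K0 ^+ (s + s + 2)), N1; split.
    have [_ _ _ bK] := hbP (leqnn N1); rewrite exprn_ge0 //.
    by apply: le_trans bK; rewrite addr_ge0 // divr_ge0.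
  by move=> N /hbP[n0 b0 bN bK] xi; exact: wsum_base.
have [N3 hN3] := hh_mesh j.
exists ((4 * Bc R j * Kc tau s j) ^+ s * Kc tau s j ^+ 3 * C), (maxn N2 N3); split.
  have K1 : 0 <= Kc tau s j by exact: le_trans (Kc_ge1 tau s j).
  have B0 : 0 <= Bc R j by exact: le_trans (Bc_ge1 R j).
  apply: mulr_ge0 => //; apply: mulr_ge0; apply: exprn_ge0 => //.
  by apply: mulr_ge0 => //; apply: mulr_ge0.
move=> N; rewrite geq_max => /andP[h2 /hN3[n0 hj0 hjN hjK]] xi.
apply: (wsum_Fker n0 hj0 hjN hjK (Bc_ge1 R j)); last exact: hC.
by move=> q qQ; exact: gprimes_le.
Qed.

Hypothesis as_ : 2 / (1 + tau) <= s%:R.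

(** The order of choices matters: the constant for [l] is fixed before [j], which is taken large in
    terms of it and with many primes; the threshold for [N] comes last. *)
Lemma ufour_step l delta j0 : 0 < delta -> exists j, (j0 <= j)%N /\
  exists N2, forall N, (N2 <= N)%N -> forall xi, 2 * `|xi.1| <= N%:R -> 2 * `|xi.2| <= N%:R ->
    normc (ufour N (j :: l) xi - ufour N l xi) <= delta /\
    (expR 1 < maxnorm xi ->
     normc (ufour N (j :: l) xi - ufour N l xi) <= delta * decay tau (maxnorm xi)).
Proof.
move=> d0; have [C [N2 [C0 hC]]] := ufour_bounded l.
have [E [J1 hJ1]] := Hc_bound s tau0.
have [J2 hJ2] := scale_bound tau0 as_ E C0 d0.
have [j [jj hj]] := gprimes_many (maxn j0 (maxn J1 (maxn J2 1))).
move: jj; rewrite !geq_max => /andP[jj0 /andP[jJ1 /andP[jJ2 j1]]].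
have [N3 hN3] := hh_mesh j.
exists j; split => //; exists (maxn N2 (maxn N3 (2 * Hc tau s j).+1)) => N.
rewrite !geq_max => /andP[h2 /andP[/hN3[n0 hj0 hjN hjK] hH]] xi x1 x2.
have Q0 : (0 < size (gprimes j))%N.
  by case: (size _) hj => //; rewrite mul0n leqn0 expn_eq0.
have dif : normc (ufour N (j :: l) xi - ufour N l xi) <=
  C * (E%:R / (size (gprimes j))%:R * Num.min 1 (Ac tau s j / wt N s xi) +
       Ac tau s j * Kc tau s j ^+ 3 / (1 + Lc tau s j) / wt N s xi).
  apply: (Fker_diff n0 hj0 hjN hjK (Bc_ge1 R j)).
  - by move=> q qQ; exact: gprimes_le.
  - exact: hC.
  - exact: Lc_ge0.
  - exact: hH.
  - exact: Hc_ge.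
  - by move=> q /mem_gprimes[qq _ _ _]; exact: quad_neq0.
  - exact: Q0.
  - by move=> k kn0 k1 k2; apply: (count_gconj_dvd j1 kn0 k1 k2); exact: hJ1.
have y0 : 0 <= maxnorm xi by rewrite /maxnorm le_max normr_ge0.
have [b1 b2] := hJ2 j jJ2 _ _ _ hj y0 (wt_lower s n0 x1 x2) (wt_ge1 N s xi).
by split; [exact: le_trans dif b1|move=> /b2; exact: le_trans].
Qed.

End State.

Section Sequence.
Variables (R : realType) (tau : R) (s : nat) (x0 : nat -> gint) (hb : nat -> nat).
Variables (N1 : nat) (K0 : R).
Hypothesis hbP : forall N, (N1 <= N)%N ->
  [/\ (0 < N)%N, (0 < hb N)%N, (hb N <= N)%N & 1 + N%:R / (hb N)%:R <= K0].
Hypothesis tau0 : 0 < tau.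
Hypothesis as_ : 2 / (1 + tau) <= s%:R.

Fixpoint first_scales (f : nat -> nat) k : seq nat :=
  if k is k'.+1 then f k' :: first_scales f k' else [::].

Lemma mem_first_scales f i k : (i < k)%N -> f i \in first_scales f k.
Proof.
elim: k => // k IH; rewrite ltnS leq_eqVlt inE => /orP[/eqP ->|/IH ->]; first by rewrite eqxx.
by rewrite orbT.
Qed.

Lemma scale_sequence : exists f : nat -> nat, (forall k, (k <= f k)%N) /\
  forall k, exists N2, forall N, (N2 <= N)%N -> forall xi,
    2 * `|xi.1| <= N%:R -> 2 * `|xi.2| <= N%:R ->
    let d := normc (ufour tau s x0 hb N (first_scales f k) xi - ufour tau s x0 hb N [::] xi) in
    d <= 1 / 2 /\ (expR 1 < maxnorm xi -> d <= 1 / 2 * decay tau (maxnorm xi)).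
Proof.
(* The tolerances sum to less than 1/2; the induction below keeps the exact partial sums
   [1 / 2 - 1 / 2 ^ (k + 1)]. *)
pose dl k : R := 1 / 2 ^+ k.+2.
have dl0 k : 0 < dl k by rewrite divr_gt0 ?exprn_gt0.
have [f hf] := choice (fun kl : nat * seq nat => ufour_step x0 hbP tau0 as_ kl.2 kl.1 (dl0 kl.1)).
pose g := fix g k := if k is k'.+1 then f (k', g k') :: g k' else [::].
pose ff k := f (k, g k).
have gE k : first_scales ff k = g k by elim: k => //= k ->.
exists ff; split => [k|k]; first by have [] := hf (k, g k).
suff [N2 h] : exists N2, forall N, (N2 <= N)%N -> forall xi,
    2 * `|xi.1| <= N%:R -> 2 * `|xi.2| <= N%:R ->
    let d := normc (ufour tau s x0 hb N (first_scales ff k) xi - ufour tau s x0 hb N [::] xi) in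
    d <= (1 / 2 - 1 / 2 ^+ k.+1) /\
    (expR 1 < maxnorm xi -> d <= (1 / 2 - 1 / 2 ^+ k.+1) * decay tau (maxnorm xi)).
  have p0 : 0 <= 1 / 2 ^+ k.+1 :> R by rewrite divr_ge0 ?exprn_ge0.
  exists N2 => N NN xi h1 h2; have [a1 a2] := h N NN xi h1 h2; split.
    by apply: le_trans a1 _; rewrite lerBlDr lerDl.
  move=> /a2 /le_trans; apply; apply: ler_wpM2r; last by rewrite lerBlDr lerDl.
  by rewrite mulr_ge0 ?powR_ge0 ?expR_ge0.
elim: k => [|k [N2 IH]].
  exists 0%N => N _ xi _ _ /=; rewrite subrr normc0 expr1 subrr; split => // _.
  by rewrite mul0r.
have [_ [N3 h3]] := hf (k, g k).
exists (maxn N2 N3) => N; rewrite geq_max => /andP[n2 n3] xi x1 x2 d.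
have [a1 a2] := IH N n2 xi x1 x2; have [b1 b2] := h3 N n3 xi x1 x2.
have dd : d <= normc (ufour tau s x0 hb N (first_scales ff k.+1) xi - ufour tau s x0 hb N (first_scales ff k) xi)
   + normc (ufour tau s x0 hb N (first_scales ff k) xi - ufour tau s x0 hb N [::] xi).
  apply: le_trans _ (le_normcD _ _); rewrite /d.
  by rewrite addrA subrK.
have e : 1 / 2 - 1 / 2 ^+ k.+2 = dl k + (1 / 2 - 1 / 2 ^+ k.+1) :> R.
  have h : (2 : R) ^+ k != 0 by rewrite expf_neq0.
  by rewrite /dl !exprS; field.
rewrite /= gE in dd a1 a2.
split; first by rewrite e; apply: le_trans dd _; rewrite lerD.
move=> ye; rewrite e mulrDl; apply: le_trans dd _; rewrite lerD //; [exact: b2|exact: a2].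
Qed.

End Sequence.

Lemma uhat_trig (R : realType) N (J : finType) (p : J -> gint) (u : J -> R) (xi : R * R) :
  uhat N p u xi =
   (\sum_j u j * cos (2 * pi * dotp xi ((p j).1%:~R / N%:R, (p j).2%:~R / N%:R))) +i*
   (- \sum_j u j * sin (2 * pi * dotp xi ((p j).1%:~R / N%:R, (p j).2%:~R / N%:R))).
Proof.
rewrite /uhat; apply: (big_ind3 (fun (z : R[i]) (a b : R) => z = a +i* (- b))) => [|z a b z' a' b' -> ->|j _].
- by apply/eqP; rewrite eq_complex /= oppr0 !eqxx.
- by apply/eqP; rewrite eq_complex /= opprD !eqxx.
rewrite /ex; set t := (X in cos (2 * pi * - X)).
have -> : dotp xi ((p j).1%:~R / N%:R, (p j).2%:~R / N%:R) = t by rewrite /dotp /t /=; ring.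
rewrite mulrN cosN sinN; apply/eqP; rewrite eq_complex /=; apply/andP.
by split; apply/eqP; ring.
Qed.

Lemma uhat_at0 (R : realType) N (J : finType) (p : J -> gint) (u : J -> R) :
  uhat N p u 0 = (\sum_j u j)%:C.
Proof.
rewrite /uhat rmorph_sum /=; apply: eq_bigr => j _.
by rewrite !mul0r addr0 mul0r oppr0 ex0 mulr1.
Qed.

(** * Placing the initial weight inside the ball *)

Section Assemble.
Variables (R : realType) (c : R * R) (r : R).
Hypothesis r0 : 0 < r.
Variable n : nat.
Hypothesis n_ge2 : (2 <= n)%N.

Let rr : R := Num.min r 1.

Definition corner N : gint := (Num.floor (N%:R * c.1) + 1, Num.floor (N%:R * c.2) + 1).
(** The sums of [n] steps take up at most half of the side [rr]; the other half covers the unit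
    added in [corner], which keeps the points to the right of [c]. Capping the side at 1 ensures
    [base_mesh N <= N]. *)
Definition base_mesh N : nat := Num.truncn (N%:R * rr / (2 * n%:R)).

Let rr0 : 0 < rr. Proof. by rewrite lt_min r0 ltr01. Qed.
Let rr1 : rr <= 1. Proof. by rewrite ge_min lexx orbT. Qed.
Let rrr : rr <= r. Proof. by rewrite ge_min lexx. Qed.
Let n2 : 2 <= n%:R :> R. Proof. by rewrite ler_nat. Qed.

Lemma base_meshP : exists N1 (K0 : R), forall N, (N1 <= N)%N ->
  [/\ (0 < N)%N, (0 < base_mesh N)%N, (base_mesh N <= N)%N &
      1 + N%:R / (base_mesh N)%:R <= K0] /\
  (forall j : base_index (base_mesh N) n,
    let p := base_point (corner N) j in
    c.1 <= p.1%:~R / N%:R <= c.1 + r /\ c.2 <= p.2%:~R / N%:R <= c.2 + r).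
Proof.
have nn : 2 <= n%:R :> R := n2; have rp : 0 < rr := rr0; have rle : rr <= 1 := rr1; have rler : rr <= r := rrr.
have d0 : 0 < 2 * n%:R :> R by lra.
exists (Num.truncn (4 * n%:R / rr)).+1, (1 + 4 * n%:R / rr) => N hN.
have hN2 : 4 * n%:R <= N%:R * rr.
  rewrite -ler_pdivrMr //; apply: ltW; apply: lt_le_trans (truncnS_gt _) _.
  by rewrite ler_nat.
have n0 : (0 < N)%N by exact: leq_trans hN.
have NR : (0 : R) < N%:R by rewrite ltr0n.
have lo : N%:R * rr / (2 * n%:R) < (base_mesh N).+1%:R by exact: truncnS_gt.
have up : (base_mesh N)%:R <= N%:R * rr / (2 * n%:R).
  by rewrite truncn_le // divr_ge0 ?mulr_ge0 // ltW.
rewrite -[(base_mesh N).+1%:R]natr1 in lo.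
move: (rr) rp rle rler lo up hN2 => rho rp rle rler lo up hN2.
have q2 : 2 <= N%:R * rho / (2 * n%:R) by rewrite ler_pdivlMr //; lra.
have b0 : (0 : R) < (base_mesh N)%:R.
  by move: q2 lo; move: (_ / _) (base_mesh N)%:R => t b q2 lo; lra.
have upN : (base_mesh N)%:R * (2 * n%:R) <= N%:R * rho by rewrite -ler_pdivlMr.
split.
  split => //; first by rewrite -(ltr0n R).
    rewrite -(ler_nat R); apply: le_trans up _; rewrite ler_pdivrMr //.
    apply: le_trans (_ : N%:R * 1 <= _); first by rewrite ler_wpM2l.
    by rewrite ler_wpM2l //; lra.
  rewrite lerD2l ler_pdivrMr // mulrAC ler_pdivlMr //.
  have : N%:R * rho <= 2 * (base_mesh N)%:R * (2 * n%:R) by rewrite -ler_pdivrMr //; lra.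
  lra.
move=> j p; have [h1 h2] := base_point_bounds (corner N) j; rewrite -/p in h1 h2.
have key (x : R) (z : int) : Num.floor (N%:R * x) + 1 <= z <= Num.floor (N%:R * x) + 1 + (n * base_mesh N)%N%:Z ->
    x <= z%:~R / N%:R <= x + r.
  move=> /andP[z1 z2].
  have f1 : (Num.floor (N%:R * x))%:~R <= N%:R * x by exact: floor_le.
  have f2 : N%:R * x < (Num.floor (N%:R * x) + 1)%:~R by exact: floorD1_gt.
  apply/andP; split.
    rewrite ler_pdivlMr // mulrC; apply: le_trans (ltW f2) _; by rewrite ler_int.
  rewrite ler_pdivrMr //; apply: le_trans (_ : (Num.floor (N%:R * x) + 1 + (n * base_mesh N)%N%:Z)%:~R <= _).
    by rewrite ler_int.
  rewrite !intrD -[((n * base_mesh N)%N%:Z)%:~R]/((n * base_mesh N)%N%:R) natrM.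
  have : N%:R * rho <= N%:R * r by rewrite ler_wpM2l.
  by nra.
by split; apply: key.
Qed.

End Assemble.

(** * The limit measure *)

Lemma ustate_neq0 (R : realType) (tau : R) s x0 hb N l (i : base_index (hb N) (s + 2)) j :
  ustate tau x0 l i != 0 -> j \in l ->
  Fker R N (hh tau s N j) (s + 3) (gprimes j) (base_point (x0 N) i) != 0.
Proof.
elim: l => // j' l IH /=; rewrite mulf_eq0 negb_or => /andP[h1 h2].
by rewrite inE => /orP[/eqP ->|/(IH h1)].
Qed.

(** The [k]-th weight is divided by its mass, which is at least 1/2; hence the factor 2 in front of
    [Theta]. *)
Lemma grid_limit_measure (R : realType) (tau : R) (s : nat) (c : R * R) (r : R)
  (ls : nat -> seq nat) (Theta : R * R -> R) : 0 < r ->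
  (forall k, exists N2, forall N, (N2 <= N)%N ->
    let uf := ufour tau s (corner c) (base_mesh r (s + 2)) N (ls k) in
    normc (uf 0 - 1) <= 1 / 2 /\
    forall xi, 2 * `|xi.1| <= N%:R -> 2 * `|xi.2| <= N%:R -> expR 1 < maxnorm xi ->
      normc (uf xi) <= Theta xi) ->
  exists mu : probability (R * R)%type R,
    (forall xi, expR 1 < maxnorm xi -> fourier_abs mu xi <= 2 * Theta xi) /\
    forall y, msupport mu y -> cball c r y /\
      forall e K, 0 < e -> exists k, (K <= k)%N /\ exists N, (0 < N)%N /\ exists p : gint,
        (forall j, j \in ls k -> Fker R N (hh tau s N j) (s + 3) (gprimes j) p != 0) /\
        maxnorm ((p.1%:~R / N%:R, p.2%:~R / N%:R) - y) < e.
Proof.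
move=> r0 hyp; have s2 : (2 <= s + 2)%N by rewrite leq_addl.
have [N1 [K0 hN1]] := base_meshP c r0 s2.
have [Nf hNf] := choice hyp.
(* Since [k <= Nk k], every fixed [xi] eventually satisfies [2 * |xi| <= Nk k]. *)
pose Nk k := maxn (Nf k) (maxn N1 k).
pose hb := base_mesh r (s + 2); pose x0 := corner c.
have NkP k : [/\ (Nf k <= Nk k)%N, (N1 <= Nk k)%N & (k <= Nk k)%N].
  by rewrite /Nk !leq_max !leqnn !orbT.
pose J k : finType := base_index (hb (Nk k)) (s + 2).
pose p k (i : J k) : gint := base_point (x0 (Nk k)) i.
pose u k (i : J k) : R := ustate tau x0 (ls k) i.
pose mass k := \sum_(i : J k) u k i.
have mass_ge k : 1 / 2 <= mass k.
  have [h1 _ _] := NkP k; have [h _] := hNf k _ h1; move: h.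
  rewrite /ufour uhat_at0 -/(mass k) => h.
  have : normc ((mass k)%:C - 1) = `|mass k - 1|.
    by rewrite /normc /= subr0 expr0n addr0 sqrtr_sqr.
  by move=> e; rewrite e ler_norml in h; lra.
have mass0 k : 0 < mass k by apply: lt_le_trans (mass_ge k); lra.
pose w k (i : J k) : R := u k i / mass k.
pose x k (i : J k) : R * R := ((p k i).1%:~R / (Nk k)%:R, (p k i).2%:~R / (Nk k)%:R).
have u0 k i : 0 <= u k i by exact: ustate_ge0.
have w0 k i : 0 <= w k i by rewrite divr_ge0 // ltW.
have w1 k : \sum_i w k i = 1.
  by rewrite -mulr_suml -/(mass k) mulfV // gt_eqF.
have xbox k i : c.1 <= (x k i).1 <= c.1 + r /\ c.2 <= (x k i).2 <= c.2 + r.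
  have [_ h1 _] := NkP k; have [_ h] := hN1 _ h1; exact: h.
have [mu [mu1 mu2]] := limit_measure r0 w0 w1 xbox.
exists mu; split => [xi xe|y ysupp]; last split.
- pose K := (Num.truncn (2 * maxnorm xi)).+1.
  have big k : (K <= k)%N -> 2 * `|xi.1| <= (Nk k)%:R /\ 2 * `|xi.2| <= (Nk k)%:R.
    move=> Kk; have [_ _ h3] := NkP k.
    have : 2 * maxnorm xi <= (Nk k)%:R.
      apply: ltW; apply: lt_le_trans (truncnS_gt _) _.
      by rewrite ler_nat (leq_trans Kk).
    have : `|xi.1| <= maxnorm xi by rewrite /maxnorm le_max lexx.
    have : `|xi.2| <= maxnorm xi by rewrite /maxnorm le_max lexx orbT.
    by move=> a1 a2 a3; split; lra.
  have bnd k : (K <= k)%N -> normc (uhat (Nk k) (p k) (u k) xi) <= Theta xi.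
    move=> Kk; have [b1 b2] := big k Kk.
    by have [h1 _ _] := NkP k; have [_ h] := hNf k _ h1; exact: h.
  have Th0 : 0 <= Theta xi by apply: le_trans (bnd K (leqnn _)); exact: normc_ge0.
  apply: (mu1 xi _ K) => [|k Kk]; first by rewrite mulr_ge0.
  pose f (g : R -> R) := \sum_i w k i * g (2 * pi * dotp xi (x k i)).
  have fE (g : R -> R) : f g = (\sum_i u k i * g (2 * pi * dotp xi (x k i))) / mass k.
    by rewrite mulr_suml; apply: eq_bigr => i _; rewrite /w mulrAC.
  rewrite -/(f cos) -/(f sin) !fE.
  have := bnd k Kk; rewrite uhat_trig /normc sqrrN => hb1.
  set S1 := \sum_i u k i * cos _ in hb1 *; set S2 := \sum_i u k i * sin _ in hb1 *.
  have h2 : S1 ^+ 2 + S2 ^+ 2 <= Theta xi ^+ 2.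
    rewrite -(@sqr_sqrtr _ (S1 ^+ 2 + S2 ^+ 2)) ?addr_ge0 ?sqr_ge0 //.
    by rewrite lerXn2r ?nnegrE ?sqrtr_ge0.
  rewrite !expr_div_n -mulrDl ler_pdivrMr ?exprn_gt0 //; apply: le_trans h2 _.
  rewrite -exprMn lerXn2r ?nnegrE ?mulr_ge0 ?(ltW (mass0 k)) //.
  by have := mass_ge k; move: (mass k) Th0 => m Th0 hm; nra.
- rewrite /cball /= leNgt; apply/negP => hy.
  have e0 : 0 < maxnorm (y - c) - r by rewrite subr_gt0.
  have [k [_ [i [_ hi]]]] := mu2 y ysupp _ 0%N e0.
  have xc : maxnorm (x k i - c) <= r.
    have [/andP[x1 x2] /andP[x3 x4]] := xbox k i.
    rewrite /maxnorm ge_max !ler_norml.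
    by move: x1 x2 x3 x4; case: (x k i) => a b /= *; apply/andP; split; apply/andP; split; lra.
  have : maxnorm (y - c) <= maxnorm (y - x k i) + maxnorm (x k i - c).
    by apply: le_trans _ (maxnormD _ _); rewrite addrA subrK.
  have -> : maxnorm (y - x k i) = maxnorm (x k i - y).
    by rewrite /maxnorm /= distrC [X in Num.max _ X]distrC.
  by lra.
move=> e K e0; have [k [Kk [i [wi hi]]]] := mu2 y ysupp e K e0.
exists k; split => //; exists (Nk k); have [_ h1 _] := NkP k; have [[n0 _ _ _] _] := hN1 _ h1.
split => //; exists (p k i); split => // j jl.
apply: (ustate_neq0 (l := ls k)) => //; rewrite -/(u k i).
by move: wi; rewrite /w; apply: contraTneq => ->; rewrite mul0r ltxx.
Qed.

Lemma Estar_unbounded (R : realType) (tau : R) (y : R * R) :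
  (forall Bd : nat, exists q : gint, exists rs : int * int, [/\ (Bd < gn q)%N, q != 0 &
     maxnorm (gmul q y - (rs.1%:~R, rs.2%:~R)) <= Defs.gnorm R q `^ (- tau)]) -> Estar tau y.
Proof.
move=> h; rewrite /Estar /= => /finite_seqP[S SE].
have [q [rs [qB q0 hq]]] := h (\max_(z <- S) gn z.1)%N.
have : [set` S] (q, rs) by rewrite -SE; split.
move=> /= qS; move: qB; rewrite ltnNge => /negP; apply.
exact: (@leq_bigmax_seq _ S predT (fun z => gn z.1) (q, rs)).
Qed.

(** Rounding down leaves an error at most 1 in each coordinate, and [|q| ^ (- tau) >= 1] for
    positive integers [q]. *)
Lemma Estar_nonpos (R : realType) (tau : R) (y : R * R) : tau <= 0 -> Estar tau y.
Proof.
move=> t0; apply: Estar_unbounded => Bd.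
pose q : gint := (Bd.+1%:Z, 0).
exists q, (Num.floor (Bd.+1%:R * y.1), Num.floor (Bd.+1%:R * y.2)); split.
- by rewrite gn_absz /= -mulnn; nia.
- by [].
apply: le_trans (_ : 1 <= _); last first.
  rewrite -[leLHS](powRr0 (Defs.gnorm R q)) ler_powR ?oppr_ge0 // /Defs.gnorm le_max /=.
  by rewrite ger0_norm // -[_%:~R]/(Bd.+1%:R) ler1n.
have fl (z : R) : `|z - (Num.floor z)%:~R| <= 1.
  have f1 : (Num.floor z)%:~R <= z by exact: floor_le.
  have f2 : z < (Num.floor z + 1)%:~R by exact: floorD1_gt.
  by rewrite intrD in f2; rewrite ger0_norm; lra.
rewrite /maxnorm /gmul /= ge_max !mul0r subr0 addr0 -[_%:~R]/(Bd.+1%:R).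
by apply/andP; split; exact: fl.
Qed.

(** A nonvanishing average has a nonvanishing term, and in the support of the B-spline the
    coordinates of [q * p] exceed multiples of [N] by at most [(s + 3) * N * eta], half of the
    tolerance times [N]. *)
Lemma Fker_approx (R : realType) (tau : R) s N j (p : gint) : 0 < tau -> (0 < N)%N ->
  Fker R N (hh tau s N j) (s + 3) (gprimes j) p != 0 ->
  exists2 q : gint, q \in gprimes j & exists rs : gint,
    maxnorm (gmul q (p.1%:~R / N%:R, p.2%:~R / N%:R) - (rs.1%:~R, rs.2%:~R)) <=
      (2 ^+ j.+1) `^ (- tau) / 2.
Proof.
move=> t0 n0 Fn0.
have [q qQ] : exists2 q, q \in gprimes j &
    bspline R N (hh tau s N j) (s + 3) (q * p).1 * bspline R N (hh tau s N j) (s + 3) (q * p).2 != 0.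
  apply: contrapT => hn; move: Fn0; rewrite /Fker big1_seq ?mulr0 ?eqxx // => q /= qQ.
  by apply/eqP; apply: contrapT => /negP h; apply: hn; exists q.
rewrite mulf_eq0 negb_or => /andP[b1 b2]; exists q => //.
have NR : (0 : R) < N%:R by rewrite ltr0n.
have key (z : int) : bspline R N (hh tau s N j) (s + 3) z != 0 ->
    exists t : int, `|z%:~R / N%:R - t%:~R : R| <= (2 ^+ j.+1) `^ (- tau) / 2.
  move=> h0; have [z' [z1 /dvdnP[k hk]]] := bspline_support h0.
  have /dvdzP[t ht] : (N %| (z - z'%:Z)%R)%Z by apply/dvdnP; exists k.
  exists t; have -> : z%:~R / N%:R - t%:~R = z'%:R / N%:R :> R.
    rewrite -[z](subrK (z' : int)) ht /= intrD intrM -[(N : int)%:~R]/(N%:R).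
    by rewrite -[(z' : int)%:~R]/(z'%:R); field; rewrite gt_eqF.
  rewrite ger0_norm ?divr_ge0 // ler_pdivrMr //.
  apply: le_trans (_ : (s + 3)%:R * (N%:R * eta tau s j) <= _).
    apply: le_trans (_ : (s + 3)%:R * (hh tau s N j)%:R <= _); first by rewrite -natrM ler_nat.
    by rewrite ler_wpM2l // truncn_le // mulr_ge0 // ltW // eta_gt0.
  rewrite le_eqVlt; apply/orP; left; apply/eqP; rewrite /eta.
  have h3 : ((s + 3)%:R : R) != 0 by rewrite pnatr_eq0 addn3.
  by field; rewrite -natrD h3.
have [t1 h1] := key _ b1; have [t2 h2] := key _ b2.
exists (t1, t2); rewrite /maxnorm /gmul ge_max /=; apply/andP; split.
  apply: le_trans h1; rewrite gint_mulE /= rmorphB /= !rmorphM /= mulrBl !mulrA //.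
apply: le_trans h2; rewrite gint_mulE /= rmorphD /= !rmorphM /= mulrDl !mulrA //.
Qed.

(** For a fixed scale [f Bd], its kernel is present in all weights with [k > Bd], so grid points
    where it does not vanish come arbitrarily close to [y]. The primes of this shell have norm above
    [Bd]. *)
Lemma Estar_support (R : realType) (tau : R) s (f : nat -> nat) (y : R * R) : 0 < tau ->
  (forall k, (k <= f k)%N) ->
  (forall e K, 0 < e -> exists k, (K <= k)%N /\ exists N, (0 < N)%N /\ exists p : gint,
    (forall j, j \in first_scales f k -> Fker R N (hh tau s N j) (s + 3) (gprimes j) p != 0) /\
    maxnorm ((p.1%:~R / N%:R, p.2%:~R / N%:R) - y) < e) ->
  Estar tau y.
Proof.
move=> t0 fk hyp; apply: Estar_unbounded => Bd.
(* Multiplication by [q] enlarges a displacement [e] to at most [2 * B * e], which is the half of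
   the tolerance left over by [Fker_approx]. *)
pose j := f Bd; pose B : R := 2 ^+ j.+1; pose e := B `^ (- tau) / (4 * B).
have B0 : 0 < B by rewrite exprn_gt0.
have e0 : 0 < e by rewrite divr_gt0 ?powR_gt0 // mulr_gt0.
have [k [Kk [N [n0 [p [hp py]]]]]] := hyp e Bd.+1 e0.
have [q qQ [rs hq]] := Fker_approx t0 n0 (hp j (mem_first_scales _ Kk)).
have [qq _ lo up] := (mem_gprimes _ _).1 qQ; have [q1 q2] := @gprimes_le R _ _ qQ.
have qn0 := quad_neq0 _ qq.
exists q, rs; split => //.
  by apply: leq_trans lo; apply: leq_ltn_trans (fk Bd) _; exact: ltn_expl.
set z := (_, _) in hq py; clearbody z.
have gB : Defs.gnorm R q <= B by rewrite /Defs.gnorm ge_max q1.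
have g0 : 0 < Defs.gnorm R q.
  rewrite /Defs.gnorm lt_max !normr_gt0 !intr_eq0 -negb_and; apply: contra qn0.
  by case: (q) => a b /= /andP[/eqP -> /eqP ->].
apply: le_trans (_ : B `^ (- tau) <= _); last first.
  by rewrite !powRN lef_pV2 ?posrE ?powR_gt0 // ge0_ler_powR ?nnegrE // ltW.
have hz : maxnorm (gmul q y - gmul q z) <= B `^ (- tau) / 2.
  have : 2 * B * e = B `^ (- tau) / 2 by rewrite /e; field; rewrite gt_eqF.
  move=> <-; have : `|z.1 - y.1| <= e /\ `|z.2 - y.2| <= e.
    by move: py; rewrite /maxnorm gt_max /= => /andP[a1 a2]; split; exact: ltW.
  move=> [d1 d2]; rewrite /maxnorm ge_max /gmul /=; apply/andP.
  have P (a b : R) (x x' y' y'' : R): `|a| <= B -> `|b| <= B -> `|x - y'| <= e -> `|x' - y''| <= e ->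
      `|a * (x - y') + b * (x' - y'')| <= 2 * B * e.
    move=> ha hb hx hx'; apply: le_trans (ler_normD _ _) _; rewrite !normrM.
    rewrite (_ : 2 * B * e = B * e + B * e); last by ring.
    by rewrite lerD // ler_pM.
  split.
    rewrite [X in `|X|](_ : _ = (- q.1%:~R) * (z.1 - y.1) + q.2%:~R * (z.2 - y.2)); last by ring.
    by apply: P; rewrite ?normrN.
  rewrite [X in `|X|](_ : _ = (- q.1%:~R) * (z.2 - y.2) + (- q.2%:~R) * (z.1 - y.1)); last by ring.
  by apply: P; rewrite ?normrN.
rewrite -[X in maxnorm (X - _)](subrK (gmul q z)) -[X in maxnorm X]addrA.
by apply: le_trans (maxnormD _ _) _; rewrite [leRHS]splitr lerD.
Qed.

Lemma decay_lower (R : realType) (tau y : R) s : 2 / (1 + tau) <= s%:R -> expR 1 < y ->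
  (((1 + y) / 2) ^+ s)^-1 <= 2 ^+ s * decay tau y.
Proof.
move=> as_ ye; have y1 : 1 < y by apply: lt_trans ye; rewrite expR_gt1.
have y0 : 0 < y by exact: lt_trans ltr01 y1.
rewrite expr_div_n invf_div ler_wpM2l ?exprn_ge0 //; apply: le_trans _ (decay_ge tau ye).
rewrite powRN lef_pV2 ?posrE ?powR_gt0 ?exprn_gt0 ?addr_gt0 //.
apply: le_trans (_ : y ^+ s <= _); last by rewrite lerXn2r ?nnegrE ?lerDr // ltW // addr_gt0.
by rewrite -powR_mulrn ?(ltW y0) // ler_powR // ltW.
Qed.

Lemma ufour_decay (R : realType) (tau : R) s x0 hb N1 K0 :
  (forall N, (N1 <= N)%N ->
    [/\ (0 < N)%N, (0 < hb N)%N, (hb N <= N)%N & 1 + N%:R / (hb N)%:R <= K0]) ->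
  2 / (1 + tau) <= s%:R ->
  forall N, (N1 <= N)%N -> forall xi, 2 * `|xi.1| <= N%:R -> 2 * `|xi.2| <= N%:R ->
  expR 1 < maxnorm xi ->
  normc (ufour tau s x0 hb N [::] xi) <= K0 ^+ (s + s + 2) * 2 ^+ s * decay tau (maxnorm xi).
Proof.
move=> hbP as_ N NN xi x1 x2 xe; have h := ufour_base tau s x0 hbP NN x1 x2.
have y0 : 0 < maxnorm xi by apply: lt_trans xe; exact: expR_gt0.
have z0 : 0 < ((1 + maxnorm xi) / 2) ^+ s by rewrite exprn_gt0 // divr_gt0 // addr_gt0.
apply: le_trans (_ : K0 ^+ (s + s + 2) * (((1 + maxnorm xi) / 2) ^+ s)^-1 <= _).
  by rewrite ler_pdivlMr.
rewrite -mulrA ler_wpM2l ?decay_lower //.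
by apply: le_trans h; rewrite mulr_ge0 ?normc_ge0 // ltW.
Qed.

Unset Implicit Arguments.

Theorem theorem1 (R : realType) (tau : R) (htau : tau != -1)
  (c : R * R) (r : R) (hr : 0 < r) :
  exists (mu : probability (R * R)%type R) (C : R),
    msupport mu `<=` Estar tau `&` cball c r /\ 0 < C /\
    forall xi : R * R, expR 1 < maxnorm xi ->
      fourier_abs mu xi <=
        C * maxnorm xi `^ (- 2 / (1 + tau)) *
        expR (ln (maxnorm xi) / ln (ln (maxnorm xi))).
Proof.
(* Decay of order [s] of the initial weight is at least as fast as the target. For [tau < -1] the
   truncation is 0 and [s = 1]. *)
pose s := (Num.truncn (2 / (1 + tau))).+1.
have as_ : 2 / (1 + tau) <= s%:R by rewrite ltW // truncnS_gt.
have s2 : (2 <= s + 2)%N by rewrite leq_addl.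
have [N1 [K0 hN1]] := base_meshP c hr s2.
have hbP N (NN : (N1 <= N)%N) := (hN1 N NN).1.
have K0_ge0 : 0 <= K0.
  by have [_ _ _] := hbP _ (leqnn N1); apply: le_trans; rewrite addr_ge0 // divr_ge0.
(* The constant of the initial weight plus the total change by all kernels. *)
pose D := K0 ^+ (s + s + 2) * 2 ^+ s + 1 / 2.
have D0 : 0 < D by rewrite ltr_wpDl // !mulr_ge0 ?exprn_ge0.
(* The two ranges of [tau] differ only in the list of scales; for [tau <= 0] it is empty and the
   initial weight alone has the required decay. *)
suff [ls hls hE] : exists2 ls : nat -> seq nat,
    (forall k, exists N2, forall N, (N2 <= N)%N -> forall xi,
      2 * `|xi.1| <= N%:R -> 2 * `|xi.2| <= N%:R ->
      let d := normc (ufour tau s (corner c) (base_mesh r (s + 2)) N (ls k) xi -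
                      ufour tau s (corner c) (base_mesh r (s + 2)) N [::] xi) in
      d <= 1 / 2 /\ (expR 1 < maxnorm xi -> d <= 1 / 2 * decay tau (maxnorm xi))) &
    forall y : R * R, (forall e K, 0 < e -> exists k, (K <= k)%N /\
      exists N, (0 < N)%N /\ exists p : gint,
        (forall j, j \in ls k -> Fker R N (hh tau s N j) (s + 3) (gprimes j) p != 0) /\
        maxnorm ((p.1%:~R / N%:R, p.2%:~R / N%:R) - y) < e) -> Estar tau y.
  have [|mu [mu1 mu2]] := @grid_limit_measure R tau s c r ls (fun xi => D * decay tau (maxnorm xi)) hr.
    move=> k; have [N2 hN2] := hls k; exists (maxn N1 N2) => N.
    rewrite geq_max => /andP[n1 n2] uf; split.
      have z0 : 2 * `|(0 : R * R).1| <= N%:R by rewrite normr0 mulr0.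
      have [] := hN2 N n2 0 z0 z0.
      by rewrite (ufour_base0 tau s (corner c) hbP n1).
    move=> xi x1 x2 xe; have [_ /(_ xe) h] := hN2 N n2 xi x1 x2.
    rewrite /D mulrDl addrC -[uf xi](subrK (ufour tau s (corner c) (base_mesh r (s + 2)) N [::] xi)).
    apply: le_trans (le_normcD _ _) _; apply: lerD => //.
    exact: (ufour_decay (corner c) hbP as_ n1 x1 x2 xe).
  exists mu, (2 * D); split; [|split; first by rewrite mulr_gt0].
    by move=> y /mu2[yc /hE].
  by move=> xi /mu1; rewrite mulrA /decay [X in _ <= X -> _]mulrA.
have [t0|t0] := leP tau 0.
  exists (fun=> [::]) => [k|y _]; last exact: Estar_nonpos.
  exists 0%N => N _ xi _ _ /=; rewrite subrr normc0; split; first by lra.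
  by move=> _; rewrite !mulr_ge0 ?powR_ge0 ?expR_ge0.
have [f [fk hf]] := scale_sequence (corner c) hbP t0 as_.
exists (first_scales f) => // y; exact: Estar_support.
Qed.
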